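(* Let $S$ be a non-empty finite set of places of $K$, let $n\geq 3$ be an integer and let $q(x_1,\dots,x_n)$ be a non-degenerate quadratic form over $K$. If $\alpha\in K^{\times}$, then the affine quadric over $K$ with equation $q(x_1,\dots,x_n)=\alpha$ satisfies purity of strong approximation off $S$.
   Context: $K$ is the function field of a smooth projective irreducible curve $\Gamma$ over $\mathbf{C}$; $\Omega_K$ is its set of places, identified with $\Gamma(\mathbf{C})$. For $v\in\Omega_K$, $K_v$ is the completion of $K$ at $v$ and $\mathscr{O}_v$ its ring of integers. A $K$-variety is a separated $K$-scheme of finite type. For a finite $S\subset\Omega_K$, $\mathscr{O}_{K,S}$ is the ring of elements of $K$ that are integral outside $S$; an $\mathscr{O}_{K,S}$-model of a $K$-variety $X$ is a separated $\mathscr{O}_{K,S}$-scheme of finite type with generic fibre isomorphic to $X$. $\mathbf{A}_K^S$ is the ring of adeles off $S$ (families $(x_v)_{v\in\Omega_K\setminus S}\in\prod_{v\notin S}K_v$ with $x_v\in\mathscr{O}_v$ for all but finitely many $v$). If $S'\supset S$ is finite and $\mathscr{X}$ is an $\mathscr{O}_{K,S'}$-model of $X$, then $X(\mathbf{A}_K^S)=\varinjlim_{S'\subset T\text{ finite}}\prod_{v\in T\setminus S}X(K_v)\times\prod_{v\in\Omega_K\setminus T}\mathscr{X}(\mathscr{O}_v)$, which carries the adelic (restricted product) topology, independent of $S'$ and $\mathscr{X}$. Strong approximation off $S$ for a $K$-variety $X$: if $X(K_v)\neq\emptyset$ for all $v\in S$, then the diagonal image of $X(K)$ in $X(\mathbf{A}_K^S)$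 is dense. Purity of strong approximation off $S$ for a $K$-variety $X$: for every closed subset $Z\subset X$ of codimension at least $2$ (including $Z=\emptyset$), the open subvariety $X\setminus Z$ satisfies strong approximation off $S$. *)

(* Defs.v *)
From HB Require Import structures.
From mathcomp Require Import all_boot all_order all_algebra.
(* Importing mpoly after the analysis libraries fails (incompatible notation
   levels); this order works. *)
From mathcomp Require Import ring_quotient complex mpoly.
From mathcomp Require Import boolp classical_sets cardinality.
From mathcomp Require Import reals constructive_ereal topology.

Set Implicit Arguments.
Unset Strict Implicit.
Unset Printing Implicit Defensive.

Import Order.TTheory GRing.Theory Num.Theory.
Local Open Scope classical_set_scope.
Local Open Scope ring_scope.

Definition prime_ideal (A : comNzRingType) (P : {pred A}) : Prop :=
  idealr_closed P /\ prime_idealr_closed P.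

Definition ideal_span (A : comNzRingType) (s : seq A) : {pred A} :=
  [pred f | `[< exists c : nat -> A, f = \sum_(k < size s) c k * s`_k >]].

(* The curve [V(eqs)] in [P^N], and its function field. *)
Section FunctionField.
Variables (C K : fieldType) (j : {rmorphism C -> K}).

Definition alg_independent (m : nat) (y : 'I_m -> K) : Prop :=
  forall p : {mpoly C[m]}, mmap j y p = 0 -> p = 0.

Definition has_trdeg (d : nat) : Prop :=
  (exists y : 'I_d -> K, alg_independent y) /\
  (forall y : 'I_d.+1 -> K, ~ alg_independent y).

(* [eqs] generates the homogeneous ideal of an integral closed subscheme of
   [P^N]; being proper and prime is not enough, since the irrelevant ideal
   defines the empty scheme. *)
Definition projective_variety (N : nat) (eqs : seq {mpoly C[N.+1]}) : Prop :=
  [/\ forall f, f \in eqs -> exists d : nat, f \is d.-homog,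
      prime_ideal (ideal_span eqs) &
      exists i : 'I_N.+1, 'X_i \notin ideal_span eqs].

Definition jacobian (N : nat) (eqs : seq {mpoly C[N.+1]}) (a : 'I_N.+1 -> C) :
    'M[C]_(size eqs, N.+1) :=
  \matrix_(i < size eqs, k < N.+1) ((eqs`_i)^`M(k)).@[a].

(* Projective Jacobian criterion; [C] is meant to be algebraically closed, so
   that the closed points are the lines spanned by such [a]. *)
Definition smooth_of_dim (N : nat) (eqs : seq {mpoly C[N.+1]}) (d : nat) :
    Prop :=
  forall a : 'I_N.+1 -> C, (exists i, a i != 0) ->
    (forall f, f \in eqs -> f.@[a] = 0) ->
    (\rank (jacobian eqs a) + d)%N = N.

(* [K] is the field of the fractions [f / g] of homogeneous elements of the same
   degree of the homogeneous coordinate ring; [xi] is a system of homogeneous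
   coordinates of the generic point. *)
Definition is_function_field (N : nat) (eqs : seq {mpoly C[N.+1]}) : Prop :=
  exists xi : 'I_N.+1 -> K,
    (forall (d : nat) (f : {mpoly C[N.+1]}), f \is d.-homog ->
       (mmap j xi f = 0 <-> f \in ideal_span eqs)) /\
    (forall y : K, exists (d : nat) (f g : {mpoly C[N.+1]}),
       [/\ f \is d.-homog, g \is d.-homog, mmap j xi g != 0 &
           y = mmap j xi f / mmap j xi g]).

(* The dimension of a variety is the transcendence degree of its function
   field. *)
Definition function_field_of_smooth_projective_curve : Prop :=
  exists (N : nat) (eqs : seq {mpoly C[N.+1]}),
    [/\ projective_variety eqs, is_function_field eqs, has_trdeg 1 &
        smooth_of_dim eqs 1].

End FunctionField.

Record discrete_valuation (L : fieldType) (v : L -> \bar int) : Prop := {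
  dvaluation0 : v 0 = +oo%E;
  dvaluation_fin : forall x, x != 0 -> exists k : int, v x = k%:E%E;
  dvaluationM : forall x y, v (x * y)%R = (v x + v y)%E;
  dvaluationD : forall x y, (Order.min (v x) (v y) <= v (x + y)%R)%E
}.

(* Normalized discrete valuations of [K] that are trivial on [C]; for a smooth
   projective curve these are the orders of vanishing at its closed points. *)
Record place (C K : fieldType) (j : {rmorphism C -> K}) := Place {
  place_val :> K -> \bar int;
  place_valuation : discrete_valuation place_val;
  place_const : forall c : C, c != 0 -> place_val (j c) = 0%E;
  place_normalized : exists x : K, place_val x = 1%:E%E
}.

(* The completion of [(K, v)], by its characterization: a complete discretely
   valued field in which [(K, v)] embeds isometrically with dense image.  It is
   unique up to a unique isomorphism of valued extensions of [K]. *)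
Record completion (K : fieldType) (v : K -> \bar int) := Completion {
  cfield :> fieldType;
  cinj : {rmorphism K -> cfield};
  cval : cfield -> \bar int;
  cval_valuation : discrete_valuation cval;
  cval_inj : forall a : K, cval (cinj a) = v a;
  cinj_dense : forall (x : cfield) (N : int),
    exists a : K, (N%:E <= cval (x - cinj a)%R)%E;
  cval_complete : forall u : nat -> cfield,
    (forall N : int, exists m : nat, forall i k : nat, (m <= i)%N -> (m <= k)%N ->
       (N%:E <= cval (u i - u k)%R)%E) ->
    exists l : cfield, forall N : int, exists m : nat, forall i : nat,
      (m <= i)%N -> (N%:E <= cval (u i - l)%R)%E
}.

Definition integer_ring (K : fieldType) (v : K -> \bar int)
    (Kv : completion v) : set Kv := [set x | (0 <= cval x)%E].

(* The product topology on the power [Kv^n] of the valued field [Kv]. *)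
Definition valued_open (K : fieldType) (v : K -> \bar int) (Kv : completion v)
    (n : nat) (A : set ('I_n -> Kv)) : Prop :=
  forall x, A x -> exists N : int, forall y : 'I_n -> Kv,
    (forall k, (N%:E <= cval (y k - x k)%R)%E) -> A y.
Arguments valued_open {K v} Kv {n} A.

(* A pair of lists [gs], [fs] of polynomials stands for the quasi-affine scheme
   [V(gs) \ V(fs)]: the complement, in the closed subscheme [V(gs)] of affine
   [n]-space, of the closed subset [V(gs) /\ V(fs)].  Every closed subset of
   [V(gs)] is of this form, polynomial rings over fields being Noetherian. *)
Section QuasiAffine.
Variables (K : fieldType) (n : nat) (gs fs : seq {mpoly K[n]}).

(* The points of [V(gs) \ V(fs)] with values in the subring [O] of the extension
   [L] of [K]: a point of [V(gs)] over [O] is a point of the open subscheme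
   exactly when the values of the [fs] generate the unit ideal of [O].  Taking
   [O := setT] gives the [L]-points. *)
Definition qaff_points (L : fieldType) (i : {rmorphism K -> L}) (O : set L) :
    set ('I_n -> L) :=
  [set x | [/\ forall k, O (x k),
               forall g, g \in gs -> mmap i x g = 0 &
               exists c : nat -> L, (forall k, O (c k)) /\
                 \sum_(k < size fs) c k * mmap i x fs`_k = 1]].

(* [V(gs) /\ V(fs)] has codimension at least [d] in [V(gs)]: each of its closed
   irreducible subsets [V(P)] is the smallest term of a chain of [d] strict
   inclusions of closed irreducible subsets [V(p k)] of [V(gs)].  This holds
   vacuously if [V(gs) /\ V(fs)] is empty. *)
Definition codim_ge (d : nat) : Prop :=
  forall P : {pred {mpoly K[n]}}, prime_ideal P -> {subset gs ++ fs <= P} ->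
  exists p : nat -> {pred {mpoly K[n]}},
    [/\ forall k, (k <= d)%N -> prime_ideal (p k) /\ {subset gs <= p k},
        forall k, (k < d)%N ->
          {subset p k <= p k.+1} /\ ~ {subset p k.+1 <= p k} &
        p d =i P].

End QuasiAffine.

Definition off (T : Type) (S : set T) : Type := {v : T | ~ S v}.

Section Adelic.
Variables (C K : fieldType) (j : {rmorphism C -> K}).
Variable Kv : forall v : place j, completion v.
Variables (S S' : set (place j)) (n : nat) (gs fs : seq {mpoly K[n]}).

(* The coefficients of the equations lie in the ring of [S']-integers, so that
   they define a model of [V(gs) \ V(fs)] over that ring. *)
Definition model_off : Prop :=
  forall g, g \in gs ++ fs -> forall v : place j, ~ S' v ->
  forall m : 'X_{1..n}, (0 <= v (g@_m))%E.

Definition local_points (v : place j) : set ('I_n -> Kv v) :=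
  qaff_points gs fs (cinj (Kv v)) setT.

Definition integral_points (v : place j) : set ('I_n -> Kv v) :=
  qaff_points gs fs (cinj (Kv v)) (integer_ring (Kv := Kv v)).

Definition rational_points : set ('I_n -> K) :=
  qaff_points gs fs (idfun : {rmorphism K -> K}) setT.

(* Families of local points indexed by the places outside [S]. *)
Definition is_adelic (x : forall v : off S, 'I_n -> Kv (sval v)) : Prop :=
  (forall v : off S, local_points (x v)) /\
  exists T : set (place j), [/\ finite_set T, S' `<=` T &
    forall v : off S, ~ T (sval v) -> integral_points (x v)].

Record adelic_points := AdelicPoints {
  adelic_family :> forall v : off S, 'I_n -> Kv (sval v);
  adelic_familyP : is_adelic adelic_family
}.

HB.instance Definition _ := gen_eqMixin adelic_points.
HB.instance Definition _ := gen_choiceMixin adelic_points.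

(* The products, over the places outside [S], of open sets of local points at
   the places of a finite [T] containing [S'] and of all the integral points
   elsewhere. *)
Definition adelic_basic : set (set adelic_points) :=
  [set W : set adelic_points | exists (T : set (place j))
             (A : forall v : place j, set ('I_n -> Kv v)),
     [/\ finite_set T, S' `<=` T, forall v, valued_open (Kv v) (A v) &
         W = [set x : adelic_points | forall v : off S,
                (T (sval v) -> A (sval v) (x v)) /\
                (~ T (sval v) -> integral_points (x v))]]].

HB.instance Definition _ :=
  isSubBaseTopological.Build adelic_points adelic_basic id.

Definition diagonal_points : set adelic_points :=
  [set x : adelic_points | exists2 a, rational_points a &
     forall v : off S, x v = cinj (Kv (sval v)) \o a].

End Adelic.
Arguments local_points {C K j} Kv {n} gs fs v.
Arguments diagonal_points {C K j} Kv S S' {n} gs fs.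

(* The adelic space and its topology do not depend on the finite set [S'] over
   which the equations define a model, so quantifying over it is harmless. *)
Definition strong_approximation (C K : fieldType) (j : {rmorphism C -> K})
    (Kv : forall v : place j, completion v) (S : set (place j)) (n : nat)
    (gs fs : seq {mpoly K[n]}) : Prop :=
  forall S' : set (place j), finite_set S' -> S `<=` S' -> model_off S' gs fs ->
    (forall v, S v -> local_points Kv gs fs v !=set0) ->
    dense (diagonal_points Kv S S' gs fs).

Definition purity_of_strong_approximation (C K : fieldType)
    (j : {rmorphism C -> K}) (Kv : forall v : place j, completion v)
    (S : set (place j)) (n : nat) (gs : seq {mpoly K[n]}) : Prop :=
  forall fs : seq {mpoly K[n]}, codim_ge gs fs 2 ->
    strong_approximation Kv S gs fs.

Definition quadratic_form (K : fieldType) (n : nat) (q : {mpoly K[n]}) : Prop :=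
  q \is 2.-homog.

(* The polar bilinear form of [q] has trivial radical. *)
Definition nondegenerate_quadratic_form (K : fieldType) (n : nat)
    (q : {mpoly K[n]}) : Prop :=
  forall x : 'I_n -> K,
    (forall y : 'I_n -> K, q.@[fun k => x k + y k] - q.@[x] - q.@[y] = 0) ->
    forall k, x k = 0.

(* Main.v *)
Require Import Defs.
From HB Require Import structures.
From mathcomp Require Import all_boot all_order all_algebra.
From mathcomp Require Import ring_quotient complex mpoly.
From mathcomp Require Import boolp classical_sets cardinality.
From mathcomp Require Import reals constructive_ereal topology.
From mathcomp Require Import lebesgue_measure.
From mathcomp Require Import zify ring.

Set Implicit Arguments.
Unset Strict Implicit.
Unset Printing Implicit Defensive.

Import Order.TTheory GRing.Theory Num.Theory.
Local Open Scope classical_set_scope.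
Local Open Scope ring_scope.

(** Strong approximation for the affine line follows from weak approximation and
    from the existence of a function whose only pole is a given place of [S].
    By Tsen's theorem [q] is isotropic, so the quadric has an equation
    [x y + c t ^ 2 + r z = alpha]: once [x] and [z] are chosen, [t] is a point of
    an affine line and [y] is determined by the congruence condition modulo [x].

    A closed subset of codimension at least 2 of the quadric, of dimension
    [n - 1], imposes a polynomial relation on any [n - 2] functions; this is
    applied to [(x, z)], [(y, z)] and [(t, z)], the last relation being monic in
    [t] for a general choice of the third basis vector. A point with integral
    coordinates reduces outside the closed subset at every place where one of
    these relations takes a unit value. For a general [z] the first relation
    fails only at finitely many places, where [t] can be corrected by the third
    one if [x] is a unit, and by the second one, through [y], if it is not. *)

(** * Valuations *)

(** What shapes the proof is the order of the choices: each value makes new places bad and cannot be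
    changed afterwards. The finite set [T] is fixed first. A general [z] then adds places where the
    relations in [x] and in [y] may vanish identically modulo the place; only the relation in [t] is
    sure to survive there, its top coefficient in [t] being an element of [K] that is a unit outside
    [T] for every [z]. This is why the third basis vector has to be general. The choice of [x] adds
    the places where [x] or the first relation is not a unit. At a zero of [x] the equation
    [c t ^ 2 = d] leaves [t] only two classes modulo [x], which the relation in [t] may both forbid,
    whereas [y] can still take any residue. The needed residues exist because all residue fields are
    [C], infinite and closed under square roots. Tsen's theorem is reduced to a nontrivial common
    zero of few quadrics over [C]. Its Nullstellensatz is a counting argument that needs [C]
    uncountable, and the only dimension theory, for codimension too, is the comparison of numbers of
    monomials. *)

Definition vge (L : fieldType) (v : L -> \bar int) (N : int) (x : L) : bool :=
  (N%:E <= v x)%E.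

(** [fine] sends [+oo] to 0, so [vord v 0] is the junk value 0; hence the hypotheses [x != 0] in the
    rules for [vord], which [vge] does not need. *)
Definition vord (L : fieldType) (v : L -> \bar int) (x : L) : int := fine (v x).

Section Valuation.
Variables (L : fieldType) (v : L -> \bar int).
Hypothesis hv : discrete_valuation v.
Implicit Types (x y : L) (N M : int).

Lemma vordE x : x != 0 -> v x = (vord v x)%:E%E.
Proof. by move=> x0; have [k vk] := dvaluation_fin hv x0; rewrite /vord vk. Qed.

Lemma vge0 N : vge v N 0.
Proof. by rewrite /vge (dvaluation0 hv) leey. Qed.

Lemma vge_ord N x : x != 0 -> vge v N x = (N <= vord v x).
Proof. by move=> x0; rewrite /vge vordE // lee_fin. Qed.

Lemma vordM x y : x != 0 -> y != 0 -> vord v (x * y) = vord v x + vord v y.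
Proof.
move=> x0 y0; have := dvaluationM hv x y.
by rewrite !vordE ?mulf_neq0 // -EFinD => -[].
Qed.

Lemma vord1 : vord v 1 = 0.
Proof.
have := vordM (oner_neq0 L) (oner_neq0 L); rewrite mulr1 => /eqP.
by rewrite -subr_eq subrr => /eqP.
Qed.

Lemma vordV x : x != 0 -> vord v x^-1 = - vord v x.
Proof.
move=> x0; have := vordM x0 (invr_neq0 x0); rewrite divff // vord1.
by move/eqP; rewrite eq_sym addr_eq0 => /eqP ->; rewrite opprK.
Qed.

Lemma vordX x n : x != 0 -> vord v (x ^+ n) = n%:Z * vord v x.
Proof.
move=> x0; elim: n => [|n IHn]; first by rewrite expr0 vord1 mul0r.
by rewrite exprS vordM ?expf_neq0 // IHn intS; ring.
Qed.

Lemma vordN x : vord v (- x) = vord v x.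
Proof.
have [->|x0] := eqVneq x 0; first by rewrite oppr0.
have n1 : -1 != 0 :> L by rewrite oppr_eq0 oner_neq0.
have := vordM n1 n1; rewrite mulrNN mulr1 vord1 => h.
have h1 : vord v (-1) = 0 by lia.
by rewrite -mulN1r vordM // h1 add0r.
Qed.

Lemma vgeD N x y : vge v N x -> vge v N y -> vge v N (x + y).
Proof.
move=> hx hy; apply: le_trans (dvaluationD hv x y).
by rewrite le_min; apply/andP.
Qed.

Lemma vgeM N M x y : vge v N x -> vge v M y -> vge v (N + M) (x * y).
Proof.
have [->|x0] := eqVneq x 0; first by move=> *; rewrite mul0r vge0.
have [->|y0] := eqVneq y 0; first by move=> *; rewrite mulr0 vge0.
by rewrite !vge_ord ?mulf_neq0 // vordM // => hx hy; lia.
Qed.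

Lemma vgeN N x : vge v N (- x) = vge v N x.
Proof.
have [->|x0] := eqVneq x 0; first by rewrite oppr0.
by rewrite !vge_ord ?oppr_eq0 // vordN.
Qed.

Lemma vgeB N x y : vge v N x -> vge v N y -> vge v N (x - y).
Proof. by move=> hx hy; apply: vgeD => //; rewrite vgeN. Qed.

Lemma vge_le M N x : N <= M -> vge v M x -> vge v N x.
Proof. by move=> NM; apply: le_trans; rewrite lee_fin. Qed.

Lemma vgeM0 N x y : vge v 0 x -> vge v N y -> vge v N (x * y).
Proof. by move=> hx hy; rewrite -[N]add0r; apply: vgeM. Qed.

Lemma vgeM0r N x y : vge v N x -> vge v 0 y -> vge v N (x * y).
Proof. by move=> hx hy; rewrite -[N]addr0; apply: vgeM. Qed.

Lemma vge_sum (I : Type) (r : seq I) (P : pred I) (F : I -> L) N :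
  (forall i, P i -> vge v N (F i)) -> vge v N (\sum_(i <- r | P i) F i).
Proof.
by move=> h; elim/big_ind: _ => //; [exact: vge0 | move=> *; exact: vgeD].
Qed.

Lemma vge1 : vge v 0 1.
Proof. by rewrite vge_ord ?oner_neq0 // vord1. Qed.

Lemma vge_prod (I : Type) (r : seq I) (P : pred I) (F : I -> L) :
  (forall i, P i -> vge v 0 (F i)) -> vge v 0 (\prod_(i <- r | P i) F i).
Proof.
by move=> h; elim/big_ind: _ => //; [exact: vge1 | move=> *; exact: vgeM0].
Qed.

Lemma vgeX x n : vge v 0 x -> vge v 0 (x ^+ n).
Proof.
move=> hx; elim: n => [|n IHn]; first by rewrite expr0 vge1.
by rewrite exprS vgeM0.
Qed.

Lemma vgeXN N x n : vge v N x -> vge v (n%:Z * N) (x ^+ n).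
Proof.
move=> hx; elim: n => [|n IHn]; first by rewrite expr0 mul0r vge1.
rewrite exprS; have -> : n.+1%:Z * N = N + n%:Z * N by rewrite intS; ring.
exact: vgeM.
Qed.

Lemma vge_nat n : vge v 0 n%:R.
Proof.
elim: n => [|n IHn]; first exact: vge0.
by rewrite -natr1; apply: vgeD => //; exact: vge1.
Qed.

Lemma not_vge1_neq0 N x : ~~ vge v N x -> x != 0.
Proof. by apply: contraNN => /eqP ->; exact: vge0. Qed.

Definition vunit x := vge v 0 x && ~~ vge v 1 x.

Lemma vunitE x : vunit x = (x != 0) && (vord v x == 0).
Proof.
rewrite /vunit; have [->|x0] := eqVneq x 0; first by rewrite !vge0.
by rewrite !vge_ord // -ltNge; apply/andP/eqP => [[]|->//]; lia.
Qed.

Lemma vunit_neq0 x : vunit x -> x != 0.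
Proof. by rewrite vunitE => /andP[]. Qed.

Lemma vunit_ge0 x : vunit x -> vge v 0 x.
Proof. by case/andP. Qed.

Lemma vunitM x y : vunit x -> vunit y -> vunit (x * y).
Proof.
rewrite !vunitE => /andP[x0 /eqP hx] /andP[y0 /eqP hy].
by rewrite mulf_neq0 //= vordM // hx hy.
Qed.

Lemma vunitV x : vunit x -> vunit x^-1.
Proof.
rewrite !vunitE => /andP[x0 /eqP hx].
by rewrite invr_eq0 x0 /= vordV // hx.
Qed.

Lemma vgeV x : vunit x -> vge v 0 x^-1.
Proof. by move=> /vunitV /vunit_ge0. Qed.

Lemma vunitX x n : vunit x -> vunit (x ^+ n).
Proof.
move=> ux; elim: n => [|n IHn]; last by rewrite exprS vunitM.
by rewrite expr0 vunitE oner_neq0 vord1 /=.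
Qed.

Lemma vunit1 : vunit 1.
Proof. by rewrite vunitE oner_neq0 vord1. Qed.

Lemma vunit_near x y : vunit x -> vge v 1 (y - x) -> vunit y.
Proof.
move=> /andP[x0 x1] xy; apply/andP; split.
  by rewrite -[y](subrK x) vgeD // (vge_le _ xy).
apply: contra x1 => y1; have -> : x = y - (y - x) by ring.
exact: vgeB.
Qed.

Lemma vgeM_unit N x y : vunit x -> vge v N (x * y) = vge v N y.
Proof.
move=> ux; apply/idP/idP => h; last by apply: vgeM0 => //; exact: vunit_ge0.
by rewrite -(mulKf (vunit_neq0 ux) y) vgeM0 // vgeV.
Qed.

Lemma vge_sum_dominant (I : finType) (F : I -> L) N i0 :
  ~~ vge v (N + 1) (F i0) -> (forall i, i != i0 -> vge v (N + 1) (F i)) ->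
  \sum_i F i != 0.
Proof.
move=> h0 h; apply: (@not_vge1_neq0 (N + 1)); apply: contra h0 => hs.
have -> : F i0 = \sum_i F i - \sum_(i | i != i0) F i.
  by rewrite (bigD1 i0) //= addrK.
by apply: vgeB => //; exact: vge_sum.
Qed.

Lemma not_vge_ord N x : ~~ vge v (N + 1) x -> vge v N x -> vord v x = N.
Proof.
move=> h; have x0 := not_vge1_neq0 h; rewrite (vge_ord _ x0) in h.
by rewrite vge_ord // => h'; move: h; rewrite -ltNge; lia.
Qed.

Lemma vge_exists_bound x : exists N : nat, vge v (- N%:Z) x.
Proof.
have [->|x0] := eqVneq x 0; first by exists 0%N; exact: vge0.
by exists `|vord v x|%N; rewrite vge_ord //; lia.
Qed.

End Valuation.

(** * Multivariate polynomials *)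

Lemma rmorph_mmap (n : nat) (R : comNzRingType) (S S' : comNzRingType)
    (f : {rmorphism R -> S}) (g : {rmorphism S -> S'}) (h : 'I_n -> S) p :
  g (mmap f h p) = mmap (g \o f) (g \o h) p.
Proof.
rewrite /mmap rmorph_sum; apply: eq_bigr => m _.
rewrite rmorphM /mmap1 rmorph_prod /=; congr (_ * _).
by apply: eq_bigr => i _; rewrite rmorphXn.
Qed.

Lemma eq_mmap (n : nat) (R : nzRingType) (S : comNzRingType) (f f' : R -> S)
    (h h' : 'I_n -> S) p : f =1 f' -> h =1 h' -> mmap f h p = mmap f' h' p.
Proof.
move=> ff' hh'; apply: eq_bigr => m _; rewrite ff'; congr (_ * _).
by apply: eq_bigr => i _; rewrite hh'.
Qed.

Lemma mmap_id (n : nat) (R : comNzRingType) (p : {mpoly R[n]}) :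
  mmap (@mpolyC n R) (fun i => 'X_i) p = p.
Proof.
rewrite [RHS]mpolyE /mmap; apply: eq_bigr => m _.
by rewrite mmap1_id mul_mpolyC.
Qed.

Lemma mmap_muni (n : nat) (R : comNzRingType) (S : comNzRingType)
    (f : {rmorphism R -> S}) (h : 'I_n.+1 -> S) (p : {mpoly R[n.+1]}) :
  mmap f h p =
  (map_poly (mmap f (fun i => h (widen_ord (leqnSn n) i))) (muni p)).[h ord_max].
Proof.
rewrite muniE rmorph_sum horner_sum; apply: eq_bigr => m _.
rewrite -mul_polyC -mul_mpolyC rmorphM /= map_polyXn map_polyC /= !hornerE.
rewrite rmorphM /= mmapC mmapX -mulrA; congr (_ * _).
rewrite /mmap1 big_ord_recr /=; congr (_ * _).
by apply: eq_bigr => i _; rewrite mnmE.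
Qed.

Lemma muni_eq0 (n : nat) (R : comNzRingType) (p : {mpoly R[n.+1]}) :
  (muni p == 0) = (p == 0).
Proof.
apply/eqP/eqP => [p0|->]; last exact: muni0.
by rewrite -[p]mmap_id mmap_muni p0 rmorph0 horner0.
Qed.

Lemma pchar0_natr_inj (K : fieldType) : [pchar K] =i pred0 ->
  injective (fun m : nat => m%:R : K).
Proof.
move=> ch0 m m' e; have nat_inj (n1 n2 : nat) : n1%:R = n2%:R :> K -> (n1 <= n2)%N -> n1 = n2.
  move=> e12 le; apply/eqP; rewrite eqn_leq le /= -subn_eq0 -((pcharf0P _).1 ch0).
  by rewrite natrB // e12 subrr.
by case/orP: (leq_total m m') => le; [exact: nat_inj | apply/esym/nat_inj].
Qed.

(** The source of all general choices of several parameters. The last variable is chosen after the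
    others, which keep the leading coefficient in it nonzero. *)
Lemma mpoly_nonvanishing (K : fieldType) (n : nat) (s : 'I_n -> nat -> K)
    (p : {mpoly K[n]}) :
  (forall i, injective (s i)) -> p != 0 ->
  exists m : 'I_n -> nat, p.@[fun i => s i (m i)] != 0.
Proof.
elim: n s p => [|n IHn] s p inj_s p0.
  exists (fun _ => 0%N); apply: contra p0 => /eqP h.
  apply/eqP/mpolyP => m; have m0 : m = 0%MM by apply/mnmP => -[].
  rewrite mcoeff0 m0 -h mevalE [p in RHS](_ : _ = (p@_0)%:MP).
    rewrite msuppC; case: eqP => [->|_]; first by rewrite big_nil.
    by rewrite big_seq1 big_ord0 mulr1 mcoeffC eqxx mulr1.
  by apply/mpolyP => m'; rewrite mcoeffC [m'](_ : _ = 0%MM) ?eqxx ?mulr1 //; apply/mnmP => -[].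
have q0 : lead_coef (muni p) != 0 by rewrite lead_coef_eq0 muni_eq0.
have [m hm] := IHn (fun i => s (widen_ord (leqnSn n) i)) _
  (fun i => inj_s _) q0.
pose g i := s (widen_ord (leqnSn n) i) (m i).
pose r : {poly K} := map_poly (meval g) (muni p).
have r0 : r != 0.
  apply: contraNneq hm => r0.
  have := congr1 (fun q : {poly K} => q`_(size (muni p)).-1) r0.
  by rewrite coef_map coef0 => ->.
have [k rk] : exists k : nat, ~~ root r (s ord_max k).
  apply: contrapT => /forallNP h.
  have := @max_poly_roots _ r [seq s ord_max i | i <- iota 0 (size r)] r0.
  rewrite size_map size_iota ltnn map_inj_uniq ?iota_uniq // => h'.
  suff : false by []; apply: h' => //.
  by apply/allP => _ /mapP[i _ ->]; apply/negPn/negP/h.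
exists (fun i => if unlift ord_max i is Some i' then m i' else k).
rewrite /meval mmap_muni unlift_none.
rewrite (_ : map_poly _ _ = r) //; apply: eq_map_poly => q.
apply: eq_mmap => // i; rewrite /g.
rewrite (_ : widen_ord _ i = lift ord_max i) ?liftK //.
by apply: val_inj; rewrite /= /bump leqNgt ltn_ord.
Qed.

(** Gaussian elimination without division, so that it applies to polynomial coefficients. A nonzero
    entry of the last column is the pivot: the rows [B] have lost that column, and a relation
    between them lifts to one between the rows of [A]. *)
Lemma linear_dependence_ord (R : idomainType) (r s : nat)
    (A : 'I_r -> 'I_s -> R) : (s < r)%N ->
  exists2 l : 'I_r -> R, exists i, l i != 0 &
    forall k, \sum_i l i * A i k = 0.
Proof.
elim: s r A => [|s IHs] [|r] A // sr.
  by exists (fun=> 1); [exists ord0; exact: oner_neq0 | case].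
have [z|] := pselect (forall i, A i ord_max = 0).
  have [l l0 hl] := IHs r.+1 (fun i k => A i (widen_ord (leqnSn s) k)) (ltnW sr).
  exists l => // k; case: (unliftP ord_max k) => [k' ->|->].
    rewrite -[RHS](hl k'); apply: eq_bigr => i _; congr (_ * A _ _).
    by apply: val_inj; rewrite /= /bump leqNgt ltn_ord.
  by rewrite big1 // => i _; rewrite z mulr0.
move=> /existsNP[i0 /eqP a0].
pose B i k := A i0 ord_max * A (lift i0 i) (widen_ord (leqnSn s) k)
  - A (lift i0 i) ord_max * A i0 (widen_ord (leqnSn s) k).
have [m [i1 m0] hm] := IHs r B sr.
pose l i := if unlift i0 i is Some i' then A i0 ord_max * m i'
  else - \sum_i' m i' * A (lift i0 i') ord_max.
exists l.
  by exists (lift i0 i1); rewrite /l liftK mulf_neq0.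
move=> k; rewrite (bigD1_ord i0) //= {1}/l unlift_none mulNr.
rewrite [X in _ + X](eq_bigr (fun i => A i0 ord_max * m i * A (lift i0 i) k));
  last by move=> i _; rewrite /l liftK.
case: (unliftP ord_max k) => [k' ->|->].
  rewrite mulr_suml -sumrN -big_split /= -[RHS](hm k'); apply: eq_bigr => i _.
  rewrite /B (_ : lift ord_max k' = widen_ord (leqnSn s) k'); first ring.
  by apply: val_inj; rewrite /= /bump leqNgt ltn_ord.
rewrite mulr_suml -sumrN -big_split /= big1 // => i _; ring.
Qed.

Lemma linear_dependence (R : idomainType) (I J : finType) (A : I -> J -> R) :
  (#|J| < #|I|)%N ->
  exists2 l : I -> R, exists i, l i != 0 & forall k, \sum_i l i * A i k = 0.
Proof.
move=> ltJI.
have [l [i l0] hl] := linear_dependence_ord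
  (fun i k => A (enum_val i) (enum_val k)) ltJI.
exists (fun i => l (enum_rank i)); first by exists (enum_val i); rewrite enum_valK.
move=> k; rewrite -[RHS](hl (enum_rank k)) (reindex_onto enum_val enum_rank) /=; last first.
  by move=> i' _; rewrite enum_rankK.
apply: eq_big => [i'|i' _]; first by rewrite enum_valK eqxx.
by rewrite enum_valK enum_rankK.
Qed.

Section DegreeCount.
Variables (K : fieldType) (n : nat).
Implicit Types p q : {mpoly K[n]}.

Lemma msizeM_bound p q (a b : nat) :
  (msize p <= a.+1)%N -> (msize q <= b.+1)%N -> (msize (p * q) <= (a + b).+1)%N.
Proof.
have [->|p0] := eqVneq p 0; first by rewrite mul0r msize0.
have [->|q0] := eqVneq q 0; first by rewrite mulr0 msize0.
by move=> pa qb; rewrite msizeM // -subn1 leq_subLR add1n (leq_trans (leq_add pa qb)) // addSn addnS ltnSn.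
Qed.

Lemma msizeX_bound p (a k : nat) :
  (msize p <= a.+1)%N -> (msize (p ^+ k) <= (k * a).+1)%N.
Proof.
move=> pa; elim: k => [|k IHk]; first by rewrite expr0 msize1.
by rewrite exprS mulSn; exact: msizeM_bound.
Qed.

Lemma msize_prod_bound (I : finType) (F : I -> {mpoly K[n]}) (a : I -> nat) :
  (forall i, (msize (F i) <= (a i).+1)%N) ->
  (msize (\prod_i F i) <= (\sum_i a i).+1)%N.
Proof.
move=> h; elim/big_ind2: _ => [|p b q c|i _]; [by rewrite msize1 | | exact: h].
exact: msizeM_bound.
Qed.

Lemma msize_coef0 p (a : nat) m : (msize p <= a.+1)%N -> (a < mdeg m)%N -> p@_m = 0.
Proof.
by move=> pa am; apply/eqP; rewrite mcoeff_eq0 msize_mdeg_ge // (leq_trans pa).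
Qed.

Lemma mdeg_ge_exponent (m : 'X_{1..n}) i : (m i <= mdeg m)%N.
Proof. by rewrite mdegE (bigD1 i) //= leq_addr. Qed.

Lemma box_exponents (D : nat) (m : 'X_{1..n}) : (mdeg m <= D)%N ->
  exists g : {ffun 'I_n -> 'I_D.+1}, m = [multinom (g i : nat) | i < n].
Proof.
move=> mD; exists [ffun i => inord (m i)]; apply/mnmP => i.
by rewrite mnmE ffunE inordK // ltnS (leq_trans (mdeg_ge_exponent m i)).
Qed.

End DegreeCount.

(** The inequality behind the dimension counts: a box of side [a] in [M] variables outgrows any
    multiple of a box of side [Q * a] in fewer variables. *)
Lemma box_growth (B Q n M : nat) : (n < M)%N ->
  exists a : nat, (0 < a)%N /\ (B * (Q * a) ^ n < a ^ M)%N.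
Proof.
move=> nM; pose a := (B * Q ^ n).+1; exists a; split => //.
apply: (@leq_trans (a ^ n.+1)); last by rewrite leq_pexp2l.
by rewrite expnMn mulnA expnS ltn_pmul2r // expn_gt0.
Qed.

(** The [a ^ M] monomials in the [y i] with exponents less than [a] have degree at most [M * D * a],
    and the polynomials of such a degree in [n] variables form a space of smaller dimension when [a]
    is large. *)
Lemma algebraic_dependence (K : fieldType) (n M : nat)
    (y : 'I_M -> {mpoly K[n]}) : (n < M)%N ->
  exists2 F : {mpoly K[M]}, F != 0 & mmap (@mpolyC n K) y F = 0.
Proof.
move=> nM.
pose D := (\max_i msize (y i))%N.
have yD i : (msize (y i) <= D.+1)%N by rewrite leqW // leq_bigmax.
have [a [a0 ha]] := box_growth 1 (M * D).+1 nM.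
pose mon (g : {ffun 'I_M -> 'I_a}) := [multinom (g i : nat) | i < M].
pose Y g := mmap1 y (mon g).
have szY g : (msize (Y g) <= (M * D * a).+1)%N.
  rewrite /Y /mmap1 (leq_trans (msize_prod_bound (a := fun i => (a * D)%N) _)) //.
    move=> i; apply: leq_trans (msizeX_bound _ (yD i)) _.
    by rewrite mnmE ltnS leq_mul2r ltnW ?orbT.
  by rewrite sum_nat_const card_ord; nia.
have card_lt : (#|{ffun 'I_n -> 'I_(M * D * a).+1}| < #|{ffun 'I_M -> 'I_a}|)%N.
  rewrite !card_ffun !card_ord; apply: leq_ltn_trans ha; rewrite mul1n.
  by case: (n) => // n'; rewrite leq_exp2r //; nia.
have [l [g0 l0] hl] := linear_dependence
  (fun g (h : {ffun 'I_n -> 'I_(M * D * a).+1}) => (Y g)@_[multinom (h i : nat) | i < n])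
  card_lt.
have inj_mon : injective mon.
  move=> g g' /mnmP e; apply/ffunP => i; apply: val_inj.
  by have := e i; rewrite !mnmE.
exists (\sum_g l g *: 'X_[mon g]).
  apply: contraNneq l0 => /(congr1 (mcoeff (mon g0))).
  rewrite mcoeff0 raddf_sum (bigD1 g0) //= mcoeffZ mcoeffX eqxx mulr1.
  rewrite big1 ?addr0 => [->//|g gg0].
  by rewrite mcoeffZ mcoeffX (inj_eq inj_mon) (negbTE gg0) mulr0.
rewrite raddf_sum /=; apply/mpolyP => m; rewrite mcoeff0 raddf_sum /=.
have [|mD] := leqP (mdeg m) (M * D * a); last first.
  apply: big1 => g _; rewrite mmapZ mmapX mcoeffCM.
  by rewrite (msize_coef0 (szY g)) ?mulr0.
move=> /box_exponents[h ->]; rewrite -[RHS](hl h); apply: eq_bigr => g _.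
by rewrite mmapZ mmapX mcoeffCM.
Qed.

(** * Places and weak approximation *)

Section ValuationMore.
Variables (L : fieldType) (v : L -> \bar int).
Hypothesis hv : discrete_valuation v.

Lemma vordD_dominant x y : x != 0 -> vge v (vord v x + 1) y ->
  x + y != 0 /\ vord v (x + y) = vord v x.
Proof.
move=> x0 yx; have h : ~~ vge v (vord v x + 1) (x + y).
  apply/negP => h; have : vge v (vord v x + 1) (x + y - y) by exact: vgeB.
  by rewrite addrK vge_ord //; lia.
split; first exact: not_vge1_neq0 h.
apply: (not_vge_ord hv h); apply: vgeD => //; first by rewrite vge_ord.
by apply: vge_le yx => //; lia.
Qed.

Lemma vord_ge0_1D x : vge v 1 x -> vunit v (1 + x).
Proof. by move=> hx; apply: (vunit_near hv (vunit1 hv)); rewrite addrAC subrr add0r. Qed.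

Lemma vge_horner (p : {poly L}) y :
  (forall i, vge v 0 p`_i) -> vge v 0 y -> vge v 0 p.[y].
Proof.
move=> hp hy; rewrite horner_coef; apply: vge_sum => // i _.
by apply: vgeM0 => //; exact: vgeX.
Qed.

End ValuationMore.

Section Places.
Variables (C K : fieldType) (j : {rmorphism C -> K}).
Implicit Types (v w : place j) (s : seq (place j)).

HB.instance Definition _ := gen_eqMixin (place j).

Lemma place_hv v : discrete_valuation v.
Proof. exact: place_valuation. Qed.
Hint Resolve place_hv : core.

Lemma place_ext v w : (forall x, v x = w x) -> v = w.
Proof.
case: v w => [v a b c] [w a' b' c'] /= /funext e; subst w.
by congr Place; exact: Prop_irrelevance.
Qed.

Lemma place_unif v : exists2 p : K, p != 0 & vord v p = 1.
Proof.
have [p vp] := place_normalized v; exists p; last by rewrite /vord vp.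
by apply: contra_eqN vp => /eqP ->; rewrite (dvaluation0 (place_hv v)).
Qed.

Lemma place_constE v (c : C) : c != 0 -> vord v (j c) = 0.
Proof. by move=> /(place_const v) h; rewrite /vord h. Qed.

Lemma vge_const v (c : C) : vge v 0 (j c).
Proof.
have [->|c0] := eqVneq c 0; first by rewrite rmorph0 vge0.
by rewrite vge_ord ?fmorph_eq0 // place_constE.
Qed.
Hint Resolve vge_const : core.

Lemma vunit_const v (c : C) : vunit v (j c) = (c != 0).
Proof.
rewrite vunitE // fmorph_eq0; have [//|c0] := eqVneq c 0.
by rewrite place_constE.
Qed.

(** If the valuation ring of [v] were contained in that of [w], then [vord w] would be [vord v]
    times [vord w p], with [p] a uniformizer at [v]. The factor is nonnegative and divides 1 because
    [w] is normalized, so the places would coincide. *)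
Lemma place_separation1 v w : v != w -> exists x, vge v 0 x && ~~ vge w 0 x.
Proof.
move=> vw; apply: contrapT => /forallNP h.
have {}h x : vge v 0 x -> vge w 0 x.
  by move=> hx; have /negP := h x; rewrite hx /= negbK.
have h0 x : x != 0 -> vord v x = 0 -> vord w x = 0.
  move=> x0 vx; have := h x; have := h x^-1.
  by rewrite !vge_ord ?invr_eq0 // !vordV // vx; lia.
have [p p0 vp] := place_unif v.
have wE x : x != 0 -> vord w x = vord v x * vord w p.
  move=> x0; have n0 : x / p ^ vord v x != 0 by rewrite mulf_neq0 // invr_eq0 expfz_neq0.
  have ordp (u : place j) : vord u (p ^ vord v x) = vord v x * vord u p.
    case: (vord v x) => k; first by rewrite -exprnP vordX.
    by rewrite NegzE -exprnN vordV ?expf_neq0 // vordX //; ring.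
  have p1 : p ^ vord v x != 0 by rewrite expfz_neq0.
  have := h0 _ n0; rewrite !vordM ?invr_eq0 // !vordV // !ordp vp mulr1 subrr.
  by move=> /(_ erefl) /eqP; rewrite subr_eq0 => /eqP.
have [q q0 wq] := place_unif w.
have wp1 : vord w p = 1.
  have := h p; rewrite !vge_ord // vp => /(_ isT) wp0.
  have := wE q q0; rewrite wq.
  move: (vord v q) (vord w p) wp0 => a b b0 ab.
  have a0 : 0 < a by case: (ltrP 0 a) => // a0; have := mulr_le0_ge0 a0 b0; lia.
  have b1 : 0 < b by case: (ltrP 0 b) => // b1; have := mulr_ge0_le0 (ltW a0) b1; lia.
  have : 0 <= (a - 1) * b by apply: mulr_ge0; lia.
  by rewrite mulrBl -ab; lia.
case/eqP: vw; apply: place_ext => x.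
have [->|x0] := eqVneq x 0; first by rewrite !(dvaluation0 (place_hv _)).
by rewrite !vordE // wE // wp1 mulr1.
Qed.

Lemma place_separation v w : v != w ->
  exists2 x, x != 0 & vord v x < 0 /\ 0 < vord w x.
Proof.
move=> vw; have [x /andP[vx wx]] := place_separation1 vw.
have wv : w != v by rewrite eq_sym.
have [y /andP[wy vy]] := place_separation1 wv.
have x0 := not_vge1_neq0 (place_hv w) wx; have y0 := not_vge1_neq0 (place_hv v) vy.
rewrite !vge_ord // in vx wx wy vy; rewrite -!ltNge in wx vy.
exists (y / x); first by rewrite mulf_neq0 ?invr_eq0.
by rewrite !vordM ?invr_eq0 // !vordV //; lia.
Qed.

(* Artin-Whaples: [x ^+ k * z / (1 + x ^+ k)] repairs the sign at the last place
   when [x] has a pole there. *)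
Lemma place_separation_seq v s : v \notin s ->
  exists2 x, x != 0 & vord v x < 0 /\ forall w, w \in s -> 0 < vord w x.
Proof.
elim: s => [|w s IHs].
  move=> _; have [p p0 vp] := place_unif v.
  by exists p^-1; rewrite ?invr_eq0 // vordV // vp.
rewrite inE negb_or => /andP[vw /IHs[x x0 [vx sx]]].
have [z z0 [vz wz]] := place_separation vw.
pose k := (\sum_(w' <- s) `|vord w' z|)%N.+1.
have kz w' : w' \in s -> `|vord w' z|%N%:Z < k%:Z.
  by move=> w's; rewrite /k ltz_nat ltnS (big_rem w') //= leq_addr.
have [wx|wx|wx] := ltrgt0P (vord w x).
- exists x => //; split => // w'; rewrite inE => /predU1P[->//|]; exact: sx.
- have r0 : x^-1 != 0 by rewrite invr_eq0.
  have unit_r w' : vord w' x < 0 -> vunit w' (1 + x^-1 ^+ k).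
    move=> h; apply: vord_ge0_1D => //.
    by rewrite vge_ord ?expf_neq0 // vordX // vordV //; nia.
  have [n1 o1] := andP (etrans (esym (vunitE (place_hv v) _)) (unit_r v vx)).
  have V (x' : place j) (d : K) : d != 0 -> vord x' (z / d) = vord x' z - vord x' d.
    by move=> d0; rewrite vordM ?invr_eq0 // vordV.
  exists (z / (1 + x^-1 ^+ k)); first by rewrite mulf_neq0 ?invr_eq0.
  split; first by rewrite V // (eqP o1) subr0.
  move=> w'; rewrite inE => /predU1P[->|w's]; rewrite V //.
    have := unit_r w wx; rewrite vunitE // => /andP[_ /eqP ->].
    by rewrite subr0.
  have := sx w' w's; have := kz w' w's => kz' wx'.
  have rk0 : x^-1 ^+ k != 0 by rewrite expf_neq0.
  have [|_] := vordD_dominant (place_hv w') rk0 (y := 1).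
    by rewrite vge_ord ?oner_neq0 // vord1 // vordX // vordV //; nia.
  by rewrite addrC => ->; rewrite vordX // vordV //; nia.
exists (x ^+ k * z); first by rewrite mulf_neq0 ?expf_neq0.
split; first by rewrite vordM ?expf_neq0 // vordX //; nia.
move=> w'; rewrite inE vordM ?expf_neq0 // vordX //.
move=> /predU1P[->|w's]; first by rewrite wx; lia.
by have := sx w' w's; have := kz w' w's; nia.
Qed.

(** For [x] with a pole at [v] and zeros along [s], the powers of [x^-1] tend to 0 at [v] and to
    infinity along [s], so the inverse of [1 + x^-1 ^+ k] tends to 1 and to 0 respectively. *)
Lemma place_idempotent v s (N : nat) : v \notin s ->
  exists e, vge v N (e - 1) /\ forall w, w \in s -> vge w N e.
Proof.
move=> /place_separation_seq[x x0 [vx sx]].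
have r0 : x^-1 != 0 by rewrite invr_eq0.
pose k := N.+1; pose e := (1 + x^-1 ^+ k)^-1.
have rk0 : x^-1 ^+ k != 0 by rewrite expf_neq0.
have vr : vge v k (x^-1 ^+ k) by rewrite vge_ord // vordX // vordV //; nia.
have u1 : vunit v (1 + x^-1 ^+ k).
  by apply: vord_ge0_1D => //; apply: vge_le vr => //; rewrite /k; lia.
have n1 := vunit_neq0 (place_hv v) u1.
exists e; split.
  have -> : e - 1 = - (x^-1 ^+ k) * e by rewrite /e; field.
  apply: vgeM0r => //; last by apply: vgeV.
  by rewrite vgeN //; apply: vge_le vr => //; rewrite /k; lia.
move=> w ws; rewrite vge_ord ?invr_eq0 // vordV //.
have kx : k%:Z <= k%:Z * vord w x by rewrite ler_peMr //; have := sx w ws; lia.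
have kr : vord w (x^-1 ^+ k) = - (k%:Z * vord w x) by rewrite vordX // vordV // mulrN.
have [|_] := vordD_dominant (place_hv w) rk0 (y := 1).
  by rewrite vge_ord ?oner_neq0 // vord1 // kr; apply: le_trans (_ : - k%:Z + 1 <= 0); [rewrite lerD2r lerN2 | rewrite /k; lia].
by rewrite addrC kr => ->; rewrite opprK; apply: le_trans kx; rewrite /k; lia.
Qed.

Lemma vge_uniform_bound s (F : seq K) :
  exists B : nat, forall v x, v \in s -> x \in F -> vge v (- B%:Z) x.
Proof.
elim: s => [|v s [B hB]]; first by exists 0%N.
have [B' hB'] : exists B' : nat, forall x, x \in F -> vge v (- B'%:Z) x.
  elim: F {hB} => [|x F [B1 h1]]; first by exists 0%N.
  have [B2 h2] := vge_exists_bound (place_hv v) x.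
  exists (B1 + B2)%N => y; rewrite inE => /predU1P[->|/h1 hy].
    by apply: vge_le h2; lia.
  by apply: vge_le hy; lia.
exists (B + B')%N => w x; rewrite inE => /predU1P[->|ws] xF.
  by apply: vge_le (hB' x xF) => //; lia.
by apply: vge_le (hB w x ws xF) => //; lia.
Qed.

Lemma weak_approximation s (a : place j -> K) (N : nat) : uniq s ->
  exists b, forall v, v \in s -> vge v N (b - a v).
Proof.
(* Multiplication by the [a w] may cost [B], so the idempotents are taken at precision [N + B]. *)
move=> us; have [B hB] := vge_uniform_bound s (map a s).
have : forall v, exists e, v \in s -> vge v (N + B)%N (e - 1) /\
    forall w, w \in s -> w != v -> vge w (N + B)%N e.
  move=> v; have [e [h1 h2]] := place_idempotent (N + B) (v := v) (s := rem v s)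
    (negbT (mem_rem_uniqF v us)).
  exists e => vs; split => // w ws wv; apply: h2.
  by rewrite mem_rem_uniq // inE wv.
move=> /choice[e he]; exists (\sum_(w <- s) e w * a w) => v vs.
rewrite (bigD1_seq v) //= addrAC -{2}[a v]mul1r -mulrBl.
have NB : N%:Z = (N + B)%N%:Z + - B%:Z by lia.
apply: vgeD => //.
  rewrite NB; apply: vgeM => //; last by apply: hB => //; exact: map_f.
  by have [] := he v vs.
rewrite big_seq_cond; apply: vge_sum => // w /andP[ws wv].
rewrite NB; apply: vgeM => //; last by apply: hB => //; exact: map_f.
by have [_] := he w ws; apply => //; rewrite eq_sym.
Qed.

End Places.
#[export] Hint Resolve place_hv vge_const : core.

(** * Residue fields and finiteness of supports *)

Section ConstantEvaluation.
Variables (C K : fieldType) (j : {rmorphism C -> K}).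

Definition comm_const (x : K) : commr_rmorph j x := fun c => mulrC x (j c).

(** Linear algebra over the subfield generated by [x] is done with coefficients in [{poly C}] acting
    through [ev x], so that denominators never appear. *)
Definition ev (x : K) : {poly C} -> K := horner_morph (comm_const x).
HB.instance Definition _ x := GRing.RMorphism.on (ev x).

Lemma evE x p : ev x p = (map_poly j p).[x]. Proof. by []. Qed.
Lemma evC x c : ev x c%:P = j c. Proof. exact: horner_morphC. Qed.
Lemma evX x : ev x 'X = x. Proof. exact: horner_morphX. Qed.

Lemma vge_ev (v : place j) x p : vge v 0 x -> vge v 0 (ev x p).
Proof.
by move=> vx; rewrite evE; apply: vge_horner => // i; rewrite coef_map; exact: vge_const.
Qed.

Definition transcendental (x : K) := forall p : {poly C}, ev x p = 0 -> p = 0.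

Definition is_constant (x : K) := exists c : C, x = j c.

Hypothesis two_dependent : forall y : 'I_2 -> K, ~ alg_independent j y.

(** The relation is repackaged as a polynomial in [y] over [{poly C}]. [phi] identifies [{mpoly
    C[1]}] with [{poly C}], and its injectivity keeps the leading coefficient nonzero. *)
Lemma pair_dependent x y :
  exists2 P : {poly {poly C}}, P != 0 & (map_poly (ev x) P).[y] = 0.
Proof.
pose h (i : 'I_2) := if i == ord_max then y else x.
have := @two_dependent h; rewrite /alg_independent => /existsNP[p /not_implyP[hp /eqP p0]].
pose phi : {rmorphism {mpoly C[1]} -> {poly C}} := mmap (@polyC C) (fun=> 'X).
have phiK q : (map_poly (@mpolyC 1 C) (phi q)).['X_0] = q.
  have -> : (map_poly (@mpolyC 1 C) (phi q)).['X_0] =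
      horner_morph (fun c => mulrC 'X_0 (@mpolyC 1 C c)) (phi q) by [].
  rewrite rmorph_mmap -[RHS]mmap_id; apply: eq_mmap => [c|i] /=.
    by rewrite horner_morphC.
  by rewrite (ord1 i); exact: horner_morphX.
have phi_inj q : phi q = 0 -> q = 0 by move=> q0; rewrite -[q]phiK q0 rmorph0 horner0.
exists (map_poly phi (muni p)).
  rewrite -lead_coef_eq0; apply: contraNneq p0 => q0.
  rewrite -muni_eq0 -lead_coef_eq0; apply/eqP/phi_inj.
  apply/eqP; apply: contraT => h0.
  by have := lead_coef_map_eq h0; rewrite q0 => e; rewrite -e eqxx in h0.
rewrite -map_poly_comp -[RHS]hp mmap_muni.
rewrite {2}/h eqxx; congr (_.[_]); apply: eq_map_poly => q /=.
rewrite rmorph_mmap; apply: eq_mmap => [c|i] /=; first by rewrite evC.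
rewrite evX /h; case: eqP => // /(congr1 val) /=.
by rewrite (ord1 i).
Qed.

End ConstantEvaluation.

Section ClosedConstants.
Variables (C : closedFieldType) (K : fieldType) (j : {rmorphism C -> K}).

(** Since [p] splits over [C], a nonunit value at [a] forces one of the factors [a - j c] to be a
    nonunit. *)
Lemma vge1_ev (v : place j) (a : K) (p : {poly C}) :
  vge v 0 a -> p != 0 -> vge v 1 (ev j a p) -> exists c, vge v 1 (a - j c).
Proof.
move=> va p0; have [r ->] := closed_field_poly_normal p.
rewrite -mul_polyC rmorphM /= evC vgeM_unit // ?vunit_const ?lead_coef_eq0 //.
rewrite rmorph_prod /= => h; apply: contrapT => /forallNP nh.
have : vunit v (\prod_(i <- r) ev j a ('X - i%:P)).
  elim: r {h} => [|c r IHr]; first by rewrite big_nil vunit1.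
  rewrite big_cons vunitM // rmorphB /= evX evC.
  by rewrite /vunit vgeB //=; apply/negP/nh.
by rewrite /vunit h andbF.
Qed.

Lemma algebraic_constant (x : K) : ~ is_constant j x -> transcendental j x.
Proof.
move=> nc p; have [r ->] := closed_field_poly_normal p.
rewrite -mul_polyC rmorphM /= evC rmorph_prod => /eqP.
rewrite mulf_eq0 fmorph_eq0 prodf_seq_eq0 => /orP[/eqP->|/hasP[c _ /=]].
  by rewrite mul0r.
by rewrite rmorphB /= evX evC subr_eq0 => /eqP xc; case: nc; exists c.
Qed.

Hypothesis two_dependent : forall y : 'I_2 -> K, ~ alg_independent j y.

(** The residue field is [C]: a relation between [a] and a uniformizer [p], divided by a power of
    [p], has as constant term in [p] a nonzero polynomial in [a], whose value is then divisible by
    [p]. *)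
Lemma residue_constant (v : place j) (a : K) :
  vge v 0 a -> exists c, vge v 1 (a - j c).
Proof.
move=> va; have [p p0 vp] := place_unif v.
have hp : vge v 1 p by rewrite vge_ord // vp.
have [P P0] := pair_dependent two_dependent a p.
elim/poly_ind: P P0 => [|P c IHP] P0; first by rewrite eqxx in P0.
rewrite rmorphD rmorphM /= map_polyX map_polyC /= !hornerE => /eqP.
have [c0|c0] := eqVneq c 0.
  rewrite c0 rmorph0 addr0 mulf_eq0 (negbTE p0) orbF => /eqP; apply: IHP.
  by apply: contraNneq P0 => ->; rewrite mul0r c0 add0r.
rewrite addrC addr_eq0 => /eqP e; apply: (vge1_ev va c0).
rewrite e vgeN //; apply: vgeM0 => //.
apply: vge_horner => // [i|]; last by apply: vge_le hp.
by rewrite coef_map; exact: vge_ev.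
Qed.

(** A Laurent expansion cut after the constant term, whose leading term is removed at each step by a
    residue. It turns vanishing at [v] into finitely many linear conditions over [C]. *)
Lemma polar_expansion (v : place j) (p : K) (y : K) (k : nat) :
  p != 0 -> vord v p = 1 -> vge v (- k%:Z) y ->
  exists c : nat -> C, vge v 1 (y - \sum_(i < k.+1) j (c i) * p ^- i).
Proof.
move=> p0 vp; elim: k y => [|k IHk] y hy.
  have [c hc] := residue_constant hy; exists (fun=> c).
  by rewrite big_ord1 expr0 invr1 mulr1.
have vpk i : vord v (p ^+ i) = i by rewrite vordX // vp mulr1.
have hy' : vge v 0 (y * p ^+ k.+1).
  by rewrite -[0](addNr k.+1%:Z) vgeM // vge_ord ?expf_neq0 // vpk.
have [c hc] := residue_constant hy'.
have [|c' hc'] := IHk (y - j c * p ^- k.+1).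
  have -> : y - j c * p ^- k.+1 = (y * p ^+ k.+1 - j c) * p ^- k.+1.
    by rewrite mulrBl mulfK ?expf_neq0.
  have -> : - k%:Z = 1 + - k.+1%:Z by lia.
  by rewrite vgeM // vge_ord ?invr_eq0 ?expf_neq0 // vordV ?expf_neq0 // vpk.
exists (fun i => if i == k.+1 then c else c' i).
rewrite big_ord_recr /= eqxx (eq_bigr (fun i : 'I_k.+1 => j (c' i) * p ^- i)).
  by rewrite opprD [- _ - _]addrC addrA.
by move=> i _; rewrite ltn_eqF.
Qed.

End ClosedConstants.

(** * Finite rank of the function field over a subfield generated by one element *)

Section PolynomialDependence.
Variables (C : idomainType) (K : fieldType) (ev : {rmorphism {poly C} -> K}).

(** For injective [ev] this is linear dependence over the fraction field of its image, denominators
    being cleared; [in_span] is membership in a span over the same field. *)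
Definition dependent (I : finType) (y : I -> K) :=
  exists2 p : I -> {poly C}, exists i, p i != 0 & \sum_i ev (p i) * y i = 0.

Definition in_span (J : finType) (F : J -> K) (y : K) :=
  exists2 h : {poly C}, h != 0 &
  exists p : J -> {poly C}, ev h * y = \sum_k ev (p k) * F k.

Lemma dependent_of_span (I J : finType) (F : J -> K) (y : I -> K) :
  (#|J| < #|I|)%N -> (forall i, in_span F (y i)) -> dependent y.
Proof.
move=> ltJI hy.
have /choice[hp hhp] : forall i, exists hp : {poly C} * (J -> {poly C}),
    hp.1 != 0 /\ ev hp.1 * y i = \sum_k ev (hp.2 k) * F k.
  by move=> i; have [h h0 [p e]] := hy i; exists (h, p).
have [l [i0 l0] hl] := linear_dependence (fun i k => (hp i).2 k) ltJI.
exists (fun i => l i * (hp i).1).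
  by exists i0; rewrite mulf_neq0 //; have [] := hhp i0.
rewrite (eq_bigr (fun i => \sum_k ev (l i * (hp i).2 k) * F k)).
  rewrite exchange_big big1 // => k _.
  by rewrite -mulr_suml -rmorph_sum hl rmorph0 mul0r.
move=> i _; rewrite rmorphM -mulrA; have [_ ->] := hhp i.
by rewrite mulr_sumr; apply: eq_bigr => k _; rewrite rmorphM mulrA.
Qed.

Lemma in_span_gen (J : finType) (F : J -> K) k : in_span F (F k).
Proof.
exists 1; first exact: oner_neq0.
exists (fun k' => (k' == k)%:R); rewrite (bigD1 k) //= eqxx !rmorph1 big1 ?addr0 //.
by move=> k' /negbTE ->; rewrite rmorph0 mul0r.
Qed.

Lemma in_span_trans (I J : finType) (F : J -> K) (z : I -> K) (y : K) :
  in_span z y -> (forall i, in_span F (z i)) -> in_span F y.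
Proof.
move=> [h h0 [p e]] hz.
have /choice[hp hhp] : forall i, exists hp : {poly C} * (J -> {poly C}),
    hp.1 != 0 /\ ev hp.1 * z i = \sum_k ev (hp.2 k) * F k.
  by move=> i; have [h' h'0 [p' e']] := hz i; exists (h', p').
pose H := \prod_i (hp i).1; pose Hi i := \prod_(k | k != i) (hp k).1.
exists (H * h).
  by rewrite mulf_neq0 //; apply/prodf_neq0 => i _; have [] := hhp i.
exists (fun k => \sum_i p i * Hi i * (hp i).2 k).
rewrite rmorphM -mulrA e mulr_sumr.
under [RHS]eq_bigr => k _ do rewrite rmorph_sum mulr_suml.
rewrite exchange_big; apply: eq_bigr => i _.
have -> : H = Hi i * (hp i).1 by rewrite mulrC /H (bigD1 i).
rewrite rmorphM -!mulrA [ev (hp i).1 * _]mulrCA; have [_ ->] := hhp i.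
rewrite !mulr_sumr; apply: eq_bigr => k _; rewrite !rmorphM; ring.
Qed.

Lemma in_span_sum (I J : finType) (F : J -> K) (z : I -> K) :
  (forall i, in_span F (z i)) -> in_span F (\sum_i z i).
Proof.
apply: in_span_trans; exists 1; first exact: oner_neq0.
by exists (fun=> 1); rewrite rmorph1 mul1r; apply: eq_bigr => i _; rewrite mul1r.
Qed.

Lemma in_spanZ (J : finType) (F : J -> K) p y :
  in_span F y -> in_span F (ev p * y).
Proof.
move=> hy; apply: (in_span_trans (z := fun _ : unit => y)) => //.
exists 1; first exact: oner_neq0.
by exists (fun=> p); rewrite rmorph1 mul1r (big_pred1 tt) // => -[].
Qed.

Lemma dependent_inj (I I' : finType) (f : I' -> I) (y : I -> K) :
  injective f -> dependent (y \o f) -> dependent y.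
Proof.
move=> injf [p [i0 p0] e].
exists (fun i => \sum_(i' | f i' == i) p i').
  exists (f i0); rewrite (bigD1 i0) //= big1 ?addr0 // => i' /andP[/eqP/injf ->].
  by rewrite eqxx.
rewrite -[RHS]e (partition_big f xpredT) //=; apply: eq_bigr => i _.
by rewrite rmorph_sum mulr_suml; apply: eq_bigr => i' /eqP <-.
Qed.

Hypothesis ev_inj : forall p, ev p = 0 -> p = 0.
Variables (N : nat) (xi : 'I_N -> K).
Hypothesis xi_alg : forall i, exists2 P : {poly {poly C}}, P != 0 &
  (map_poly ev P).[xi i] = 0.

Lemma generators_common_degree : exists E : nat, (0 < E)%N /\ forall i,
  exists2 P : {poly {poly C}}, size P = E.+1 & (map_poly ev P).[xi i] = 0.
Proof.
have /choice[P hP] : forall i, exists P : {poly {poly C}},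
    P != 0 /\ (map_poly ev P).[xi i] = 0.
  by move=> i; have [P ? ?] := xi_alg i; exists P.
pose E := (\max_i size (P i)).+1; exists E; split => // i.
have [P0 e] := hP i; have sE : (size (P i) <= E)%N by rewrite leqW // leq_bigmax.
(* Powers of the variable bring all relations to the same degree [E], so that one bound on exponents
   serves all generators. *)
exists (P i * 'X^(E.+1 - size (P i))); last by rewrite rmorphM hornerM e mul0r.
by rewrite size_mulXn // subnK // leqW.
Qed.

(** The monomials in the [xi i] with exponents less than [E] span: multiplication by [xi i]
    preserves their span, since the relation of degree [E] rewrites [xi i ^+ E] in lower powers. *)
Lemma dependence_bound_poly : exists (J : finType) (F : J -> K), 
  forall (c : {rmorphism C -> K}) (f : {mpoly C[N]}), (forall a, c a = ev a%:P) ->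
  in_span F (mmap c xi f).
Proof.
have [E [E0 hE]] := generators_common_degree.
pose J : finType := {ffun 'I_N -> 'I_E}.
pose F (b : J) := \prod_i xi i ^+ b i.
have FM i (b : J) : in_span F (xi i * F b).
  pose up (l : 'I_E) : J := [ffun k => if k == i then l else b k].
  pose rest := \prod_(k | k != i) xi k ^+ b k.
  have Fup l : F (up l) = xi i ^+ l * rest.
    rewrite /F (bigD1 i) //= ffunE eqxx; congr (_ * _).
    by apply: eq_bigr => k /negbTE ki; rewrite ffunE ki.
  have Fb : F b = xi i ^+ b i * rest by rewrite /F (bigD1 i).
  have [P sP eP] := hE i.
  have [lt|ge] := ltnP (b i).+1 E.
    by rewrite Fb mulrA -exprS -(Fup (Ordinal lt)); exact: in_span_gen.
  have bE : (b i).+1 = E by apply/eqP; rewrite eqn_leq ge ltn_ord.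
  apply: (in_span_trans (z := fun l => F (up l))); last by move=> l; exact: in_span_gen.
  exists P`_E; first by rewrite -[E]/(E.+1.-1) -sP -lead_coefE lead_coef_eq0 -size_poly_eq0 sP.
  exists (fun l : 'I_E => - P`_l).
  rewrite Fb mulrA mulrA -[_ * xi i * _]mulrA -exprS bE.
  have : \sum_(l < E.+1) ev P`_l * xi i ^+ l = 0.
    rewrite -[RHS]eP horner_coef size_map_inj_poly ?sP ?rmorph0 //.
      by apply: eq_bigr => l _; rewrite coef_map.
    by apply: raddf_inj.
  rewrite big_ord_recr /= addrC => /eqP; rewrite addr_eq0 => /eqP ->.
  rewrite mulNr mulr_suml -sumrN; apply: eq_bigr => l _.
  by rewrite rmorphN Fup mulNr mulrA.
have FMspan i y : in_span F y -> in_span F (xi i * y).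
  move=> [h h0 [p e]]; apply: (in_span_trans (z := fun b => xi i * F b)) => //.
  by exists h => //; exists p; rewrite mulrCA e mulr_sumr; apply: eq_bigr => b _; rewrite mulrCA.
exists J, F => c f hc; rewrite /mmap big_tnth; apply: in_span_sum => k.
move: (tnth (in_tuple _) k) => m.
rewrite hc; apply: in_spanZ; rewrite /mmap1.
elim: (index_enum _) => [|i r IHr].
  rewrite big_nil; have -> : 1 = F [ffun=> Ordinal E0] :> K.
    by rewrite /F big1 // => i _; rewrite ffunE expr0.
  exact: in_span_gen.
rewrite big_cons; elim: (m i) => [|e IHe]; first by rewrite expr0 mul1r.
by rewrite exprS -mulrA; exact: FMspan.
Qed.

Variable c : {rmorphism C -> K}.
Hypothesis cE : forall a, c a = ev a%:P.
Hypothesis xi_gen : forall y : K, exists f g : {mpoly C[N]},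
  mmap c xi g != 0 /\ y = mmap c xi f / mmap c xi g.

(** Multiplying a family by the product [G] of its denominators preserves dependence and brings it
    into the polynomials in the [xi i]. *)
Lemma dependence_bound : exists D : nat, forall (I : finType) (y : I -> K),
  (D < #|I|)%N -> dependent y.
Proof.
have [J [F hF]] := dependence_bound_poly.
exists #|J| => I y ltJI.
have /choice[fg hfg] : forall i, exists fg : {mpoly C[N]} * {mpoly C[N]},
    mmap c xi fg.2 != 0 /\ y i = mmap c xi fg.1 / mmap c xi fg.2.
  by move=> i; have [f [g [? ?]]] := xi_gen (y i); exists (f, g).
pose G := \prod_i mmap c xi (fg i).2.
have G0 : G != 0 by apply/prodf_neq0 => i _; have [] := hfg i.
have Gy i : in_span F (G * y i).
  have [g0 ->] := hfg i; rewrite /G (bigD1 i) //= mulrC.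
  rewrite mulrA mulfVK // -rmorph_prod -rmorphM; exact: hF.
have [p p0 e] := dependent_of_span ltJI Gy; exists p => //.
apply: (mulfI G0); rewrite mulr0 -[RHS]e mulr_sumr.
by apply: eq_bigr => i _; rewrite mulrCA.
Qed.

End PolynomialDependence.

Lemma bounded_uniq_finite (T : eqType) (A : T -> Prop) (d : nat) :
  (forall s : seq T, uniq s -> (forall v, v \in s -> A v) -> (size s <= d)%N) ->
  exists2 s : seq T, uniq s & forall v, v \in s <-> A v.
Proof.
move=> h.
pose P (n : nat) := `[< exists s : seq T, [/\ uniq s, size s = n & forall v, v \in s -> A v] >].
have P0 : exists n, P n by exists 0%N; apply/asboolP; exists [::].
have Pd n : P n -> (n <= d)%N by move=> /asboolP[s [us <- hs]]; exact: h.
case: (ex_maxnP P0 Pd) => n /asboolP[s [us sn hs]] nmax.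
exists s => // v; split=> [|Av]; first exact: hs.
apply: contrapT => /negP vs; suff : (n.+1 <= n)%N by rewrite ltnn.
apply: nmax; apply/asboolP; exists (v :: s); split; rewrite /= ?vs ?sn //.
by move=> w; rewrite inE => /predU1P[->//|]; exact: hs.
Qed.

Section CurveField.
Variables (C : closedFieldType) (K : fieldType) (j : {rmorphism C -> K}).
Hypothesis two_dependent : forall y : 'I_2 -> K, ~ alg_independent j y.
Hypothesis finitely_generated : exists (N : nat) (xi : 'I_N -> K),
  forall y : K, exists f g : {mpoly C[N]},
    mmap j xi g != 0 /\ y = mmap j xi f / mmap j xi g.

(** Here [d] is the degree of [K] over the subfield generated by [C] and [x], obtained as the
    largest size of an independent family. *)
Lemma rank_over_subfield (x : K) : ~ is_constant j x -> exists d : nat,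
  (exists e : 'I_d -> K, ~ dependent (ev j x) e) /\
  forall (I : finType) (y : I -> K), (d < #|I|)%N -> dependent (ev j x) y.
Proof.
move=> /algebraic_constant trx; have [N [xi gen]] := finitely_generated.
have [D hD] := dependence_bound trx (fun i => pair_dependent two_dependent x (xi i))
   (fun a => esym (evC j x a)) gen.
pose P (d : nat) := `[< exists e : 'I_d -> K, ~ dependent (ev j x) e >].
have P0 : exists d, P d.
  by exists 0%N; apply/asboolP; exists (fun=> 0) => -[p [] []].
have Pd d : P d -> (d <= D)%N.
  move=> /asboolP[e he]; rewrite leqNgt; apply/negP => Dd.
  by apply/he/hD; rewrite card_ord.
case: (ex_maxnP P0 Pd) => d /asboolP[e he] dmax.
exists d; split=> [|I y dI]; first by exists e.
apply: (@dependent_inj _ _ _ _ 'I_d.+1 (fun i => enum_val (widen_ord dI i))).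
  by move=> a b /enum_val_inj/(congr1 val) /= ?; apply: val_inj.
apply: contrapT => h; suff : (d.+1 <= d)%N by rewrite ltnn.
by apply/dmax/asboolP; exists (y \o (fun i => enum_val (widen_ord dI i))).
Qed.

(** As long as all constant coefficients vanish the relation can be divided by [x], which lowers the
    total size of its coefficients. *)
Lemma dependent_nonzero_const (x : K) (I : finType) (y : I -> K) :
  x != 0 -> dependent (ev j x) y ->
  exists2 p : I -> {poly C}, exists i, (p i)`_0 != 0 &
    \sum_i ev j x (p i) * y i = 0.
Proof.
move=> x0 [p p0 e]; have [n] := ubnP (\sum_i size (p i)).
elim: n p p0 e => // n IHn p p0 e; rewrite ltnS => hn.
have [[i pi0]|nz] := pselect (exists i, (p i)`_0 != 0); first by exists p => //; exists i.
have z i : (p i)`_0 = 0 by apply/eqP/negPn/negP => h; apply: nz; exists i.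
have pE i : p i = drop_poly 1 (p i) * 'X.
  apply/polyP => k; rewrite coefMX coef_drop_poly.
  by case: k => [|k] /=; rewrite ?z ?addn1.
apply: (IHn (fun i => drop_poly 1 (p i))).
- have [i pi0] := p0; exists i; apply: contraNneq pi0 => e0.
  by rewrite pE e0 mul0r.
- apply: (mulfI x0); rewrite mulr0 -[RHS]e mulr_sumr; apply: eq_bigr => i _.
  by rewrite [in RHS]pE rmorphM /= evX; ring.
- apply: leq_trans hn; have [i pi0] := p0.
  rewrite (bigD1 i) //= [X in (_ < X)%N](bigD1 i) //= -addSn leq_add //.
    by rewrite size_drop_poly subn1 prednK // size_poly_gt0.
  by apply: leq_sum => k _; rewrite size_drop_poly leq_subr.
Qed.

Lemma ev_split (x : K) (p : {poly C}) :
  exists q, ev j x p = ev j x q * x + j p`_0.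
Proof.
exists (drop_poly 1 p).
have {1}-> : p = drop_poly 1 p * 'X + (p`_0)%:P.
  apply/polyP => k; rewrite coefD coefMX coef_drop_poly coefC.
  by case: k => [|k] /=; rewrite ?add0r ?addr0 ?addn1.
by rewrite rmorphD rmorphM /= evX evC.
Qed.

(* The residue degrees [f_i] of [sum e_i f_i <= d] are all [1] here. *)
Lemma fundamental_inequality (x : K) (d : nat) (s : seq (place j)) :
  (forall (I : finType) (y : I -> K), (d < #|I|)%N -> dependent (ev j x) y) ->
  uniq s -> (forall v, v \in s -> 0 < vord v x) ->
  (\sum_(v <- s) `|vord v x| <= d)%N.
Proof.
move=> hd us sx; rewrite leqNgt; apply/negP => ltd.
have x0 : x != 0.
  apply: contraTneq ltd => ->; rewrite big_seq big1 // => v vs.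
  by rewrite /vord (dvaluation0 (place_hv v)).
pose w (i : 'I_(size s)) := tnth (in_tuple s) i.
have ws i : w i \in s by exact: mem_tnth.
pose e (i : 'I_(size s)) := `|vord (w i) x|%N.
have eE i : vord (w i) x = (e i)%:Z by have := sx _ (ws i); rewrite /e; lia.
have inj_w i l : i != l -> w i != w l.
  move=> il; rewrite /w !(tnth_nth (w i)) /= nth_uniq //.
pose N := (\sum_(v <- s) `|vord v x|)%N.+1.
have eN i : (e i < N)%N by rewrite /N ltnS (big_rem (w i)) ?ws //= leq_addr.
pose I : finType := {i : 'I_(size s) & 'I_(e i)}.
have cardI : #|I| = (\sum_(v <- s) `|vord v x|)%N.
  rewrite card_tagged sumnE big_map big_enum /= [RHS]big_tnth /=.
  by apply: eq_bigr => i _; rewrite card_ord.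
(* For each place and each exponent less than its order [e i], an element of exactly that order
   there and of large order at the other places. These are to be independent, whereas there are more
   than [d] of them. *)
have /choice[y hy] : forall a : I, exists y : K,
    (vge (w (tag a)) (tagged a : nat) y && ~~ vge (w (tag a)) ((tagged a : nat)%:Z + 1) y) /\
    forall l, l != tag a -> vge (w l) N y.
  move=> [i k] /=; have [p p0 vp] := place_unif (w i).
  have vpk : vord (w i) (p ^+ k) = k by rewrite vordX // vp mulr1.
  have pk0 : p ^+ k != 0 by rewrite expf_neq0.
  have kN : (k < N)%N := ltn_trans (ltn_ord k) (eN i).
  have [b hb] := weak_approximation (fun v => if v == w i then p ^+ k else 0) N us.
  exists b; split.
    have := hb _ (ws i); rewrite eqxx => h.
    have -> : b = p ^+ k + (b - p ^+ k) by ring.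
    have [] := vordD_dominant (place_hv (w i)) pk0 (y := b - p ^+ k).
      by apply: vge_le h => //; rewrite vpk; lia.
    by move=> n0 o; rewrite !vge_ord // o vpk lexx -ltNge; lia.
  move=> l li; have := hb _ (ws l); rewrite (negbTE (inj_w _ _ li)) subr0 //.
have [|p [a0 pa0] sum0] := dependent_nonzero_const x0 (hd I y _); first by rewrite cardI.
pose i0 := tag a0.
(* Among the terms at [w i0] with nonzero constant coefficient, the one of least exponent [k]
   dominates: a term of smaller exponent has a coefficient divisible by [x], so its order is at
   least [e i0], which exceeds [k]. *)
pose Q (k : nat) := [exists a : I, [&& tag a == i0, (tagged a : nat) == k & (p a)`_0 != 0]].
have exQ : exists k, Q k.
  by exists (tagged a0 : nat); apply/existsP; exists a0; rewrite !eqxx.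
case: (ex_minnP exQ) => k /existsP[a /and3P[/eqP ta /eqP ka pa]] kmin.
suff : \sum_b ev j x (p b) * y b != 0 by rewrite sum0 eqxx.
have vx0 : vge (w i0) (e i0) x by rewrite vge_ord // eE.
have evge b : vge (w i0) 0 (ev j x (p b)) by apply: vge_ev; apply: vge_le vx0.
have k_lt : (k < e i0)%N by rewrite -ka -ta ltn_ord.
apply: (vge_sum_dominant (place_hv (w i0)) (N := k) (i0 := a)).
  have u : vunit (w i0) (ev j x (p a)).
    have [q ->] := ev_split x (p a).
    apply: (vunit_near (place_hv _) (x := j (p a)`_0)); first by rewrite vunit_const.
    rewrite addrK; apply: vgeM0 => //; last by apply: vge_le vx0 => //; lia.
    by apply: vge_ev; apply: vge_le vx0.
  rewrite vgeM_unit //; have [/andP[_ h] _] := hy a.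
  by move: h; rewrite ka ta.
move=> b ba; have [/andP[yb _] yN] := hy b.
have [tb|tb] := eqVneq (tag b) i0; last first.
  apply: vgeM0 => //; apply: vge_le (yN i0 _) => //; last by rewrite eq_sym.
  by have := eN i0; lia.
have {}yb : vge (w i0) (tagged b : nat) (y b) by rewrite -(congr1 w tb).
have [lt|gt|kb] := ltngtP (tagged b : nat) k; last first.
- case/eqP: ba; move: tb kb; rewrite -ta -ka; clear; case: a b => [i k] [i' k'] /= tb.
  by subst i' => /val_inj ->.
- by apply: vgeM0 => //; apply: vge_le yb => //; lia.
have pb : (p b)`_0 = 0.
  apply/eqP/negPn/negP => nz; suff : (k <= tagged b)%N by rewrite leqNgt lt.
  by apply: kmin; apply/existsP; exists b; apply/and3P; split => //; exact/eqP.
apply: vge_le (_ : vge _ ((e i0)%:Z + (tagged b : nat)%:Z) _) => //; first by lia.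
apply: vgeM => //; have [q ->] := ev_split x (p b).
rewrite pb rmorph0 addr0; apply: vgeM0 => //.
by apply: vge_ev; apply: vge_le vx0.
Qed.

Lemma zeros_finite (x : K) : ~ is_constant j x ->
  exists2 s : seq (place j), uniq s & forall v, v \in s <-> 0 < vord v x.
Proof.
move=> /rank_over_subfield[d [_ hd]].
apply: (@bounded_uniq_finite _ (fun v : place j => 0 < vord v x) d) => s us hs.
apply: leq_trans (fundamental_inequality hd us hs).
rewrite -sum1_size big_seq [leqRHS]big_seq; apply: leq_sum => v /hs.
by lia.
Qed.

Lemma place_support_finite (x : K) : x != 0 ->
  exists s : seq (place j), forall v, v \notin s -> vunit v x.
Proof.
move=> x0; have [[c xc]|nc] := pselect (is_constant j x).
  by exists [::] => v _; rewrite xc vunit_const; apply: contraNneq x0 => c0; rewrite xc c0 rmorph0.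
have nc' : ~ is_constant j x^-1.
  by move=> [c xc]; apply: nc; exists c^-1; rewrite fmorphV -xc invrK.
have [s1 _ h1] := zeros_finite nc; have [s2 _ h2] := zeros_finite nc'.
exists (s1 ++ s2) => v; rewrite mem_cat negb_or vunitE // x0 /= => /andP[/negP n1 /negP n2].
have := contra_not (fun h => (h1 v).2 h) n1; have := contra_not (fun h => (h2 v).2 h) n2.
by rewrite vordV // => /negP; rewrite -leNgt => ? /negP; rewrite -leNgt; lia.
Qed.

End CurveField.

(** * Strong approximation for the line *)

Section OnePole.
Variables (C : closedFieldType) (K : fieldType) (j : {rmorphism C -> K}).
Hypothesis two_dependent : forall y : 'I_2 -> K, ~ alg_independent j y.
Hypothesis finitely_generated : exists (N : nat) (xi : 'I_N -> K),
  forall y : K, exists f g : {mpoly C[N]},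
    mmap j xi g != 0 /\ y = mmap j xi f / mmap j xi g.

Lemma constant_vord (v : place j) x : is_constant j x -> vord v x = 0.
Proof.
move=> [c ->]; have [->|c0] := eqVneq c 0; last exact: place_constE.
by rewrite rmorph0 /vord (dvaluation0 (place_hv v)).
Qed.

Lemma support_finite_seq (F : seq K) : exists s : seq (place j),
  forall v, v \notin s -> forall x, x \in F -> x = 0 \/ vunit v x.
Proof.
elim: F => [|x F [s hs]]; first by exists [::].
have [->|x0] := eqVneq x 0.
  by exists s => v /hs h y; rewrite inE => /predU1P[->|/h//]; left.
have [s' hs'] := place_support_finite two_dependent finitely_generated x0.
exists (s' ++ s) => v; rewrite mem_cat negb_or => /andP[/hs' h /hs h'] y.
by rewrite inE => /predU1P[->|/h'//]; right.
Qed.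

(** A pole at [v] outside [W] is cancelled by a power of [t - j (c v)], where [c v] is the residue
    of [t] at [v]. This factor is integral outside [W], so it creates no other pole there. *)
Lemma clear_poles (t : K) (W : seq (place j)) (F : seq K) :
  ~ is_constant j t -> (forall v, v \notin W -> vge v 0 t) ->
  exists2 h : K, h != 0 & forall v, v \notin W -> forall x, x \in F -> vge v 0 (h * x).
Proof.
move=> nc tW; have [B hB] := support_finite_seq F.
have [M hM] := vge_uniform_bound B F.
have : forall v : place j, exists c, v \notin W -> vge v 1 (t - j c).
  move=> v; have [vW|vW] := boolP (v \in W); first by exists 0.
  by have [c hc] := residue_constant two_dependent (tW v vW); exists c.
move=> /choice[c hc].
have nz a : t - j a != 0 by rewrite subr_eq0; apply/eqP => ta; apply: nc; exists a.
exists (\prod_(v <- B) (t - j (c v)) ^+ M).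
  by rewrite prodf_seq_neq0; apply/allP => v _; rewrite /= expf_neq0.
have int v w : v \notin W -> vge v 0 ((t - j (c w)) ^+ M).
  by move=> vW; apply: vgeX => //; apply: vgeB => //; exact: tW.
move=> v vW x xF; have [vB|/hB/(_ _ xF)[->|ux]] := boolP (v \in B).
- rewrite (big_rem v) //= mulrAC; apply: vgeM0r => //; last by apply: vge_prod => // w _; exact: int.
  rewrite -[0](subrr M%:Z); apply: vgeM => //; last exact: hM.
  by have := vgeXN (place_hv v) M (hc v vW); rewrite mulr1.
- by rewrite mulr0 vge0.
by apply: vgeM0 => //; [apply: vge_prod => // w _; exact: int | exact: vunit_ge0].
Qed.

(* If [t] has a simple pole at [s0], the elements [t ^ l e_i] with [l < k] span a
   space of dimension [d k]; cancelling the polar parts and the constant terms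
   at the poles of [t] other than [s0] costs at most [(d - 1) k + O(1)] linear
   conditions, by the fundamental inequality. *)
Lemma one_pole_function (s0 : place j) :
  exists2 u : K, ~ is_constant j u & forall v, v != s0 -> vge v 0 u.
Proof.
have [p p0 vp] := place_unif s0.
have nc : ~ is_constant j p by move/(constant_vord s0); rewrite vp.
have nct : ~ is_constant j p^-1.
  by move=> [c hc]; apply: nc; exists c^-1; rewrite fmorphV -hc invrK.
have [W uW hW] := zeros_finite two_dependent finitely_generated nc.
have s0W : s0 \in W by apply/hW; rewrite vp.
have tW v : v \notin W -> vge v 0 p^-1.
  move=> /negP vW; rewrite vge_ord ?invr_eq0 // vordV // oppr_ge0 leNgt.
  by apply/negP => /hW.
pose W' := rem s0 W.
have memW' v : (v \in W') = (v != s0) && (v \in W) by rewrite mem_rem_uniq.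
have [W'0|W'0] := eqVneq W' [::].
  exists p^-1 => // v vs; apply: tW; apply/negP => vW.
  by have := memW' v; rewrite W'0 vs vW.
have [d [[e0 ind0] hd]] := rank_over_subfield two_dependent finitely_generated nc.
have sumW := fundamental_inequality hd uW (fun v => (hW v).1).
(* The basis is rescaled so that its poles lie among those of [p^-1]; only the places of [W] remain
   to be controlled. *)
have [h h0 hh] := clear_poles [seq e0 i | i <- enum 'I_d] nct tW.
pose e i := h * e0 i.
have eW v i : v \notin W -> vge v 0 (e i).
  by move=> vW; apply: hh => //; apply: map_f; rewrite mem_enum.
have ind : ~ dependent (ev j p) e.
  move=> [q q0 eq0]; apply: ind0; exists q => //; apply: (mulfI h0).
  by rewrite mulr0 -[RHS]eq0 mulr_sumr; apply: eq_bigr => i _; rewrite mulrCA.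
have [c0 hc0] := vge_uniform_bound W [seq e i | i <- enum 'I_d].
(* As [s0] counts for 1 in the fundamental inequality, the other places count for at most [d - 1],
   so there are at most [(d - 1) * k + c0.+1 * size W'] conditions. This [k] makes that less than
   [d * k]. *)
pose k := (c0.+1 * size W').+1.
pose L (w : place j) := (k * `|vord w p| + c0)%N.
pose w (i : 'I_(size W')) := tnth (in_tuple W') i.
have wW' i : w i \in W' by exact: mem_tnth.
pose I : finType := ('I_d * 'I_k)%type.
pose J : finType := {i : 'I_(size W') & 'I_(L (w i)).+1}.
pose y (a : I) := p ^- a.2 * e a.1.
have yL i a : vge (w i) (- (L (w i))%:Z) (y a).
  have := wW' i; rewrite memW' => /andP[_ wW]; have op := (hW _).1 wW.
  rewrite /y /L; have -> : - (k * `|vord (w i) p| + c0)%N%:Z =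
     - (k%:Z * vord (w i) p) + - c0%:Z by rewrite PoszD PoszM gtz0_abs // opprD.
  apply: vgeM => //; last by apply: hc0 => //; apply: map_f; rewrite mem_enum.
  rewrite vge_ord ?invr_eq0 ?expf_neq0 // vordV ?expf_neq0 // vordX // lerN2.
  by rewrite ler_pM2r // lez_nat ltnW.
have /choice[pi hpi] : forall i, exists pi : K, pi != 0 /\ vord (w i) pi = 1.
  by move=> i; have [pi ? ?] := place_unif (w i); exists pi.
have /choice[cf hcf] : forall a : I, exists cf : forall i, nat -> C, forall i,
    vge (w i) 1 (y a - \sum_(m < (L (w i)).+1) j (cf i m) * pi i ^- m).
  move=> a; have /choice[cf hcf] : forall i, exists c : nat -> C,
      vge (w i) 1 (y a - \sum_(m < (L (w i)).+1) j (c m) * pi i ^- m).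
    by move=> i; have [pi0 opi] := hpi i; exact: polar_expansion.
  by exists cf.
have ltJI : (#|J| < #|I|)%N.
  rewrite card_prod !card_ord card_tagged sumnE big_map big_enum /=.
  under eq_bigr => i _ do rewrite card_ord.
  have -> : (\sum_(i < size W') (L (w i)).+1 = \sum_(v <- W') (L v).+1)%N by rewrite big_tnth.
  have -> : (\sum_(v <- W') (L v).+1 = k * \sum_(v <- W') `|vord v p| + c0.+1 * size W')%N.
    rewrite big_distrr /= -sum1_size big_distrr -big_split /=.
    by apply: eq_bigr => v _; rewrite /L muln1 addnS.
  move: sumW; rewrite (big_rem s0) //= vp -/W' => sW.
  have : (k * (1 + \sum_(v <- W') `|vord v p|) <= d * k)%N by rewrite mulnC leq_mul2r sW orbT.
  by apply: leq_trans; rewrite mulnDr muln1 addnC ltn_add2r /k.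
have [l [a0 l0] hl] := linear_dependence
  (fun (a : I) (m : J) => cf a (tag m) (tagged m : nat)) ltJI.
pose u := \sum_a j (l a) * y a.
have uw i : vge (w i) 1 u.
  have -> : u = \sum_a j (l a) * (y a - \sum_(m < (L (w i)).+1) j (cf a i m) * pi i ^- m).
    rewrite (eq_bigr (fun a => j (l a) * y a -
      \sum_(m < (L (w i)).+1) j (l a * cf a i m) * pi i ^- m)); last first.
      move=> a _; rewrite mulrBr mulr_sumr; congr (_ - _).
      by apply: eq_bigr => m _; rewrite rmorphM mulrA.
    rewrite sumrB exchange_big /= [X in _ - X]big1 ?subr0 // => m _.
    have := hl (Tagged (fun i => 'I_(L (w i)).+1) m); rewrite /= => hm.
    by rewrite -mulr_suml -rmorph_sum hm rmorph0 mul0r.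
  by apply: vge_sum => // a _; apply: vgeM0 => //; exact: hcf.
(* Multiplied by [p ^+ k], the equation [u = 0] would be a relation between the [e i] with
   coefficients the polynomials [q i] in [p], not all zero. *)
have u0 : u != 0.
  apply/eqP => u0; apply: ind.
  pose q (i : 'I_d) : {poly C} := \sum_(m < k) l (i, m) *: 'X^(k - m).
  have qc (i : 'I_d) (m : 'I_k) : (q i)`_(k - m) = l (i, m).
    rewrite coef_sum (bigD1 m) //= coefZ coefXn eqxx mulr1 big1 ?addr0 // => m' m'm.
    rewrite coefZ coefXn; case: eqP => [|_]; last by rewrite mulr0.
    move=> e'; case/eqP: m'm; apply: val_inj => /=.
    by have := ltn_ord m; have := ltn_ord m'; lia.
  exists q.
    by exists a0.1; apply: contraNneq l0 => q0; have := qc a0.1 a0.2; rewrite q0 coef0; case: (a0) => ? ? /= <-.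
  rewrite -[RHS](mulr0 (p ^+ k)) -[X in _ = _ * X]u0 /u mulr_sumr.
  transitivity (\sum_i \sum_m p ^+ k * (j (l (i, m)) * y (i, m))); last first.
    by rewrite pair_bigA; apply: eq_bigr => -[].
  apply: eq_bigr => i _; rewrite /q rmorph_sum mulr_suml; apply: eq_bigr => m _.
  rewrite -mul_polyC rmorphM rmorphXn /= evC evX /y /=.
  have km : p ^+ k = p ^+ (k - m) * p ^+ m by rewrite -exprD subnK // ltnW.
  by rewrite km; field; rewrite expf_neq0.
(* At a place of [W'] the nonzero element [u] has positive order, which no constant has; this is why
   the constant terms were cancelled as well. *)
have [i0] : exists i : 'I_(size W'), true.
  by have sW : (0 < size W')%N by [rewrite lt0n size_eq0]; exists (Ordinal sW).
move=> _; exists u.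
  move=> cu; have := uw i0; rewrite vge_ord // (constant_vord _ cu) //.
move=> v vs; have [vW|vW] := boolP (v \in W); last first.
  apply: vge_sum => // a _; apply: vgeM0 => //; apply: vgeM0 => //; last exact: eW.
  by rewrite -exprVn; apply: vgeX => //; exact: tW.
have vW' : v \in W' by rewrite memW' vs.
have ltv : (index v W' < size W')%N by rewrite index_mem.
have wv : w (Ordinal ltv) = v by rewrite /w (tnth_nth v) /= nth_index.
by have := uw (Ordinal ltv); rewrite wv; apply: vge_le.
Qed.
End OnePole.

Section StrongApproximationLine.
Variables (C : closedFieldType) (K : fieldType) (j : {rmorphism C -> K}).
Hypothesis two_dependent : forall y : 'I_2 -> K, ~ alg_independent j y.
Hypothesis finitely_generated : exists (N : nat) (xi : 'I_N -> K),
  forall y : K, exists f g : {mpoly C[N]},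
    mmap j xi g != 0 /\ y = mmap j xi f / mmap j xi g.
Variable S : set (place j).
Hypothesis S_nonempty : S !=set0.

Lemma zeros_minus_constants (u : K) (U : seq C) : ~ is_constant j u ->
  exists W : seq (place j), forall (v : place j) c, c \in U -> vge v 1 (u - j c) -> v \in W.
Proof.
move=> nc; elim: U => [|c U [W hW]]; first by exists [::].
have [|s _ hs] := zeros_finite two_dependent finitely_generated (x := u - j c).
  move=> [d /eqP]; rewrite subr_eq -rmorphD => /eqP e.
  by apply: nc; exists (d + c).
exists (s ++ W) => v d; rewrite inE mem_cat => /predU1P[->|dU] h; last by rewrite (hW v d) ?orbT.
have n0 : u - j c != 0 by rewrite subr_eq0; apply/eqP => e; apply: nc; exists c.
by rewrite (hs v).2 //; rewrite vge_ord // in h; lia.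
Qed.

(* Correct a weak approximation [b] by a polynomial in a function [u] with poles
   in [S] only, close to [1] at [T] and vanishing at the unwanted poles of [b];
   the latter must not share their [u]-value with a place of [T], so [b] is made
   integral at all the places where [u] takes one of these values. *)
Lemma strong_approximation_line (T : seq (place j)) (a : place j -> K) (N : nat) :
  uniq T -> (forall v, v \in T -> ~ S v) ->
  exists b, (forall v, v \in T -> vge v N (b - a v)) /\
    (forall v, ~ S v -> v \notin T -> vge v 0 b).
Proof.
move=> uT TS; have [s0 Ss0] := S_nonempty.
have [u nc us0] := one_pole_function two_dependent finitely_generated s0.
have uS v : ~ S v -> vge v 0 u by move=> vS; apply: us0; apply/eqP => vs; apply: vS; rewrite vs.
have : forall v : place j, exists c, ~ S v -> vge v 1 (u - j c).
  move=> v; have [vS|vS] := pselect (S v); first by exists 0.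
  by have [c hc] := residue_constant two_dependent (uS v vS); exists c.
move=> /choice[rho hrho].
pose U := map rho T.
have [W0 hW0] := zeros_minus_constants U nc.
pose W := undup (T ++ [seq v <- W0 | ~~ `[< S v >]]).
have memW v : ~ S v -> rho v \in U -> v \in W.
  move=> vS vU; rewrite mem_undup mem_cat mem_filter (hW0 v (rho v)) ?hrho //.
  by rewrite andbT; case: asboolP => //; rewrite orbT.
have WT v : v \in T -> v \in W by move=> vT; rewrite mem_undup mem_cat vT.
have WS v : v \in W -> ~ S v.
  by rewrite mem_undup mem_cat mem_filter => /orP[/TS//|/andP[/asboolPn]].
have [b hb] := weak_approximation (fun v => if v \in T then a v else 0) N (undup_uniq _ : uniq W).
have [B hB] := support_finite_seq two_dependent finitely_generated [:: b].
have [Bd hBd] := vge_uniform_bound (T ++ B) [:: b].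
pose M := (N + Bd)%N.
pose U' := [seq c <- map rho B | c \notin U].
pose P (l : seq C) := \prod_(c <- l) ('X - c%:P) ^+ M : {poly C}.
have root_in l x : root (P l) x -> x \in l.
  rewrite /P /root horner_prod prodf_seq_eq0 => /hasP[c cl] /=; rewrite horner_exp hornerXsubC.
  by rewrite expf_eq0 => /andP[_]; rewrite subr_eq0 => /eqP ->.
(* The multiplier [a2 * P U' = 1 - a1 * P U] is congruent to 1 to order [M] at the places off [S]
   where [u] has residue in [U], in particular on [T], and vanishes to order [M] at those where the
   residue is in [U']. *)
have /Bezout_eq1_coprimepP[[a1 a2] /= e12] : coprimep (P U) (P U').
  apply: Pdiv.ClosedField.root_coprimep => x /root_in xU; apply/negP => xU'.
  by have := root_in U' x xU'; rewrite mem_filter xU.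
have evP l v : ~ S v -> vge v 0 (ev j u (P l)) by move=> vS; apply/vge_ev/uS.
have evPM l v : ~ S v -> rho v \in l -> vge v M (ev j u (P l)).
  move=> vS vl; rewrite /P (big_rem _ vl) /= rmorphM /=.
  apply: vgeM0r => //; last exact/vge_ev/uS.
  rewrite rmorphXn rmorphB /= evX evC -[M%:Z]mulr1; apply: vgeXN => //.
  exact: hrho.
have evI p v : ~ S v -> vge v 0 (ev j u p) by move=> vS; apply/vge_ev/uS.
have bB v : v \in T ++ B -> vge v (- Bd%:Z) b by move=> vTB; apply: hBd => //; rewrite inE.
have MN : N%:Z = M%:Z + - Bd%:Z by rewrite /M PoszD addrK.
exists (ev j u (a2 * P U') * b); split=> [v vT|v vS vT].
  have vS := TS v vT.
  have -> : ev j u (a2 * P U') * b - a v = - ev j u a1 * (ev j u (P U) * b) + (b - a v).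
    have -> : a2 * P U' = 1 - a1 * P U by rewrite -e12; ring.
    by rewrite rmorphB rmorph1 rmorphM; ring.
  apply: vgeD => //; last by have := hb v (WT v vT); rewrite vT.
  rewrite mulNr vgeN //; apply: vgeM0 => //; first exact: evI.
  rewrite MN; apply: vgeM => //; first by apply: evPM => //; apply: map_f.
  by apply: bB; rewrite mem_cat vT.
have [vU|vU] := boolP (rho v \in U).
  apply: vgeM0 => //; first exact: evI.
  have := hb v (memW v vS vU); rewrite (negbTE vT) subr0.
  by apply: vge_le.
have [vB|vB] := boolP (v \in B).
  rewrite rmorphM -mulrA; apply: vgeM0 => //; first exact: evI.
  have -> : 0 = Bd%:Z + - Bd%:Z by rewrite subrr.
  apply: vgeM => //; last by apply: bB; rewrite mem_cat vB orbT.
  apply: vge_le (evPM U' v vS _) => //; first by rewrite /M lez_nat leq_addl.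
  by rewrite mem_filter vU map_f.
apply: vgeM0 => //; first exact: evI.
have [|->|/vunit_ge0//] := hB v vB b; first by rewrite inE.
by rewrite vge0.
Qed.

(** Approximating the [N]-th powers of uniformizers, and not 0, ensures a nonzero result. Its
    integer multiples then move an approximation without spoiling it. *)
Lemma small_element (T : seq (place j)) (N : nat) :
  uniq T -> (forall v, v \in T -> ~ S v) ->
  exists2 u, u != 0 & (forall v, v \in T -> vge v N u) /\
    (forall v, ~ S v -> vge v 0 u).
Proof.
move=> uT TS; have [T0|T0] := eqVneq T [::].
  by exists 1; [exact: oner_neq0 | rewrite T0; split=> // v _; exact: vge1].
have : forall v : place j, exists p, p != 0 /\ vord v p = 1.
  by move=> v; have [p p0 vp] := place_unif v; exists p.
move=> /choice[p hp].
have [u [uT' uS]] := strong_approximation_line (fun v => p v ^+ N) N.+1 uT TS.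
have uN v : v \in T -> u != 0 /\ vord v u = N.
  have [p0 vp] := hp v; move=> /uT' h.
  have pN0 : p v ^+ N != 0 by rewrite expf_neq0.
  have pN : vord v (p v ^+ N) = N by rewrite vordX // vp mulr1.
  have [] := vordD_dominant (place_hv v) pN0 (y := u - p v ^+ N).
    by apply: vge_le h => //; rewrite pN; lia.
  by rewrite addrC subrK pN.
case: T T0 uT TS uT' uS uN => // v T _ uT TS uT' uS uN.
exists u; first by have [] := uN v (mem_head _ _).
have uTN w : w \in v :: T -> vge w N u.
  by move=> /uN[u0 ou]; rewrite vge_ord // ou.
split=> // w wS; have [wT|wT] := boolP (w \in v :: T); last exact: uS.
by apply: vge_le (uTN w wT).
Qed.

(** The points with coordinates [b0 i + (m i)%:R * u], with [u] small on [T], satisfy the conditions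
    for all natural numbers [m i]; in characteristic 0 they do not all lie on the hypersurface of
    [p]. *)
Lemma strong_approximation_generic (k : nat) (p : {mpoly K[k]})
    (T : seq (place j)) (a : 'I_k -> place j -> K) (N : nat) : p != 0 ->
  [pchar K] =i pred0 ->
  uniq T -> (forall v, v \in T -> ~ S v) ->
  exists b : 'I_k -> K, [/\ p.@[b] != 0,
    forall i v, v \in T -> vge v N (b i - a i v) &
    forall i v, ~ S v -> v \notin T -> vge v 0 (b i)].
Proof.
move=> p0 ch0 uT TS; have [u u0 [uT' uS]] := small_element N uT TS.
have /choice[b0 hb0] : forall i, exists b, (forall v, v \in T -> vge v N (b - a i v)) /\
    (forall v, ~ S v -> v \notin T -> vge v 0 b).
  by move=> i; exact: strong_approximation_line.
have inj i : injective (fun m : nat => b0 i + m%:R * u).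
  by move=> m m' /addrI/(mulIf u0)/(pchar0_natr_inj ch0).
have [m pm] := mpoly_nonvanishing inj p0.
exists (fun i => b0 i + (m i)%:R * u); split=> // i v.
  move=> vT; rewrite addrAC; apply: vgeD => //; first by have [h _] := hb0 i; exact: h.
  by apply: vgeM0 => //; [exact: vge_nat | exact: uT'].
move=> vS vT; apply: vgeD => //; first by have [_ h] := hb0 i; exact: h.
by apply: vgeM0 => //; [exact: vge_nat | exact: uS].
Qed.

End StrongApproximationLine.

(** * Codimension *)

Section PrimeAvoidance.
Variables (A : comNzRingType) (I M : set A).
Hypothesis I0 : I 0.
Hypothesis I_lin : forall a u v, I u -> I v -> I (a * u + v).
Hypothesis M1 : M 1.
Hypothesis MM : forall x y, M x -> M y -> M (x * y).
Hypothesis IM : forall x, I x -> ~ M x.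

Let good (J : set A) := [/\ I `<=` J,
  forall a u v, J u -> J v -> J (a * u + v) & forall x, J x -> ~ M x].

(** An ideal that is maximal among those containing [I] and disjoint from the multiplicative set [M]
    is prime. The last clause records the maximality, on which the Nullstellensatz below relies. *)
Lemma prime_avoidance : exists P : {pred A}, [/\ prime_ideal P,
  forall x, I x -> x \in P, forall x, M x -> x \notin P &
  forall y, y \notin P -> exists p a, p \in P /\ M (p + a * y)].
Proof.
have [|J [Jgood Jmax]] := @Zorn_bigcup A (fun J => J = set0 \/ good J).
  move=> F FP tot; have [[J [FJ gJ]]|nF] := pselect (exists J, F J /\ good J); last first.
    left; rewrite -subset0 => x [J FJ Jx].
    have [J0|gJ] := FP J FJ; first by rewrite J0 in Jx.
    by apply: nF; exists J.
  have [IJ _ _] := gJ.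
  right; split=> [x Ix|a u v [J1 F1 u1] [J2 F2 v2]|x [J1 F1 x1]].
  - by exists J => //; exact: IJ.
  - have good_of J' y : F J' -> J' y -> good J'.
      by move=> FJ' J'y; have [J0|//] := FP J' FJ'; rewrite J0 in J'y.
    have [s12|s21] := tot J1 J2 F1 F2.
      have [_ lin _] := good_of J2 v F2 v2.
      by exists J2 => //; apply: lin => //; exact: s12.
    have [_ lin _] := good_of J1 u F1 u1.
    by exists J1 => //; apply: lin => //; exact: s21.
  - have [J0|[_ _ dis]] := FP J1 F1; first by rewrite J0 in x1.
    exact: dis.
have {Jgood}[IJ J_lin JM] : good J.
  case: Jgood => // J0; exfalso; apply: (Jmax I); last by right; split.
  by rewrite J0; split; [exact: sub0set | move=> /(_ 0 I0)].
have J0 : J 0 by exact: IJ.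
have JD u v : J u -> J v -> J (u + v) by move=> hu hv; rewrite -[u]mul1r; exact: J_lin.
have JZ a u : J u -> J (a * u) by move=> hu; rewrite -[a * u]addr0; exact: J_lin.
have maxP y : ~ J y -> exists p a, J p /\ M (p + a * y).
  move=> nJy; apply: contrapT => h.
  apply: (Jmax [set x | exists p a, J p /\ x = p + a * y]).
    split=> [x Jx|sub]; first by exists x, 0; rewrite mul0r addr0.
    by apply/nJy/sub; exists 0, 1; rewrite mul1r add0r.
  right; split=> [x /IJ Jx|b u v [p [a [Jp ->]]] [q [c [Jq ->]]]|x [p [a [Jp ->]]] Mx].
  - by exists x, 0; rewrite mul0r addr0.
  - by exists (b * p + q), (b * a + c); split; [exact: J_lin | ring].
  - by apply: h; exists p, a.
pose P : {pred A} := fun x => `[< J x >].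
have inP x : reflect (J x) (x \in P) by exact: asboolP.
exists P; split.
- split; first split.
  + exact/inP.
  + by apply/inP => /JM.
  + by move=> a u v /inP hu /inP hv; apply/inP/J_lin.
  + move=> u v /inP uv; apply/orP.
    apply: contrapT => /not_orP[/negP/inP nu /negP/inP nv].
    have [p [a [Jp M1']]] := maxP u nu; have [q [b [Jq M2]]] := maxP v nv.
    apply: (JM _ _ (MM M1' M2)).
    have -> : (p + a * u) * (q + b * v) =
      (q + b * v) * p + ((a * u) * q + (a * b) * (u * v)) by ring.
    by apply: (JD); [exact: JZ | apply: (JD); exact: JZ].
- by move=> x /IJ Jx; apply/inP.
- by move=> x Mx; apply/inP => /JM.
- move=> y /inP/maxP[p [a [Jp h]]].
  by exists p, a; split => //; apply/inP.
Qed.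

End PrimeAvoidance.

Section IdealSpan.
Variables (A : comNzRingType) (s : seq A).

Lemma ideal_spanP f : reflect (exists c : nat -> A, f = \sum_(k < size s) c k * s`_k)
  (f \in ideal_span s).
Proof. by rewrite /ideal_span inE; exact: asboolP. Qed.

Lemma ideal_span0 : 0 \in ideal_span s.
Proof. by apply/ideal_spanP; exists (fun=> 0); rewrite big1 // => k _; rewrite mul0r. Qed.

Lemma ideal_span_lin a u v :
  u \in ideal_span s -> v \in ideal_span s -> a * u + v \in ideal_span s.
Proof.
move=> /ideal_spanP[c ->] /ideal_spanP[d ->]; apply/ideal_spanP.
exists (fun k => a * c k + d k); rewrite mulr_sumr -big_split /=.
by apply: eq_bigr => k _; ring.
Qed.

Lemma ideal_span_gen x : x \in s -> x \in ideal_span s.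
Proof.
move=> xs; apply/ideal_spanP; exists (fun k => (k == index x s)%:R).
have lt : (index x s < size s)%N by rewrite index_mem.
rewrite (bigD1 (Ordinal lt)) //= eqxx mul1r nth_index // big1 ?addr0 // => k.
by rewrite -val_eqE /= => /negbTE ->; rewrite mul0r.
Qed.

End IdealSpan.

Section Codimension.
Variable K : fieldType.

Definition independent_mod (n k : nat) (u : 'I_k -> {mpoly K[n]})
    (p : {pred {mpoly K[n]}}) :=
  forall F : {mpoly K[k]}, F != 0 -> mmap (@mpolyC n K) u F \notin p.

(** The new element gets the index [ord_max], the variable that [muni] singles out. *)
Definition adjoin_last (T : Type) (k : nat) (u : 'I_k -> T) (w : T) (i : 'I_k.+1) : T :=
  if unlift ord_max i is Some i' then u i' else w.

Lemma adjoin_last_widen T k (u : 'I_k -> T) w i :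
  adjoin_last u w (widen_ord (leqnSn k) i) = u i.
Proof.
rewrite /adjoin_last (_ : widen_ord _ i = lift ord_max i) ?liftK //.
by apply: val_inj; rewrite /= /bump leqNgt ltn_ord.
Qed.

(* The transcendence degree strictly increases when passing to a smaller prime. *)
Lemma independent_mod_adjoin (n k : nat) (u : 'I_k -> {mpoly K[n]})
    (p p' : {pred {mpoly K[n]}}) w :
  prime_ideal p -> prime_ideal p' -> {subset p <= p'} -> w \in p' -> w \notin p ->
  independent_mod u p' -> independent_mod (adjoin_last u w) p.
Proof.
move=> [[p0 _ p_lin] p_prime] [[p'0 _ p'_lin] _] sub wp' wp ind F.
rewrite -muni_eq0 mmap_muni /adjoin_last unlift_none.
rewrite (_ : map_poly _ _ = map_poly (mmap (@mpolyC n K) u) (muni F)); last first.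
  by apply: eq_map_poly => q; apply: eq_mmap => // i; rewrite -/(adjoin_last u w _) adjoin_last_widen.
elim/poly_ind: (muni F) => [|G c IHG]; first by rewrite eqxx.
rewrite rmorphD rmorphM /= map_polyX map_polyC /= !hornerE => nz.
have [c0|c0] := eqVneq c 0.
  rewrite c0 rmorph0 addr0; have G0 : G != 0.
    by apply: contraNneq nz => ->; rewrite mul0r c0 add0r.
  apply/negP => /p_prime; rewrite (negbTE wp) orbF.
  by apply/negP/IHG.
apply/negP => /sub h; have /negP := ind c c0; apply.
set x := _ * w in h *; set y := mmap _ _ _ in h *.
have -> : y = -1 * x + (x + y) by ring.
apply: (p'_lin) => //; rewrite /x -[_ * w]addr0; exact: p'_lin.
Qed.

Lemma zero_ideal_prime (n : nat) : prime_ideal (pred1 (0 : {mpoly K[n]})).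
Proof.
split; first split; rewrite ?inE ?eqxx ?oner_eq0 //.
  by move=> a u v; rewrite !inE => /eqP -> /eqP ->; rewrite mulr0 addr0.
by move=> u v; rewrite !inE mulf_eq0.
Qed.

(* Otherwise [u] stays algebraically independent modulo a prime [P] containing
   the ideal; the two steps of the chain below [P], and [g] itself, extend it to
   [m + 3] independent polynomials in [m + 2] variables. *)
Lemma codim2_relation (m : nat) (g : {mpoly K[m.+2]}) (fs : seq {mpoly K[m.+2]})
    (u : 'I_m -> {mpoly K[m.+2]}) :
  g != 0 -> codim_ge [:: g] fs 2 ->
  exists2 F : {mpoly K[m]}, F != 0 & mmap (@mpolyC _ K) u F \in ideal_span (g :: fs).
Proof.
move=> g0 hcod; apply: contrapT => h.
have nF F : F != 0 -> mmap (@mpolyC _ K) u F \notin ideal_span (g :: fs).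
  by move=> F0; apply/negP => hF; apply: h; exists F.
pose M := [set x | exists2 F : {mpoly K[m]}, F != 0 & x = mmap (@mpolyC _ K) u F].
have [|||||P [Pprime IP MP _]] := @prime_avoidance _ [set` ideal_span (g :: fs)] M.
- exact: ideal_span0.
- by move=> a x y; exact: ideal_span_lin.
- by exists 1; rewrite ?oner_neq0 ?rmorph1.
- by move=> _ _ [F F0 ->] [G G0 ->]; exists (F * G); rewrite ?mulf_neq0 ?rmorphM.
- by move=> x /= xI [F F0 xF]; have := nF F F0; rewrite -xF xI.
have [|p [hp hlt pP]] := hcod P Pprime.
  by move=> x xs; apply/IP/ideal_span_gen.
have ind2 : independent_mod u (p 2%N).
  by move=> F F0; rewrite pP; apply: MP; exists F.
have exw k : (k < 2)%N -> exists2 w, w \in p k.+1 & w \notin p k.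
  move=> k2; have [_ ns] := hlt k k2; apply: contrapT => nw; apply: ns => x xp.
  by apply/negPn/negP => nx; apply: nw; exists x.
have [w1 w1in w1n] := exw 1%N isT; have [w0 w0in w0n] := exw 0%N isT.
have [pr0 gs0] := hp 0%N isT; have [pr1 _] := hp 1%N isT; have [pr2 _] := hp 2%N isT.
have ind1 := independent_mod_adjoin pr1 pr2 (hlt 1%N isT).1 w1in w1n ind2.
have ind0 := independent_mod_adjoin pr0 pr1 (hlt 0%N isT).1 w0in w0n ind1.
have gp0 : g \in p 0%N by apply: gs0; rewrite inE.
have ind : independent_mod (adjoin_last (adjoin_last (adjoin_last u w1) w0) g) (pred1 0).
  apply: (independent_mod_adjoin (zero_ideal_prime _) pr0 _ gp0) => //.
  by move=> x; rewrite inE => /eqP ->; have [[]] := pr0.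
have [F F0 e] := algebraic_dependence
  (adjoin_last (adjoin_last (adjoin_last u w1) w0) g) (ltnSn m.+2).
by have := ind F F0; rewrite e inE eqxx.
Qed.

End Codimension.

(** * Tsen's theorem for quadratic forms *)

Section PrimeIdealFacts.
Variables (A : comNzRingType) (P : {pred A}).
Hypothesis P_prime : prime_ideal P.

Lemma prime_ideal0 : 0 \in P. Proof. by have [[]] := P_prime. Qed.
Lemma prime_ideal1 : 1 \notin P. Proof. by have [[]] := P_prime. Qed.

Lemma prime_idealD u v : u \in P -> v \in P -> u + v \in P.
Proof. by have [[_ _ h] _] := P_prime; move=> hu hv; rewrite -[u]mul1r; exact: h. Qed.

Lemma prime_idealMl a u : u \in P -> a * u \in P.
Proof.
by have [[z _ h] _] := P_prime; move=> hu; rewrite -[_ * _]addr0; exact: h.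
Qed.

Lemma prime_ideal_sum (I : Type) (r : seq I) (F : I -> A) :
  (forall i, F i \in P) -> \sum_(i <- r) F i \in P.
Proof.
by move=> h; elim/big_ind: _ => //; [exact: prime_ideal0 | exact: prime_idealD].
Qed.

Lemma prime_idealM u v : u * v \in P -> u \in P \/ v \in P.
Proof. by have [_ h] := P_prime; move=> /h/orP. Qed.

Lemma prime_idealX u n : u \notin P -> u ^+ n \notin P.
Proof.
move=> nu; elim: n => [|n IHn]; first by rewrite expr0 prime_ideal1.
by rewrite exprS; apply/negP => /prime_idealM[]; apply/negP.
Qed.

Lemma prime_ideal_prod (I : eqType) (r : seq I) (F : I -> A) :
  \prod_(i <- r) F i \in P -> exists i, F i \in P.
Proof.
elim: r => [|i r IHr]; first by rewrite big_nil (negbTE prime_ideal1).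
by rewrite big_cons => /prime_idealM[|/IHr//]; exists i.
Qed.

End PrimeIdealFacts.

Lemma prime_ideal_subst (C : comNzRingType) (M : nat) (P : {pred {mpoly C[M]}})
    (y : 'I_M -> {mpoly C[M]}) (p : {mpoly C[M]}) :
  prime_ideal P -> (forall k, 'X_k - y k \in P) -> p - mmap (@mpolyC M C) y p \in P.
Proof.
move=> hP hy; rewrite -[p in p - _]mmap_id /mmap -sumrB.
apply: prime_ideal_sum => // m; rewrite -mulrBr; apply: prime_idealMl => //.
rewrite /mmap1; elim/big_ind2: _ => [|a b c d h1 h2|k _].
- by rewrite subrr prime_ideal0.
- have -> : b * d - a * c = d * (b - a) + a * (d - c) by ring.
  by apply: prime_idealD => //; apply: prime_idealMl.
elim: (m k) => [|e IHe]; first by rewrite subrr prime_ideal0.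
have -> : 'X_k ^+ e.+1 - y k ^+ e.+1 =
  'X_k ^+ e * ('X_k - y k) + y k * ('X_k ^+ e - y k ^+ e) by rewrite !exprS; ring.
by apply: prime_idealD => //; apply: prime_idealMl.
Qed.

(** The form in which uncountability is used: every map to the natural numbers has an infinite
    fibre. *)
Definition uncountable_pigeonhole (C : eqType) := forall D : C -> nat,
  exists d, forall r : nat, exists2 s : seq C, uniq s /\ size s = r &
    forall c, c \in s -> D c = d.

(** * Nullstellensatz over an uncountable algebraically closed field *)

Section Nullstellensatz.
Variable C : closedFieldType.
Hypothesis C_uncountable : uncountable_pigeonhole C.
Variables (M : nat).
Implicit Types I P : {pred {mpoly C[M]}}.

(* Amitsur's trick: the elements [a c = b ^ d / ('X_k - c b)] modulo [P], for
   uncountably many [c], lie in finitely many finite-dimensional spaces. *)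
Lemma homogeneous_root P (b : {mpoly C[M]}) k : prime_ideal P -> b \notin P ->
  (forall y, y \notin P -> exists p a, p \in P /\ exists e : nat, p + a * y = b ^+ e) ->
  exists c : C, 'X_k - c%:MP * b \in P.
Proof.
move=> hP bP maxP; apply: contrapT => /forallNP h.
have /choice[f hf] : forall c : C, exists f : {mpoly C[M]} * {mpoly C[M]} * nat,
    f.1.1 \in P /\ f.1.1 + f.1.2 * ('X_k - c%:MP * b) = b ^+ f.2.
  move=> c; have /negP/maxP[p [a [pP [e he]]]] := h c.
  by exists ((p, a), e).
have [d hd] := C_uncountable (fun c => (f c).2 + msize (f c).1.2)%N.
pose B := (d * msize b + d)%N.
have [s [us ss] sd] := hd (#|{ffun 'I_M -> 'I_B.+1}|).+1.
pose x (i : 'I_(size s)) := tnth (in_tuple s) i.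
have xD i := sd _ (mem_tnth i (in_tuple s)) : ((f (x i)).2 + msize (f (x i)).1.2 = d)%N.
have x_inj : injective x by apply/tuple_uniqP.
pose p' i := b ^+ (d - (f (x i)).2) * (f (x i)).1.1.
pose a' i := b ^+ (d - (f (x i)).2) * (f (x i)).1.2.
have p'P i : p' i \in P by apply: prime_idealMl => //; have [] := hf (x i).
have eqn i : p' i + a' i * ('X_k - (x i)%:MP * b) = b ^+ d.
  have [_ e] := hf (x i); rewrite -mulrA -mulrDr e -exprD subnK //.
  by rewrite -(xD i) leq_addr.
have sza i : (msize (a' i) <= B.+1)%N.
  apply: (@leq_trans ((d - (f (x i)).2) * msize b + d).+1).
    apply: msizeM_bound; first by apply: msizeX_bound.
    by rewrite ltnW // ltnS -(xD i) leq_addl.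
  by rewrite ltnS leq_add2r leq_mul2r leq_subr orbT.
have [|l [i0 l0] hl] := linear_dependence (fun (i : 'I_(size s)) (g : {ffun 'I_M -> 'I_B.+1}) =>
    (a' i)@_[multinom (g t : nat) | t < M]).
  by rewrite card_ord ss.
have la : \sum_i (l i)%:MP * a' i = 0.
  apply/mpolyP => m; rewrite mcoeff0 raddf_sum /=.
  have [|mB] := leqP (mdeg m) B; last first.
    by apply: big1 => i _; rewrite mcoeffCM (msize_coef0 (sza i)) ?mulr0.
  move=> /box_exponents[g ->]; rewrite -[RHS](hl g).
  by apply: eq_bigr => i _; rewrite mcoeffCM.
pose lin i : {mpoly C[M]} := 'X_k - (x i)%:MP * b.
(* Modulo [P], each [a' i] is [b ^+ d] divided by [lin i]. The product of all [lin t] clears these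
   denominators in the relation [la], which becomes [b ^+ d * G] in [P]. *)
pose G := \sum_i (l i)%:MP * \prod_(t | t != i) lin t.
have GP : b ^+ d * G \in P.
  have -> : b ^+ d * G = \sum_i (l i)%:MP * p' i * \prod_(t | t != i) lin t
      + (\sum_i (l i)%:MP * a' i) * \prod_t lin t.
    rewrite /G mulr_sumr mulr_suml -big_split; apply: eq_bigr => i _ /=.
    by rewrite -(eqn i) (bigD1 (P := xpredT) i) //= -/(lin i); ring.
  rewrite la mul0r addr0; apply: prime_ideal_sum => // i.
  by rewrite mulrAC; apply: prime_idealMl.
have {}GP : G \in P.
  by case: (prime_idealM hP GP) => //; have /negP := prime_idealX hP d bP.
(* [G] is the value of [g] at the fraction ['X_k / b], made homogeneous by powers of [b]. Since [g]
   is nonzero, as its value at [x i0] shows, and splits over [C], up to powers of [b] and a unit [G]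
   is a product of forms ['X_k - c%:MP * b], one of which must lie in [P]. *)
pose g : {poly C} := \sum_i l i *: \prod_(t | t != i) ('X - (x t)%:P).
have g0 : g != 0.
  apply: contraNneq l0 => /(congr1 (fun q => q.[x i0])).
  rewrite horner0 /g horner_sum (bigD1 i0) //= [X in _ + X]big1 ?addr0; last first.
    move=> i ii0; rewrite hornerZ horner_prod (bigD1 i0) 1?eq_sym //=.
    by rewrite hornerXsubC subrr mul0r mulr0.
  rewrite hornerZ horner_prod => /eqP; rewrite mulf_eq0 => /orP[//|].
  rewrite prodf_seq_eq0 => /hasP[t _ /= /andP[ti]].
  by rewrite hornerXsubC subr_eq0 => /eqP/x_inj/esym/eqP; rewrite (negbTE ti).
have b0 : b != 0 by apply: contraNneq bP => ->; exact: prime_ideal0.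
pose emb : {rmorphism C -> {fraction {mpoly C[M]}}} := @tofrac _ \o @mpolyC M C.
pose z : {fraction {mpoly C[M]}} := tofrac 'X_k / tofrac b.
have bF : tofrac b != 0 by rewrite tofrac_eq0.
have linF c : tofrac ('X_k - c%:MP * b) = tofrac b * (z - emb c).
  by rewrite rmorphB rmorphM /= /z mulrBr mulrCA divff // mulr1 mulrC.
have [r gE] := closed_field_poly_normal g.
have sz1 : (0 < size s)%N by rewrite ss.
have evXsubC c : (map_poly emb ('X - c%:P)).[z] = z - emb c.
  by rewrite map_polyXsubC hornerXsubC.
have GF : tofrac G = tofrac b ^+ (size s).-1 * (map_poly emb g).[z].
  rewrite /G /g !rmorph_sum /= horner_sum mulr_sumr; apply: eq_bigr => i _.
  rewrite rmorphM rmorph_prod /= map_polyZ hornerZ rmorph_prod horner_prod /=.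
  rewrite mulrCA; congr (_ * _).
  rewrite (eq_bigr (fun t => tofrac b * (z - emb (x t)))); last by move=> t _; rewrite linF.
  rewrite big_split /= prodr_const; congr (_ ^+ _ * _).
    by rewrite cardC1 card_ord.
  by apply: eq_bigr => t _; rewrite evXsubC.
have prodF : tofrac (\prod_(c <- r) ('X_k - c%:MP * b)) =
    tofrac b ^+ size r * \prod_(c <- r) (z - emb c).
  rewrite rmorph_prod /= (eq_bigr (fun c => tofrac b * (z - emb c))) => [|c _]; last exact: linF.
  by rewrite big_split /= big_const_seq count_predT iter_mulr_1.
have gz : (map_poly emb g).[z] = emb (lead_coef g) * \prod_(c <- r) (z - emb c).
  rewrite {1}gE map_polyZ hornerZ rmorph_prod horner_prod /=; congr (_ * _).
  by apply: eq_bigr => c _; rewrite evXsubC.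
have GE : b ^+ size r * G =
    (lead_coef g)%:MP * b ^+ (size s).-1 * \prod_(c <- r) ('X_k - c%:MP * b).
  apply/eqP; rewrite -tofrac_eq; apply/eqP.
  rewrite rmorphM [RHS]rmorphM [in RHS]rmorphM !rmorphXn /= GF prodF gz /=; ring.
have lcP : (lead_coef g)%:MP \notin P.
  apply/negP => lP; have /negP := prime_ideal1 hP; apply.
  have -> : 1 = (lead_coef g)^-1%:MP * (lead_coef g)%:MP :> {mpoly C[M]}.
    by rewrite -mpolyCM mulVf ?lead_coef_eq0.
  exact: prime_idealMl.
have : b ^+ size r * G \in P by exact: prime_idealMl.
rewrite GE => /(prime_idealM hP)[/(prime_idealM hP)[lP|bP']|].
- by rewrite lP in lcP.
- by have /negP := prime_idealX hP (size s).-1 bP.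
by move=> /(prime_ideal_prod hP)[c /(h c)].
Qed.

(** A prime maximal among those avoiding the powers of ['X_k0] is a closed point of the chart where
    ['X_k0] is invertible, so the ratios ['X_k / 'X_k0] are constants modulo it. *)
Lemma homogeneous_nullstellensatz (I : {pred {mpoly C[M]}}) (k0 : 'I_M) :
  0 \in I -> (forall a u v, u \in I -> v \in I -> a * u + v \in I) ->
  (forall e, 'X_k0 ^+ e \notin I) ->
  exists2 P : {pred {mpoly C[M]}}, prime_ideal P /\ {subset I <= P} &
    'X_k0 \notin P /\ exists c : 'I_M -> C, forall k, 'X_k - (c k)%:MP * 'X_k0 \in P.
Proof.
move=> I0 I_lin IX.
pose S := [set x : {mpoly C[M]} | exists e : nat, x = 'X_k0 ^+ e].
have [|||||P [hP IP SP maxP]] := @prime_avoidance _ [set` I] S => //.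
- by exists 0%N.
- by move=> _ _ [e ->] [e' ->]; exists (e + e')%N; rewrite exprD.
- by move=> x /= xI [e xe]; have := IX e; rewrite -xe xI.
have bP : 'X_k0 \notin P by apply: SP; exists 1%N.
exists P; split => //.
have /choice[c hc] : forall k, exists c : C, 'X_k - c%:MP * 'X_k0 \in P.
  by move=> k; exact: homogeneous_root hP bP maxP.
by exists c.
Qed.

End Nullstellensatz.

Section LinearSpan.
Variables (C : fieldType) (V : lmodType C).

Definition lspan (J : finType) (F : J -> V) (y : V) :=
  exists c : J -> C, y = \sum_k c k *: F k.

Lemma lspan_gen (J : finType) (F : J -> V) k : lspan F (F k).
Proof.
exists (fun k' => (k' == k)%:R); rewrite (bigD1 k) //= eqxx scale1r big1 ?addr0 //.
by move=> k' /negbTE ->; rewrite scale0r.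
Qed.

Lemma lspan_sum (I : Type) (r : seq I) (J : finType) (F : J -> V) (z : I -> V) :
  (forall i, lspan F (z i)) -> lspan F (\sum_(i <- r) z i).
Proof.
move=> h; elim/big_ind: _ => [|x y [c ->] [d ->]|i _ //].
  by exists (fun=> 0); rewrite big1 // => k _; rewrite scale0r.
exists (fun k => c k + d k); rewrite -big_split; apply: eq_bigr => k _.
by rewrite scalerDl.
Qed.

Lemma lspanZ (J : finType) (F : J -> V) a y : lspan F y -> lspan F (a *: y).
Proof.
move=> [c ->]; exists (fun k => a * c k); rewrite scaler_sumr.
by apply: eq_bigr => k _; rewrite scalerA.
Qed.

Lemma lspan_dependent (I J : finType) (F : J -> V) (y : I -> V) :
  (#|J| < #|I|)%N -> (forall i, lspan F (y i)) ->
  exists2 l : I -> C, exists i, l i != 0 & \sum_i l i *: y i = 0.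
Proof.
move=> lt /choice[c hc]; have [l l0 hl] := linear_dependence c lt.
exists l => //; under eq_bigr => i _ do rewrite hc scaler_sumr.
rewrite exchange_big big1 // => k _.
under eq_bigr => i _ do rewrite scalerA.
by rewrite -scaler_suml hl scale0r.
Qed.

End LinearSpan.

(** * Nontrivial common zeros of quadrics *)

Section CommonZero.
Variable C : closedFieldType.
Hypothesis C_uncountable : uncountable_pigeonhole C.
Variables (N M : nat) (f : 'I_N -> {mpoly C[M]}).
Hypothesis f_homog : forall k, f k \is 2.-homog.

Lemma homog_meval_scale (p b : {mpoly C[M]}) d (c : 'I_M -> C) : p \is d.-homog ->
  mmap (@mpolyC M C) (fun k => (c k)%:MP * b) p = p.@[c]%:MP * b ^+ d.
Proof.
move=> /dhomogP hp; rewrite mevalE /mmap raddf_sum mulr_suml big_seq [RHS]big_seq.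
apply: eq_bigr => m /hp md; have -> : d = (\sum_i m i)%N by rewrite -md; exact: mdegE.
rewrite /= mpolyCM -mulrA; congr (_ * _).
rewrite /mmap1 rmorph_prod /=.
rewrite -prodrXr -big_split; apply: eq_bigr => i _.
by rewrite exprMn rmorphXn.
Qed.

Lemma pihomogMr (p q : {mpoly C[M]}) e d : q \is d.-homog ->
  pihomog mdeg (e + d)%N (p * q) = pihomog mdeg e p * q.
Proof.
move=> hq; pose k := maxn (msize p) e.+1.
rewrite {1}(@pihomog_partitionE _ _ mdeg k p) ?leq_maxl //.
rewrite mulr_suml raddf_sum /=.
have ek : (e < k)%N by rewrite /k leq_maxr.
rewrite (bigD1 (Ordinal ek)) //= big1 ?addr0.
  by rewrite pihomog_dE //; apply: dhomogM => //; exact: pihomogP.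
move=> i ie; apply: (@pihomog_ne0 _ _ _ (i + d)%N).
  by rewrite eqn_add2r; rewrite -val_eqE in ie.
by apply: dhomogM => //; exact: pihomogP.
Qed.

Lemma homogeneous_part_relation (k0 : 'I_M) (e : nat) :
  'X_k0 ^+ (e + 2)%N \in ideal_span [seq f k | k <- enum 'I_N] ->
  exists2 g : 'I_N -> {mpoly C[M]}, 'X_k0 ^+ (e + 2)%N = \sum_k g k * f k &
    forall k, g k \is e.-homog.
Proof.
move=> /ideal_spanP[c]; rewrite size_map size_enum_ord => E.
exists (fun k => pihomog mdeg e (c k)); last by move=> k; exact: pihomogP.
have hX : ('X_k0 ^+ (e + 2)%N : {mpoly C[M]}) \is (e + 2)%N.-homog.
  have := dhomogMn (e + 2)%N (_ : ('X_k0 : {mpoly C[M]}) \is 1%N.-homog).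
  by rewrite mul1n; apply; rewrite dhomogX /= mdeg1.
rewrite -[LHS](pihomog_dE hX) E raddf_sum; apply: eq_bigr => k _ /=.
rewrite (nth_map k) ?size_enum_ord // nth_ord_enum.
exact: pihomogMr.
Qed.

Section NoZero.
Variable e : nat.
Hypothesis power_in : forall k0 : 'I_M,
  'X_k0 ^+ (e + 2)%N \in ideal_span [seq f k | k <- enum 'I_N].

Let J (s : nat) : finType :=
  ({ffun 'I_M -> 'I_(e + 2)} * {ffun 'I_N -> 'I_s.+1})%type.
Let G s (a : J s) : {mpoly C[M]} :=
  'X_[[multinom (a.1 i : nat) | i < M]] * \prod_k f k ^+ a.2 k.

(** An exponent that reaches [e + 2] is reduced by the relation [power_in]: each factor [f k] so
    gained costs degree 2. Hence one bound [s] serves for the degree and for the exponents of the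
    [f k]. *)
Lemma monomial_in_span s (m : 'X_{1..M}) : (mdeg m <= s)%N -> lspan (@G s) 'X_[m].
Proof.
elim: s m => [|s IHs] m hm.
  have m0 : m = 0%MM by apply/eqP; rewrite -mdeg_eq0 -leqn0.
  have e2 : (0 < e + 2)%N by rewrite addnS.
  have := lspan_gen (@G 0) ([ffun=> Ordinal e2], [ffun=> ord0]).
  rewrite {2}/G /= [X in _ * X]big1; last by move=> i _; rewrite ffunE expr0.
  by rewrite mulr1 m0; congr (lspan _ 'X_[_]); apply/mnmP => i; rewrite mnmE ffunE mnm0E.
have [small|] := pselect (forall i, (m i < e + 2)%N).
  have := lspan_gen (@G s.+1) ([ffun i => Ordinal (small i)], [ffun=> ord0]).
  rewrite {2}/G /= [X in _ * X]big1; last by move=> i _; rewrite ffunE expr0.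
  by rewrite mulr1; congr (lspan _ 'X_[_]); apply/mnmP => i; rewrite mnmE ffunE.
move=> /existsNP[k0 /negP]; rewrite -leqNgt => le.
have [g gE gh] := homogeneous_part_relation (power_in k0).
have mE : m = (U_(k0) *+ (e + 2)%N + (m - U_(k0) *+ (e + 2)%N))%MM.
  rewrite addmC submK //; apply/mnm_lepP => i; rewrite mulmnE mnm1E.
  by case: eqP => [<-|_]; rewrite ?mul1n ?mul0n.
set m' := (m - _)%MM in mE.
have dm' : (mdeg m' + (e + 2) <= s.+1)%N.
  by apply: leq_trans hm; rewrite {1}mE mdegD mdegMn mdeg1 mul1n addnC.
rewrite mE mpolyXD -mpolyXn gE mulr_suml; apply: lspan_sum => k.
have -> : g k * f k * 'X_[m'] = \sum_(m1 <- msupp (g k)) (g k)@_m1 *: ('X_[m1 + m'] * f k).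
  rewrite mulrAC [g k in LHS]mpolyE !mulr_suml; apply: eq_bigr => m1 _.
  by rewrite mpolyXD -!scalerAl.
rewrite big_seq; apply: (big_ind (lspan (@G s.+1))) => [|x y [c ->] [d ->]|m1 m1g].
- by exists (fun=> 0); rewrite big1 // => i _; rewrite scale0r.
- exists (fun i => c i + d i); rewrite -big_split; apply: eq_bigr => i _.
  by rewrite scalerDl.
apply: lspanZ.
have dm1 : mdeg m1 = e by move/dhomogP: (gh k) => /(_ m1 m1g).
have [c ->] : lspan (@G s) 'X_[m1 + m'] by apply: IHs; rewrite mdegD dm1; lia.
rewrite mulr_suml; apply: lspan_sum => a; rewrite -scalerAl; apply: lspanZ.
have := lspan_gen (@G s.+1) (a.1, [ffun i => inord (a.2 i + (i == k))]).
rewrite {2}/G /G /= -mulrA; congr (lspan _ (_ * _)).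
rewrite (bigD1 k) //= [X in _ = X * _](bigD1 k) //= ffunE eqxx addn1.
rewrite inordK; last by rewrite ltnS ltn_ord.
rewrite exprSr -!mulrA; congr (_ * _); rewrite mulrC; congr (_ * _).
apply: eq_bigr => i ik; rewrite ffunE (negbTE ik) addn0 inordK //.
by rewrite ltnW // ltnS ltn_ord.
Qed.

(* The polynomial ring is a finite module over the subring generated by the
   [f k], so its growth is at most that of [N] variables. *)
Lemma no_zero_bound : (M <= N)%N.
Proof.
rewrite leqNgt; apply/negP => NM.
have [a [a0 ha]] := box_growth ((e + 2) ^ M) M.+1 NM.
pose mon (g : {ffun 'I_M -> 'I_a}) := [multinom (g i : nat) | i < M].
have dmon g : (mdeg (mon g) <= M * a)%N.
  rewrite mdegE -[M in (M * _)%N]card_ord -sum_nat_const leq_sum // => i _.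
  by rewrite mnmE ltnW.
have lt : (#|J (M * a)| < #|{ffun 'I_M -> 'I_a}|)%N.
  rewrite card_prod !card_ffun !card_ord; apply: leq_ltn_trans ha.
  rewrite leq_mul2l; apply/orP; right.
  by case: (N) => // N'; rewrite leq_exp2r //; nia.
have [l [g0 l0]] := lspan_dependent lt (fun g => monomial_in_span (dmon g)).
have inj_mon : injective mon.
  move=> g g' /mnmP h; apply/ffunP => i; apply: val_inj.
  by have := h i; rewrite !mnmE.
move=> /(congr1 (mcoeff (mon g0))); rewrite mcoeff0 raddf_sum (bigD1 g0) //=.
rewrite mcoeffZ mcoeffX eqxx mulr1 big1 ?addr0 => [/eqP|g gg0]; first by apply/negP.
by rewrite mcoeffZ mcoeffX (inj_eq inj_mon) (negbTE gg0) mulr0.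
Qed.

End NoZero.

(** Either no power of some variable lies in the ideal of the [f k], and the Nullstellensatz gives a
    zero where that coordinate is nonzero, or every variable is nilpotent modulo the ideal, and
    [no_zero_bound] forbids [N < M]. *)
Theorem quadrics_common_zero : (N < M)%N ->
  exists2 x : 'I_M -> C, exists i, x i != 0 & forall k, (f k).@[x] = 0.
Proof.
move=> NM; pose I := ideal_span [seq f k | k <- enum 'I_N].
have fI k : f k \in I by apply: ideal_span_gen; apply: map_f; rewrite mem_enum.
have [[k0 hk0]|no] := pselect (exists k0 : 'I_M, forall e, 'X_k0 ^+ e \notin I).
  have [P [hP IP] [bP [c hc]]] := homogeneous_nullstellensatz C_uncountable
    (ideal_span0 _) (@ideal_span_lin _ _) hk0.
  exists c.
    exists k0; apply/eqP => c0; have := hc k0.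
    by rewrite c0 mul0r subr0 (negbTE bP).
  move=> k; apply/eqP; apply: contraT => n0.
  have := prime_ideal_subst (f k) hP hc; rewrite (homog_meval_scale _ _ (f_homog k)).
  have fP := IP _ (fI k) => h.
  have : (f k).@[c]%:MP * 'X_k0 ^+ 2 \in P.
    have -> : (f k).@[c]%:MP * 'X_k0 ^+ 2 = f k + -1 * (f k - (f k).@[c]%:MP * 'X_k0 ^+ 2) by ring.
    by apply: prime_idealD => //; exact: prime_idealMl.
  move=> /(prime_idealMl hP ((f k).@[c])^-1%:MP).
  by rewrite mulrA -mpolyCM mulVf // mpolyC1 mul1r (negbTE (prime_idealX hP 2 bP)).
have : forall k0 : 'I_M, exists e, 'X_k0 ^+ e \in I.
  move=> k0; apply: contrapT => h; apply: no; exists k0 => e.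
  by apply/negP => he; apply: h; exists e.
move=> /choice[e he]; suff : (M <= N)%N by rewrite leqNgt NM.
apply: (@no_zero_bound (\max_k e k)) => k0.
have [d ->] : exists d, (\max_k e k + 2 = d + e k0)%N.
  exists (\max_k e k + 2 - e k0)%N; rewrite subnK // (leq_trans (leq_bigmax k0)) //.
  exact: leq_addr.
rewrite exprD -[_ * _]addr0; apply: ideal_span_lin => //; exact: ideal_span0.
Qed.

End CommonZero.

(** Already on the real numbers some fibre is infinite: otherwise they would be countable, and the
    unit interval would have Lebesgue measure 0. *)
Lemma real_uncountable_pigeonhole (R : realType) : uncountable_pigeonhole R[i].
Proof.
move=> D; pose A d := [set x : R | D x%:C%C = d].
have [d Ad] : exists d, infinite_set (A d).
  apply: contrapT => /forallNP h.
  have : countable [set: R].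
    have -> : [set: R] = \bigcup_d A d.
      by apply/seteqP; split=> // x _; exists (D x%:C%C).
    apply: bigcup_countable => // d _; apply: finite_set_countable.
    exact: contrapT (h d).
  move=> /(sub_countable (subset_card_le (@subsetT _ [set` `[0%R, 1%R]]))).
  move=> /countable_lebesgue_measure0; rewrite lebesgue_measure_itv /= lte01 oppr0 adde0.
  by move=> /eqP; rewrite onee_eq0.
exists d => r; have [B BA rB] := infinite_set_fset r Ad.
exists [seq x%:C%C | x <- take r (finmap.enum_fset B)].
  split; last by rewrite size_map size_take_min; apply/minn_idPl.
  by rewrite map_inj_uniq ?take_uniq ?finmap.fset_uniq // => x y [].
by move=> c /mapP[x /mem_take xB ->]; exact: (BA x).
Qed.

Lemma quadrics_common_zero_finType (C : closedFieldType) (I J : finType)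
    (A : J -> I -> I -> C) :
  uncountable_pigeonhole C -> (#|J| < #|I|)%N ->
  exists2 l : I -> C, exists t, l t != 0 &
    forall k, \sum_t \sum_t' A k t t' * (l t * l t') = 0.
Proof.
move=> hC ltJI.
pose f (k : 'I_#|J|) : {mpoly C[#|I|]} := \sum_t \sum_t'
  A (enum_val k) t t' *: ('X_(enum_rank t) * 'X_(enum_rank t')).
have X1 k : ('X_k : {mpoly C[#|I|]}) \is 1%N.-homog by rewrite dhomogX /= mdeg1.
have fh k : f k \is 2%N.-homog.
  by apply: rpred_sum => t _; apply: rpred_sum => t' _; apply: rpredZ; exact: (dhomogM (X1 _) (X1 _)).
have [x [i xi] hx] := quadrics_common_zero hC fh ltJI.
exists (fun t => x (enum_rank t)).
  by exists (enum_val i); rewrite enum_valK.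
move=> k; rewrite -[RHS](hx (enum_rank k)) /f enum_rankK raddf_sum.
apply: eq_bigr => t _; rewrite raddf_sum; apply: eq_bigr => t' _.
by rewrite /= mevalZ mevalM !mevalXU.
Qed.

(** [Q] need not be symmetric; the polar form will be built from [Q a b + Q b a], without division
    by 2. *)
Lemma quadratic_form_sum (K : fieldType) (n : nat) (q : {mpoly K[n]}) :
  q \is 2%N.-homog ->
  exists Q : 'I_n -> 'I_n -> K, q = \sum_a \sum_b Q a b *: ('X_a * 'X_b).
Proof.
move=> /dhomogP hq; rewrite [q]mpolyE big_seq.
apply: (big_ind (fun p => exists Q : 'I_n -> 'I_n -> K,
   p = \sum_a \sum_b Q a b *: ('X_a * 'X_b))) => [|p p' [Q ->] [Q' ->]|m /hq md].
- exists (fun _ _ => 0); rewrite big1 // => a _; rewrite big1 // => b _.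
  by rewrite scale0r.
- exists (fun a b => Q a b + Q' a b); rewrite -big_split; apply: eq_bigr => a _.
  by rewrite -big_split; apply: eq_bigr => b _; rewrite scalerDl.
have [a ma] : exists a, (0 < m a)%N.
  apply: contrapT => h; suff : mdeg m = 0%N by rewrite md.
  by rewrite mdegE big1 // => i _; apply/eqP; rewrite -leqn0 leqNgt; apply/negP => ?; apply: h; exists i.
have mE : m = (U_(a) + (m - U_(a)))%MM by rewrite addmC submK // lep1mP -lt0n.
have : mdeg (m - U_(a))%MM == 1%N.
  have md' : mdeg m = 2%N by exact: md.
  by rewrite -(eqn_add2l 1) -(mdeg1 a) -mdegD -mE md' mdeg1.
move=> /mdeg1P[b /eqP bE].
exists (fun a' b' => q@_m * ((a' == a) && (b' == b))%:R).
rewrite (bigD1 a) //= (bigD1 b) //= !eqxx mulr1 !big1 ?addr0; last first.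
- by move=> b' /negbTE b'b; rewrite b'b andbF mulr0 scale0r.
- move=> a' /negbTE a'a; rewrite big1 // => b' _.
  by rewrite a'a mulr0 scale0r.
by congr (_ *: _); rewrite {1}mE mpolyXD bE.
Qed.

Section Tsen.
Variables (C : closedFieldType) (K : fieldType) (j : {rmorphism C -> K}).
Hypothesis C_uncountable : uncountable_pigeonhole C.
Hypothesis two_dependent : forall y : 'I_2 -> K, ~ alg_independent j y.
Hypothesis finitely_generated : exists (N : nat) (xi : 'I_N -> K),
  forall y : K, exists f g : {mpoly C[N]},
    mmap j xi g != 0 /\ y = mmap j xi f / mmap j xi g.

Lemma maximal_independent_spans (t : K) (d : nat) (e : 'I_d -> K) :
  (forall (I : finType) (y : I -> K), (d < #|I|)%N -> dependent (ev j t) y) ->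
  ~ dependent (ev j t) e -> forall y, in_span (ev j t) e y.
Proof.
move=> hd ind y.
have [|p [i0 p0]] := hd 'I_d.+1 (adjoin_last e y); first by rewrite card_ord.
rewrite big_ord_recr /= {2}/adjoin_last unlift_none.
under eq_bigr => i _ do rewrite adjoin_last_widen.
move=> E; exists (p ord_max).
  apply/eqP => pm; apply: ind; exists (fun i => p (widen_ord (leqnSn d) i)).
    case: (unliftP ord_max i0) => [i i0E|i0E]; last by rewrite i0E pm eqxx in p0.
    exists i; rewrite (_ : widen_ord _ i = i0) // i0E.
    by apply: val_inj; rewrite /= /bump leqNgt ltn_ord.
  by move: E; rewrite pm rmorph0 mul0r addr0.
exists (fun i => - p (widen_ord (leqnSn d) i)).
rewrite (eq_bigr (fun i => - (ev j t (p (widen_ord (leqnSn d) i)) * e i))).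
  by rewrite sumrN; apply/eqP; rewrite -addr_eq0 addrC E.
by move=> i _; rewrite rmorphN mulNr.
Qed.

Lemma in_span_common (t : K) (I J : finType) (F : J -> K) (y : I -> K) :
  (forall i, in_span (ev j t) F (y i)) ->
  exists2 h : {poly C}, h != 0 & exists p : I -> J -> {poly C},
    forall i, ev j t h * y i = \sum_k ev j t (p i k) * F k.
Proof.
move=> hy; have /choice[hp hhp] : forall i, exists hp : {poly C} * (J -> {poly C}),
    hp.1 != 0 /\ ev j t hp.1 * y i = \sum_k ev j t (hp.2 k) * F k.
  by move=> i; have [h h0 [p e]] := hy i; exists (h, p).
exists (\prod_i (hp i).1); first by apply/prodf_neq0 => i _; have [] := hhp i.
exists (fun i k => (\prod_(i' | i' != i) (hp i').1) * (hp i).2 k) => i.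
rewrite (bigD1 i) //= mulrC rmorphM mulrA [y i * _]mulrC; have [_ ->] := hhp i.
by rewrite mulr_suml; apply: eq_bigr => k _; rewrite rmorphM; ring.
Qed.

(* With respect to a basis of [K] over [C(t)] of size [d], searching for
   coordinates of degree less than [m] gives about [2 d m] quadratic equations
   over [C] in [n d m] unknowns. *)
Theorem Tsen_quadratic (n : nat) (q : {mpoly K[n]}) (t : K) :
  ~ is_constant j t -> (3 <= n)%N -> q \is 2%N.-homog ->
  exists2 x : 'I_n -> K, exists i, x i != 0 & q.@[x] = 0.
Proof.
move=> nc n3 hq; have [Q qE] := quadratic_form_sum hq.
have trt := algebraic_constant nc.
have [d [[e ind] hd]] := rank_over_subfield two_dependent finitely_generated nc.
have d0 : (0 < d)%N.
  rewrite lt0n; apply/eqP => d0.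
  have [|p [i p0]] := hd 'I_1 (fun=> 1); first by rewrite card_ord d0.
  by rewrite big_ord1 mulr1 => /trt p0'; rewrite (ord1 i) p0' eqxx in p0.
(* After multiplication by a common denominator [H], the products [Q a b * e i * e i'] have
   polynomial coordinates [r] in the basis [e], of size at most [D]. *)
pose X := ('I_n * 'I_n * 'I_d * 'I_d)%type.
have [H H0 [r hr]] := in_span_common
  (fun x : X => maximal_independent_spans hd ind (Q x.1.1.1 x.1.1.2 * e x.1.2 * e x.2)).
pose D := (\max_x \max_k size (r x k))%N.
have rD x k : (size (r x k) <= D)%N.
  by apply: leq_trans (leq_bigmax x); exact: (leq_bigmax k).
(* There are [d * (2 * m + D)] equations for [n * d * m] unknowns; [D < m] and [3 <= n] give more
   unknowns than equations. *)
pose m := D.+1.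
pose I : finType := ('I_n * 'I_d * 'I_m)%type.
pose J : finType := ('I_d * 'I_(2 * m + D))%type.
pose A (k : J) (a b : I) := (r (a.1.1, b.1.1, a.1.2, b.1.2) k.1 * 'X^(a.2 + b.2))`_k.2.
have lt : (#|J| < #|I|)%N.
  rewrite !card_prod !card_ord mulnC -[(n * d * m)%N]mulnAC ltn_pmul2r //.
  by rewrite /m; nia.
have [l [t0 l0] hl] := quadrics_common_zero_finType A C_uncountable lt.
pose p a i : {poly C} := \sum_(s < m) l (a, i, s) *: 'X^s.
pose x a := \sum_i ev j t (p a i) * e i.
exists x.
  apply: contrapT => nx; have x0 a : x a = 0.
    by apply/eqP/negPn/negP => h; apply: nx; exists a.
  apply: ind; exists (p t0.1.1); last exact: x0.
  exists t0.1.2; apply: contraNneq l0 => /(congr1 (fun p : {poly C} => p`_t0.2)).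
  rewrite coef0 coef_sum (bigD1 t0.2) //= big1 ?addr0.
    by rewrite coefZ coefXn eqxx mulr1 -!surjective_pairing => ->.
  move=> s st; rewrite coefZ coefXn; case: eqP => [/val_inj e0|_]; last by rewrite mulr0.
  by rewrite e0 eqxx in st.
pose P k : {poly C} := \sum_a \sum_i \sum_b \sum_i' r (a, b, i, i') k * p a i * p b i'.
have sum3 (F : I -> {poly C}) : \sum_a F a = \sum_a \sum_i \sum_s F (a, i, s).
  by rewrite pair_bigA pair_bigA /=; apply: eq_bigr => -[[]].
have PE k : P k = \sum_a \sum_b
    (l a * l b) *: (r (a.1.1, b.1.1, a.1.2, b.1.2) k * 'X^(a.2 + b.2)).
  rewrite sum3; apply: eq_bigr => a _; apply: eq_bigr => i _.
  under [RHS]eq_bigr => s _ do rewrite sum3.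
  rewrite [RHS]exchange_big; apply: eq_bigr => b _ /=.
  rewrite [RHS]exchange_big; apply: eq_bigr => i' _ /=.
  rewrite [p a i]/p [r _ k * _]mulr_sumr mulr_suml; apply: eq_bigr => s _.
  rewrite [p b i']/p mulr_sumr; apply: eq_bigr => s' _.
  by rewrite -!mul_polyC exprD polyCM; ring.
have P0 k : P k = 0.
  apply/polyP => s; rewrite coef0 PE.
  have [sD|sD] := ltnP s (2 * m + D).
    rewrite -[RHS](hl (k, Ordinal sD)) coef_sum; apply: eq_bigr => a _.
    by rewrite coef_sum; apply: eq_bigr => b _; rewrite coefZ /A /= mulrC.
  rewrite coef_sum big1 // => a _; rewrite coef_sum big1 // => b _.
  rewrite coefZ nth_default ?mulr0 //; apply: leq_trans sD.
  apply: leq_trans (size_polyMleq _ _) _; rewrite size_polyXn addnS /=.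
  have ab : (a.2 + b.2 <= 2 * m)%N by rewrite mul2n -addnn leq_add // ltnW.
  by rewrite addnC leq_add.
have HQ : ev j t H * q.@[x] = \sum_k ev j t (P k) * e k.
  have -> : \sum_k ev j t (P k) * e k = \sum_a \sum_i \sum_b \sum_i' \sum_k
      ev j t (r (a, b, i, i') k * p a i * p b i') * e k.
    under eq_bigr => k _ do rewrite /P rmorph_sum mulr_suml.
    rewrite exchange_big; apply: eq_bigr => a _ /=.
    under eq_bigr => k _ do rewrite rmorph_sum mulr_suml.
    rewrite exchange_big; apply: eq_bigr => i _ /=.
    under eq_bigr => k _ do rewrite rmorph_sum mulr_suml.
    rewrite exchange_big; apply: eq_bigr => b _ /=.
    under eq_bigr => k _ do rewrite rmorph_sum mulr_suml.
    by rewrite exchange_big.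
  rewrite qE raddf_sum mulr_sumr; apply: eq_bigr => a _ /=.
  rewrite raddf_sum mulr_sumr exchange_big; apply: eq_bigr => b _ /=.
  rewrite mevalZ mevalM !mevalXU [x a]/x !(mulr_suml, mulr_sumr).
  apply: eq_bigr => i _; rewrite [x b]/x !(mulr_suml, mulr_sumr); apply: eq_bigr => i' _.
  have := hr (a, b, i, i') => /= hri.
  have -> : ev j t H * (Q a b * (ev j t (p a i) * e i * (ev j t (p b i') * e i'))) =
    (ev j t H * (Q a b * e i * e i')) * (ev j t (p a i) * ev j t (p b i')) by ring.
  rewrite hri mulr_suml; apply: eq_bigr => k _; rewrite !rmorphM /=; ring.
apply/eqP; have : ev j t H * q.@[x] == 0.
  by rewrite HQ big1 // => k _; rewrite P0 rmorph0 mul0r.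
rewrite mulf_eq0 => /orP[/eqP/trt H0'|//].
by rewrite H0' eqxx in H0.
Qed.
End Tsen.

(** * Adapted coordinates *)

Section Frames.
Variables (K : fieldType) (n : nat) (q : {mpoly K[n]}).
Hypothesis two_neq0 : 2%:R != 0 :> K.
Variable Q : 'I_n -> 'I_n -> K.
Hypothesis qE : q = \sum_a \sum_b Q a b *: ('X_a * 'X_b).
Implicit Types x y u v : 'rV[K]_n.

Definition qf x : K := q.@[fun a => x 0 a].
Definition polar x y : K := \sum_a \sum_b (Q a b + Q b a) * (x 0 a * y 0 b).

Lemma qfE x : qf x = \sum_a \sum_b Q a b * (x 0 a * x 0 b).
Proof.
rewrite /qf qE raddf_sum; apply: eq_bigr => a _; rewrite raddf_sum.
by apply: eq_bigr => b _; rewrite /= mevalZ mevalM !mevalXU.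
Qed.

Lemma polarC x y : polar x y = polar y x.
Proof.
rewrite /polar exchange_big; apply: eq_bigr => a _; apply: eq_bigr => b _; ring.
Qed.

Lemma polarDl x y z : polar (x + y) z = polar x z + polar y z.
Proof.
rewrite -big_split; apply: eq_bigr => a _; rewrite -big_split.
by apply: eq_bigr => b _; rewrite mxE /=; ring.
Qed.

Lemma polarZl c x z : polar (c *: x) z = c * polar x z.
Proof.
rewrite /polar mulr_sumr; apply: eq_bigr => a _; rewrite mulr_sumr.
by apply: eq_bigr => b _; rewrite mxE /=; ring.
Qed.

Lemma polarDr x y z : polar z (x + y) = polar z x + polar z y.
Proof. by rewrite ![polar z _]polarC polarDl. Qed.

Lemma polarZr c x z : polar z (c *: x) = c * polar z x.
Proof. by rewrite ![polar z _]polarC polarZl. Qed.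

Lemma polar0l z : polar 0 z = 0.
Proof. by rewrite -(scale0r (0 : 'rV[K]_n)) polarZl mul0r. Qed.

Lemma polar_suml (I : Type) (r : seq I) (P : pred I) (F : I -> 'rV[K]_n) z :
  polar (\sum_(i <- r | P i) F i) z = \sum_(i <- r | P i) polar (F i) z.
Proof.
by elim/big_ind2: _ => [|x a y b <- <-|//]; [exact: polar0l | exact: polarDl].
Qed.

Lemma polar_sumr (I : Type) (r : seq I) (P : pred I) (F : I -> 'rV[K]_n) z :
  polar z (\sum_(i <- r | P i) F i) = \sum_(i <- r | P i) polar z (F i).
Proof. by rewrite polarC polar_suml; apply: eq_bigr => i _; rewrite polarC. Qed.

Lemma qfD x y : qf (x + y) = qf x + qf y + polar x y.
Proof.
rewrite !qfE; have -> : polar x y = \sum_a \sum_b Q a b * (x 0 a * y 0 b + x 0 b * y 0 a).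
  rewrite /polar; under eq_bigr => a _ do (under eq_bigr => b _ do rewrite mulrDl; rewrite big_split).
  rewrite big_split /= [X in _ + X]exchange_big -big_split; apply: eq_bigr => a _.
  rewrite -big_split; apply: eq_bigr => b _ /=; ring.
rewrite -!big_split; apply: eq_bigr => a _; rewrite -!big_split.
by apply: eq_bigr => b _; rewrite !mxE /=; ring.
Qed.

Lemma polar_diag x : polar x x = 2%:R * qf x.
Proof.
have : qf (x + x) = qf x + qf x + polar x x by exact: qfD.
have -> : qf (x + x) = 4%:R * qf x.
  rewrite !qfE mulr_sumr; apply: eq_bigr => a _; rewrite mulr_sumr.
  by apply: eq_bigr => b _; rewrite !mxE; ring.
move=> e; have -> : polar x x = 4%:R * qf x - (qf x + qf x) by rewrite e; ring.
ring.
Qed.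

Lemma qfZ c x : qf (c *: x) = c ^+ 2 * qf x.
Proof. by apply: (mulfI two_neq0); rewrite mulrCA -!polar_diag polarZl polarZr; ring. Qed.

Hypothesis nondeg : forall x, (forall y, polar x y = 0) -> x = 0.

(* The first two vectors form a hyperbolic pair; the others are anisotropic and
   orthogonal to all the others. *)
Definition frame (r : nat) (E : nat -> 'rV[K]_n) :=
  (forall i k, (i < r)%N -> (k < r)%N -> polar (E i) (E k) =
     if (i < 2)%N && (k < 2)%N then (i != k)%:R
     else if i == k then 2%:R * qf (E i) else 0) /\
  (forall i, (2 <= i < r)%N -> qf (E i) != 0).

(** Each of the two isotropic vectors is dual to the other one, hence the exchange of the indices 0
    and 1. *)
Definition frame_coord (E : nat -> 'rV[K]_n) (i : nat) v : K :=
  if i == 0%N then polar v (E 1%N) else if i == 1%N then polar v (E 0%N)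
  else polar v (E i) / (2%:R * qf (E i)).

Lemma frame_coord0 E i : frame_coord E i 0 = 0.
Proof. by rewrite /frame_coord !polar0l mul0r; case: ifP => // _; case: ifP. Qed.

Lemma frame_isotropic r E i : frame r E -> (i < r)%N -> (i < 2)%N -> qf (E i) = 0.
Proof.
move=> [h _] ir i2; have := h i i ir ir; rewrite i2 eqxx polar_diag => /eqP.
by rewrite mulf_eq0 (negbTE two_neq0) => /eqP.
Qed.

Lemma frame_coordE r E i k : (2 <= r)%N -> frame r E -> (i < r)%N -> (k < r)%N ->
  frame_coord E i (E k) = (i == k)%:R.
Proof.
move=> r2 [h hq] ir kr; rewrite /frame_coord.
have [i0|i0] := eqVneq i 0%N; first by rewrite h // i0; case: k kr => [|[|k]] kr.
have [i1|i1] := eqVneq i 1%N; first by rewrite h // ?i1; [case: k kr => [|[|k]] kr | lia].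
have i2 : (2 <= i)%N by lia.
rewrite h // [(i < 2)%N]ltnNge i2 andbF; have [ki|ki] := eqVneq k i; last by rewrite mul0r.
by rewrite ki divff // mulf_neq0 // hq // i2.
Qed.

Definition frame_proj r (E : nat -> 'rV[K]_n) v :=
  v - \sum_(i < r) frame_coord E i v *: E i.

Lemma frame_proj_orth r E v k : (2 <= r)%N -> frame r E -> (k < r)%N ->
  polar (frame_proj r E v) (E k) = 0.
Proof.
move=> r2 fr kr; have [h hq] := fr.
rewrite polarDl -[- _]scaleN1r polarZl polar_suml.
pose s := if k == 0%N then 1%N else if k == 1%N then 0%N else k.
have sr : (s < r)%N by rewrite /s; case: eqP => _; [lia | case: eqP => _; lia].
rewrite (bigD1 (Ordinal sr)) //= big1 ?addr0 => [|i is_].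
  rewrite polarZl h // /frame_coord /s.
  have [->|k0] := eqVneq k 0%N; first by rewrite /=; ring.
  have [->|k1] := eqVneq k 1%N; first by rewrite /=; ring.
  have k2 : (2 <= k)%N by lia.
  rewrite (negbTE k0) (negbTE k1) [(k < 2)%N]ltnNge k2 /= eqxx mulfVK; first by ring.
  by rewrite mulf_neq0 // hq // k2.
rewrite polarZl h //; have {}is_ : (i : nat) != s by rewrite -val_eqE in is_.
suff -> : (if (i < 2)%N && (k < 2)%N then ((i : nat) != k)%:R
     else if (i : nat) == k then 2%:R * qf (E i) else 0) = 0 :> K by rewrite mulr0.
move: is_; rewrite /s; case: (k) kr => [|[|k']] _; case: (i : nat) => [|[|i']] //=.
by move=> /negbTE ->.
Qed.

Lemma frame_orth_nonzero r E : (r < n)%N ->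
  exists2 v, v != 0 & forall k, (k < r)%N -> polar v (E k) = 0.
Proof.
move=> rn; have [|l [a l0] hl] := linear_dependence
  (fun (a : 'I_n) (k : 'I_r) => polar (delta_mx 0 a) (E k)).
  by rewrite !card_ord.
exists (\sum_a l a *: delta_mx 0 a).
  apply: contraNneq l0 => /(congr1 (fun v : 'rV_n => v 0 a)).
  rewrite summxE (bigD1 a) //= !mxE !eqxx mulr1 big1 ?addr0 => [->//|b ba].
  by rewrite !mxE eq_sym (negbTE ba) andbF mulr0.
move=> k kr; rewrite polar_suml -[RHS](hl (Ordinal kr)).
by apply: eq_bigr => b _; rewrite polarZl.
Qed.

(** If [qf] vanished on the orthogonal complement of the frame, so would the polar form there; a
    nonzero vector of the complement would then be orthogonal to everything, against
    nondegeneracy. *)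
Lemma frame_extend r E : (2 <= r < n)%N -> frame r E ->
  exists2 E', frame r.+1 E' & forall i, (i < r)%N -> E' i = E i.
Proof.
move=> /andP[r2 rn] fr; have [h hq] := fr.
have [w w0 worth] : exists2 w, qf w != 0 & forall k, (k < r)%N -> polar w (E k) = 0.
  apply: contrapT => no.
  have iso u : (forall k, (k < r)%N -> polar u (E k) = 0) -> qf u = 0.
    by move=> hu; apply/eqP/negPn/negP => u0; apply: no; exists u.
  have [v v0 vorth] := frame_orth_nonzero E rn.
  case/eqP: v0; apply: nondeg => y.
  have -> : y = frame_proj r E y + \sum_(i < r) frame_coord E i y *: E i by rewrite subrK.
  rewrite polarDr polar_sumr [X in _ + X]big1 ?addr0; last first.
    by move=> i _; rewrite polarZr vorth // mulr0.
  have porth k : (k < r)%N -> polar (frame_proj r E y) (E k) = 0 by exact: frame_proj_orth.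
  have := iso (v + frame_proj r E y).
  rewrite qfD (iso v) // (iso (frame_proj r E y)) // !add0r; apply => k kr.
  by rewrite polarDl vorth // porth // addr0.
exists (fun i => if i == r then w else E i); last by move=> i; case: eqP => // ->; rewrite ltnn.
split=> [i k|i /andP[i2]]; last first.
  by rewrite ltnS leq_eqVlt; case: eqP => //= _ ir; rewrite hq // i2.
rewrite [(i < r.+1)%N]ltnS [(k < r.+1)%N]ltnS [(i <= r)%N]leq_eqVlt [(k <= r)%N]leq_eqVlt.
have [->|ir] := eqVneq i r; have [->|kr] := eqVneq k r => //=.
- by move=> _ _; rewrite ltnNge r2 /= polar_diag.
- by move=> _ kr'; rewrite worth // ltnNge r2.
- by move=> ir' _; rewrite polarC worth // [(r < 2)%N]ltnNge r2 /= andbF (negbTE ir).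
- by move=> ir' kr'; exact: h.
Qed.

Lemma frame_complete r E : (2 <= r <= n)%N -> frame r E ->
  exists2 E', frame n E' & forall i, (i < r)%N -> E' i = E i.
Proof.
move=> /andP[r2 rn]; have [d] := ubnP (n - r); elim: d r E r2 rn => // d IHd r E r2 rn.
rewrite ltnS => nd fr; move: rn; rewrite leq_eqVlt => /predU1P[rn|rn].
  by exists E => //; rewrite -rn.
have [|E1 f1 e1] := frame_extend (r := r) _ fr; first by rewrite r2.
have [| | |E2 f2 e2] := IHd r.+1 E1 _ _ _ f1; [by rewrite ltnW | by [] | by lia |].
by exists E2 => // i ir; rewrite e2 ?e1 // ltnW.
Qed.

(** The defect [u] is orthogonal to the frame. For dimension reasons [u] and the [E i] satisfy a
    linear relation; taking its coordinates kills the coefficients of the [E i], and so [u] is 0. *)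
Lemma frame_full E v : (2 <= n)%N -> frame n E ->
  v = \sum_(i < n) frame_coord E i v *: E i.
Proof.
move=> n2 fr; apply/eqP; rewrite -subr_eq0 -/(frame_proj n E v); apply/eqP.
set u := frame_proj n E v.
have uorth k : (k < n)%N -> polar u (E k) = 0 by exact: frame_proj_orth.
pose y (i : 'I_n.+1) := if (i < n)%N then E i else u.
have [|l [i0 l0] hl] := linear_dependence (fun (i : 'I_n.+1) (a : 'I_n) => y i 0 a).
  by rewrite !card_ord.
have sum0 : \sum_(i < n) l (widen_ord (leqnSn n) i) *: E i + l ord_max *: u = 0.
  apply/rowP => a; rewrite mxE [RHS]mxE -[RHS](hl a) big_ord_recr /= summxE.
  congr (_ + _); last by rewrite mxE /y /= ltnn.
  by apply: eq_bigr => i _; rewrite mxE /y /= ltn_ord.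
have lin k x y' c : frame_coord E k (x + c *: y') = frame_coord E k x + c * frame_coord E k y'.
  rewrite /frame_coord; case: eqP => _; first by rewrite polarDl polarZl.
  case: eqP => _; first by rewrite polarDl polarZl.
  by rewrite polarDl polarZl; ring.
have u_coord k : (k < n)%N -> frame_coord E k u = 0.
  move=> kn; rewrite /frame_coord; case: ifP => _; first by rewrite uorth.
  by case: ifP => _; rewrite uorth ?mul0r // (leq_trans _ n2).
have lk (k : 'I_n) : l (widen_ord (leqnSn n) k) = 0.
  have : frame_coord E k (\sum_(i < n) l (widen_ord (leqnSn n) i) *: E i + l ord_max *: u) = 0.
    by rewrite sum0 frame_coord0.
  rewrite lin u_coord // mulr0 addr0 => <-.
  have -> : frame_coord E k (\sum_(i < n) l (widen_ord (leqnSn n) i) *: E i) =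
     \sum_(i < n) l (widen_ord (leqnSn n) i) * frame_coord E k (E i).
    elim/big_rec2: _ => [|i x s _ <-]; last by rewrite addrC lin addrC.
    by rewrite frame_coord0.
  rewrite (bigD1 k) //= (frame_coordE n2 fr) // eqxx mulr1 big1 ?addr0 // => i ik.
  by rewrite (frame_coordE n2 fr) // eq_sym -val_eqE in ik *; rewrite (negbTE ik) mulr0.
move: sum0; rewrite big1 ?add0r => [/eqP|i _]; last by rewrite lk scale0r.
rewrite scaler_eq0 => /orP[/eqP lm|/eqP//].
case: (unliftP ord_max i0) l0 => [i ->|->]; last by rewrite lm eqxx.
rewrite (_ : lift ord_max i = widen_ord (leqnSn n) i) ?lk ?eqxx //.
by apply: val_inj; rewrite /= /bump leqNgt ltn_ord.
Qed.

Lemma qf_frame r E (xi : nat -> K) : (2 <= r)%N -> frame r E ->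
  qf (\sum_(i < r) xi i *: E i) =
  xi 0%N * xi 1%N + \sum_(2 <= i < r) qf (E i) * xi i ^+ 2.
Proof.
case: r => [|[|r]] // _; elim: r => [|r IHr] fr; have [h hq] := fr.
  rewrite big_geq // addr0 big_ord_recl big_ord1 qfD !qfZ /=.
  by rewrite !(frame_isotropic fr) // polarZl polarZr h //=; ring.
have fr' : frame r.+2 E.
  split=> [i k ir kr|i /andP[i2 ir]]; first by apply: h; exact: ltnW.
  by apply: hq; rewrite i2 ltnW.
rewrite big_ord_recr /= qfD IHr // qfZ [in RHS]big_nat_recr //= polarZr polar_suml.
rewrite [X in _ + xi r.+2 * X = _]big1; first by ring.
move=> i _; rewrite polarZl h //; last by rewrite ltnW // ltnS.
by rewrite andbF; case: eqP => [e|_]; [have := ltn_ord i; rewrite e ltnn | rewrite mulr0].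
Qed.

Lemma hyperbolic_pair e : e != 0 -> qf e = 0 ->
  exists2 E, frame 2 E & E 0%N = e.
Proof.
move=> e0 qe; have [y ey] : exists y, polar e y != 0.
  apply: contrapT => h; case/eqP: e0; apply: nondeg => y.
  by apply/eqP/negPn/negP => ey; apply: h; exists y.
have [y' ey'] : exists y', polar e y' = 1.
  by exists ((polar e y)^-1 *: y); rewrite polarZr mulVf.
(* The correction by a multiple of the isotropic vector [e] makes [y'] isotropic and keeps its
   product with [e]. *)
pose f := y' - qf y' *: e.
have ee : polar e e = 0 by rewrite polar_diag qe mulr0.
have ef : polar e f = 1 by rewrite polarDr ey' -scaleNr polarZr ee mulr0 addr0.
have qff : qf f = 0.
  by rewrite /f -scaleNr qfD qfZ qe polarZr polarC ey'; ring.
exists (fun i => if i == 0%N then e else f) => //; split=> [i k|i]; last by lia.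
case: i => [|[|i]] //; case: k => [|[|k]] //= _ _.
- by rewrite polarC.
- by rewrite polar_diag qff mulr0.
Qed.

End Frames.

Section TopCoefficient.
Variables (A : comNzRingType).

Lemma coef_affine_power (w l : A) (n : nat) :
  (size ((w%:P * 'X + l%:P) ^+ n)%R <= n.+1)%N /\ ((w%:P * 'X + l%:P) ^+ n)`_n = w ^+ n.
Proof.
elim: n => [|n [s c]]; first by rewrite expr0 size_poly1 coef1.
have sz1 : (size (w%:P * 'X + l%:P)%R <= 2)%N.
  rewrite mul_polyC; apply: leq_trans (size_polyD _ _) _; rewrite geq_max.
  rewrite (leq_trans (size_scale_leq _ _)) ?size_polyX //=.
  by rewrite (leq_trans (size_polyC_leq1 _)).
rewrite exprS; split.
  by apply: leq_trans (size_polyMleq _ _) _; rewrite -subn1 leq_subLR add1n; lia.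
rewrite mulrDl coefD -mulrA !coefCM coefXM /= c -exprS.
by rewrite nth_default ?mulr0 ?addr0.
Qed.

Lemma coef_prod_top (I : Type) (r : seq I) (p : I -> {poly A}) (d : I -> nat) (c : I -> A) :
  (forall i, (size (p i) <= (d i).+1)%N /\ (p i)`_(d i) = c i) ->
  (size (\prod_(i <- r) p i)%R <= (\sum_(i <- r) d i).+1)%N /\
  (\prod_(i <- r) p i)`_(\sum_(i <- r) d i)%N = \prod_(i <- r) c i.
Proof.
move=> h; elim: r => [|i r [s e]]; first by rewrite !big_nil size_poly1 coef1.
rewrite !big_cons; have [si ci] := h i; split.
  by apply: leq_trans (size_polyMleq _ _) _; rewrite -subn1 leq_subLR add1n; lia.
rewrite coefM.
have lt : (d i < (d i + \sum_(k <- r) d k).+1)%N by rewrite ltnS leq_addr.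
rewrite (bigD1 (Ordinal lt)) //= addKn ci e [X in _ + X]big1 ?addr0 // => k kd.
have [ki|ki] := ltnP (d i) k.
  by rewrite nth_default ?mul0r // (leq_trans si).
have {}ki : (k < d i)%N by rewrite ltn_neqAle ki andbT; rewrite -val_eqE in kd.
rewrite [X in _ * X]nth_default ?mulr0 //; apply: leq_trans s _.
by rewrite -subn_gt0 in ki; lia.
Qed.

End TopCoefficient.

(** In the top degree [e] the affine parts [l] do not contribute: the coefficient is the leading
    form of [F] at the direction [w]. A direction where this form is nonzero makes a relation monic
    up to a constant. *)
Lemma coef_top_substitution (K : fieldType) (m k : nat) (F : {mpoly K[m]}) (e : nat)
    (w : 'I_m -> K) (l : 'I_m -> {mpoly K[k]}) :
  (msize F <= e.+1)%N ->
  (mmap (@polyC _ \o @mpolyC k K) (fun i => (w i)%:MP%:P * 'X + (l i)%:P) F)`_e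
    = ((pihomog mdeg e F).@[w])%:MP.
Proof.
move=> sF; have -> : (pihomog mdeg e F).@[w] = \sum_(m0 <- msupp F)
    if mdeg m0 == e then F@_m0 * \prod_i w i ^+ m0 i else 0.
  rewrite pihomogE raddf_sum big_mkcond; apply: eq_bigr => m0 _.
  by case: ifP => // _; rewrite /= mevalZ mevalX.
rewrite /mmap coef_sum raddf_sum big_seq [RHS]big_seq; apply: eq_bigr => m0 m0F.
rewrite /= coefCM /mmap1.
have [sz cf] := coef_prod_top (index_enum 'I_m)
  (fun i => coef_affine_power (w i)%:MP (l i) (m0 i)).
rewrite -mdegE in sz cf.
case: eqP => [me|ne].
  rewrite -me cf mpolyCM rmorph_prod; congr (_ * _).
  by apply: eq_bigr => i _; rewrite rmorphXn.
rewrite raddf0 nth_default ?mulr0 //; apply: leq_trans sz _.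
by have := msize_mdeg_lt m0F => h; have := leq_trans h sF; lia.
Qed.

Lemma pihomog_top_neq0 (K : fieldType) (m : nat) (F : {mpoly K[m]}) :
  F != 0 -> pihomog mdeg (msize F).-1 F != 0.
Proof.
move=> F0; have d : mdeg (mlead F) = (msize F).-1.
  by have := mlead_deg F0 => <-.
apply/eqP => /(congr1 (mcoeff (mlead F))); rewrite mcoeff0 pihomogE raddf_sum.
rewrite big_mkcond (bigD1_seq (mlead F)) ?msupp_uniq ?mlead_supp //= d eqxx.
rewrite mcoeffZ mcoeffX eqxx mulr1 big1 ?addr0 => [|m0 ne].
  by apply/eqP; rewrite mleadc_eq0.
by case: ifP => // _; rewrite mcoeffZ mcoeffX (negbTE ne) mulr0.
Qed.

Lemma mpoly_ext (K : fieldType) (n : nat) (p1 p2 : {mpoly K[n]}) :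
  [pchar K] =i pred0 -> (forall x, p1.@[x] = p2.@[x]) -> p1 = p2.
Proof.
move=> ch0 h; apply/eqP; rewrite -subr_eq0; apply: contraT => p0.
have [m] := mpoly_nonvanishing (fun _ => pchar0_natr_inj ch0) p0.
by rewrite mevalB h subrr eqxx.
Qed.

Definition linear_mpoly (K : fieldType) (n : nat) (c : 'I_n -> K) : {mpoly K[n]} :=
  \sum_a c a *: 'X_a.

Lemma linear_mpolyD (K : fieldType) (n : nat) (c : 'I_n -> K) (J : finType)
    (m : J -> K) (d : J -> 'I_n -> K) :
  (forall a, c a = \sum_i m i * d i a) ->
  linear_mpoly c = \sum_i m i *: linear_mpoly (d i).
Proof.
move=> h; under [RHS]eq_bigr => i _ do rewrite scaler_sumr.
rewrite exchange_big; apply: eq_bigr => a _; rewrite h scaler_suml.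
by apply: eq_bigr => i _; rewrite scalerA.
Qed.

Lemma muni_X_last (K : fieldType) (k : nat) : muni ('X_ord_max : {mpoly K[k.+1]}) = 'X.
Proof.
rewrite muniE msuppX big_seq1 mcoeffX eqxx scale1r mnm1E eqxx.
rewrite [X in 'X_[X]](_ : _ = 0%MM) ?mpolyX0 ?scale1r //.
apply/mnmP => i; rewrite mnmE mnm1E mnm0E; case: eqP => // /(congr1 val) /= e.
by have := ltn_ord i; rewrite -e ltnn.
Qed.

Lemma muni_X_widen (K : fieldType) (k : nat) (i : 'I_k) :
  muni ('X_(widen_ord (leqnSn k) i) : {mpoly K[k.+1]}) = ('X_i)%:P.
Proof.
rewrite muniE msuppX big_seq1 mcoeffX eqxx scale1r mnm1E -val_eqE /= ltn_eqF //.
rewrite expr0 -[RHS]mulr1 mul_polyC; congr ('X_[_] *: _).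
by apply/mnmP => l; rewrite mnmE !mnm1E -!val_eqE.
Qed.

Section FrameLinear.
Variables (K : fieldType) (n : nat) (q : {mpoly K[n]}) (Q : 'I_n -> 'I_n -> K).

Lemma frame_coord_sum (E : nat -> 'rV[K]_n) i (J : finType) (c : J -> K) (x : J -> 'rV[K]_n) :
  frame_coord q Q E i (\sum_l c l *: x l) = \sum_l c l * frame_coord q Q E i (x l).
Proof.
rewrite /frame_coord; do 2!(case: ifP => _;
  first by rewrite polar_suml; apply: eq_bigr => l _; rewrite polarZl).
by rewrite polar_suml mulr_suml; apply: eq_bigr => l _; rewrite polarZl mulrA.
Qed.

End FrameLinear.

Section QuadricCoordinates.
Variables (K : fieldType) (k : nat).
Local Notation n := k.+3.
Local Notation o0 := (ord0 : 'I_n).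
Local Notation o1 := (lift ord0 ord0 : 'I_n).
Local Notation o2 := (lift ord0 (lift ord0 ord0) : 'I_n).
Local Notation oz i := (lift ord0 (lift ord0 (lift ord0 i)) : 'I_n).

(* [E i] are the vectors of an adapted basis and [P i] the coordinates with
   respect to it: the quadratic form becomes
   [x y + c t ^ 2 + \sum_i cz i * z i ^ 2], the variables being numbered
   [x, y, t, z]; the relation [F0] involves [x] and [z], [F1] involves [y] and
   [z], and [F2], which is monic in [t] up to a constant, [t] and [z]. *)
Record quadric_coordinates (q : {mpoly K[n]}) (I : {pred {mpoly K[n]}}) := QuadricCoordinates {
  qc_E : 'I_n -> 'I_n -> K;
  qc_P : 'I_n -> 'I_n -> K;
  qc_c : K;
  qc_cz : 'I_k -> K;
  qc_F : 'I_3 -> {mpoly K[k.+1]};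
  qc_e : nat;
  qc_b : K;
  qc_PE : forall a b, \sum_i qc_E i a * qc_P i b = (a == b)%:R;
  qc_EP : forall i i', \sum_a qc_P i a * qc_E i' a = (i == i')%:R;
  qc_form : mmap (@mpolyC n K) (fun a => \sum_i qc_E i a *: 'X_i) q =
    'X_o0 * 'X_o1 + qc_c *: 'X_o2 ^+ 2 + \sum_i qc_cz i *: 'X_(oz i) ^+ 2;
  qc_c0 : qc_c != 0;
  qc_F_neq0 : forall s, qc_F s != 0;
  qc_F_in : forall s : 'I_3, mmap (@mpolyC n K)
    (adjoin_last (fun i => linear_mpoly (qc_P (oz i)))
       (linear_mpoly (qc_P (widen_ord (isT : (3 <= n)%N) s)))) (qc_F s) \in I;
  qc_b0 : qc_b != 0;
  qc_top : (muni (qc_F ord_max))`_qc_e = qc_b%:MP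
}.

(** Two frames are used. The coordinates [u] of the first one outside its hyperbolic plane satisfy a
    relation [F]. The second frame [E] keeps the hyperbolic pair and has as third vector a general
    combination [W] of the others. The [u i] are then linear in the new [t] and [z], with
    coefficient [w i] at [t], so [F] becomes a relation [F2] whose coefficient of [t ^ e] is the
    leading form of [F] at [w]. The relations [F0] and [F1] are taken in the second frame. *)
Lemma exists_quadric_coordinates (q : {mpoly K[n]}) (I : {pred {mpoly K[n]}}) :
  [pchar K] =i pred0 -> q \is 2%N.-homog ->
  (exists2 x : 'I_n -> K, exists i, x i != 0 & q.@[x] = 0) ->
  nondegenerate_quadratic_form q ->
  (forall u : 'I_k.+1 -> {mpoly K[n]}, exists2 F, F != 0 & mmap (@mpolyC n K) u F \in I) ->
  inhabited (quadric_coordinates q I).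
Proof.
move=> ch0 hq [e0 [i0 e0n] qe0] ndq hI.
have two0 : 2%:R != 0 :> K by rewrite ((pcharf0P _).1 ch0).
have [Q qE] := quadratic_form_sum hq.
pose B := polar Q.
have nondeg x : (forall y, B x y = 0) -> x = 0.
  move=> h; apply/rowP => a; rewrite mxE.
  apply: (ndq (fun a => x 0 a)) => y.
  have := h (\row_a y a); have := qfD qE x (\row_a y a).
  rewrite /qf /B => + e; rewrite e addr0.
  have -> : q.@[fun a => (x + \row_a y a) 0 a] = q.@[fun a => x 0 a + y a].
    by apply: meval_eq => b; rewrite !mxE.
  have -> : q.@[fun a => (\row_a y a) 0 a] = q.@[y] by apply: meval_eq => b; rewrite mxE.
  by move=> ->; ring.
have [E2 fE2 _] : exists2 E, frame q Q 2 E & E 0%N = \row_a e0 a.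
  apply: hyperbolic_pair => //.
    by apply: contraNneq e0n => /rowP/(_ i0); rewrite !mxE => ->.
  by rewrite /qf -[RHS]qe0; apply: meval_eq => b; rewrite mxE.
have [|E' fE' _] := frame_complete two0 qE nondeg (r := 2) _ fE2; first by [].
pose crd (E : nat -> 'rV[K]_n) i b := frame_coord q Q E i (delta_mx 0 b).
have crdE E i x : frame_coord q Q E i x = \sum_b x 0 b * crd E i b.
  by rewrite {1}[x]row_sum_delta frame_coord_sum.
pose u (i : 'I_k.+1) := linear_mpoly (crd E' i.+2).
have [F F0 FI] := hI u.
pose e := (msize F).-1.
pose qW : {mpoly K[k.+1]} := \sum_(i < k.+1) qf q (E' i.+2) *: 'X_i ^+ 2.
have qWy y : qW.@[y] = \sum_(i < k.+1) qf q (E' i.+2) * y i ^+ 2.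
  rewrite raddf_sum; apply: eq_bigr => i _.
  by rewrite /= mevalZ rmorphXn /= mevalXU.
have [polE' qfE'] := fE'.
have qW0 : qW != 0.
  apply/eqP => /(congr1 (meval (fun i : 'I_k.+1 => (i == ord0)%:R))).
  rewrite meval0 qWy (bigD1 ord0) //= big1 ?addr0 => [|i /negbTE ->]; last first.
    by rewrite expr0n mulr0.
  by rewrite expr1n mulr1 => /eqP; apply/negP/qfE'.
(* The factor [qW] keeps [W] anisotropic, as the third vector of a frame must be. *)
have [mw] := mpoly_nonvanishing (fun _ => pchar0_natr_inj ch0)
  (mulf_neq0 (pihomog_top_neq0 F0) qW0).
set w : 'I_k.+1 -> K := (fun i => (mw i)%:R).
rewrite mevalM mulf_eq0 negb_or => /andP[topw qWw].
pose W := \sum_(i < k.+1) w i *: E' i.+2.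
have qWE : qf q W = qW.@[w].
  pose xi j := if j is j'.+2 then (if insub j' is Some i then w i else 0) else 0.
  have xiE (i : 'I_k.+1) : xi i.+2 = w i by rewrite /xi valK.
  transitivity (qf q (\sum_(i < n) xi i *: E' i)).
    congr (qf _ _); rewrite big_ord_recl [X in _ + X]big_ord_recl !scale0r !add0r.
    by apply: eq_bigr => i _; rewrite -(xiE i).
  rewrite (qf_frame two0 qE xi (isT : (2 <= n)%N) fE') mul0r add0r !big_add1 big_mkord qWy.
  by apply: eq_bigr => i _; rewrite xiE.
pose E3 i := if i == 2%N then W else E' i.
have polW i : (i < 2)%N -> polar Q (E' i) W = 0.
  move=> i2; rewrite polar_sumr big1 // => l _; rewrite polarZr.
  have iN : (i < n)%N by exact: leq_trans i2 _.
  have lN : (l.+2 < n)%N by exact: ltn_ord l.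
  by rewrite polE' // andbF; case: i i2 {iN} => [|[|i]] //= _; rewrite mulr0.
have fE3 : frame q Q 3 E3.
  split=> [i l i3 l3|i]; last first.
    by case: i => [|[|[|i]]] //= _; rewrite /E3 /= qWE.
  case: i i3 => [|[|[|i]]] // _; case: l l3 => [|[|[|l]]] // _; rewrite /E3 /=;
    rewrite ?polW // ?[polar Q W _]polarC ?polW //; try by rewrite polE'.
  by rewrite (polar_diag qE).
have [|E fE EE3] := frame_complete two0 qE nondeg (r := 3) _ fE3; first by [].
have n2 : (2 <= n)%N by [].
have E2W : E 2%N = W by rewrite EE3.
have E01 i : (i < 2)%N -> E i = E' i.
  by move=> i2; rewrite EE3 /E3; [case: eqP i2 => // -> | exact: ltnW].
pose mu (i : 'I_k.+1) (l : 'I_k) := frame_coord q Q E' i.+2 (E l.+3).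
pose F2 : {mpoly K[k.+1]} := mmap (@mpolyC _ K) (fun i =>
  w i *: 'X_ord_max + \sum_l mu i l *: 'X_(widen_ord (leqnSn k) l)) F.
have muniF2 : (muni F2)`_e = ((pihomog mdeg e F).@[w])%:MP.
  have -> : muni F2 = mmap (@polyC _ \o @mpolyC k K)
      (fun i => (w i)%:MP%:P * 'X + (\sum_l mu i l *: 'X_l)%:P) F.
    pose g : {rmorphism {mpoly K[k.+1]} -> {poly {mpoly K[k]}}} := @muni k K.
    rewrite -[muni F2]/(g F2) rmorph_mmap; apply: eq_mmap => [c|i]; first exact: muniC.
    rewrite -[LHS]/(muni (w i *: 'X_ord_max + \sum_l mu i l *: 'X_(widen_ord (leqnSn k) l))).
    rewrite muniD muniZ muni_X_last mul_polyC; congr (_ + _).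
    rewrite raddf_sum [RHS]raddf_sum; apply: eq_bigr => l _.
    by rewrite [LHS]muniZ muni_X_widen [RHS]/= -[in RHS]mul_mpolyC polyCM mul_polyC.
  by rewrite coef_top_substitution //; exact: leqSpred.
have /choice[Fs hFs] : forall s : 'I_3, exists G : {mpoly K[k.+1]}, G != 0 /\
    mmap (@mpolyC n K) (adjoin_last (fun i => linear_mpoly (crd E (oz i)))
       (linear_mpoly (crd E s))) G \in I.
  by move=> s; have [G] := hI (adjoin_last (fun i => linear_mpoly (crd E (oz i)))
       (linear_mpoly (crd E s))); exists G.
constructor; apply: (@QuadricCoordinates q I (fun i a => E i 0 a) (fun i b => crd E i b)
  (qf q W) (fun i => qf q (E i.+3)) (fun s => if s == ord_max then F2 else Fs s)
  e ((pihomog mdeg e F).@[w])).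
- move=> a b; have := congr1 (fun v : 'rV_n => v 0 a) (frame_full two0 (delta_mx 0 b) n2 fE).
  rewrite summxE !mxE eqxx /= => ->; apply: eq_bigr => i _.
  by rewrite mxE mulrC.
- move=> i i'; have := frame_coordE two0 n2 fE (ltn_ord i) (ltn_ord i').
  by rewrite crdE val_eqE => <-; apply: eq_bigr => a _; rewrite mulrC.
- apply: mpoly_ext => // x.
  pose xi j := if insub j is Some i then x i else 0.
  have xiE (i : 'I_n) : xi i = x i by rewrite /xi valK.
  have := qf_frame two0 qE xi n2 fE.
  rewrite !big_add1 big_mkord /= [in RHS]big_ord_recl => qfx.
  transitivity (qf q (\sum_(i < n) xi i *: E i)).
    rewrite (rmorph_mmap _ (meval x)); apply: eq_mmap => [c|a]; first exact: mevalC.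
    rewrite /= summxE raddf_sum; apply: eq_bigr => i _.
    by rewrite /= mevalZ mevalXU mxE xiE mulrC.
  rewrite qfx !mevalD mevalM !mevalXU mevalZ rmorphXn /= mevalXU raddf_sum.
  rewrite -E2W (xiE o0) (xiE o1) (xiE o2) addrA; congr (_ + _).
  apply: eq_bigr => i _; rewrite /= mevalZ rmorphXn /= mevalXU.
  by rewrite -[bump _ _]/(nat_of_ord (lift ord0 i)) -(xiE (oz i)).
- by rewrite qWE.
- move=> s; case: (eqVneq s ord_max) => _; last by have [] := hFs s.
  apply/negP => /eqP F20; move: muniF2; rewrite F20 muni0 coef0 => /esym/eqP.
  by rewrite mpolyC_eq0 (negbTE topw).
- move=> s; case: (eqVneq s ord_max) => [->|_]; last by have [_] := hFs s.
  rewrite (_ : mmap _ _ F2 = mmap (@mpolyC n K) u F) //.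
  rewrite /F2 rmorph_mmap; apply: eq_mmap => [c|i] /=; first by rewrite mmapC.
  rewrite mmapD mmapZ raddf_sum /= mmapX mmap1U /adjoin_last unlift_none -/(adjoin_last _ _).
  under eq_bigr => l _ do rewrite mmapZ mmapX mmap1U adjoin_last_widen mul_mpolyC.
  rewrite mul_mpolyC /u (linear_mpolyD (c := crd E' i.+2) (m := fun l : 'I_n => frame_coord q Q E' i.+2 (E l))
    (d := fun l => crd E l)); last first.
    move=> a; have := congr1 (frame_coord q Q E' i.+2) (frame_full two0 (delta_mx 0 a) n2 fE).
    rewrite frame_coord_sum => e1; apply: etrans e1 _.
    by apply: eq_bigr => l _; rewrite mulrC.
  have iN : (i.+2 < n)%N by exact: ltn_ord i.
  (* The hyperbolic pair is common to both frames, so [u i] involves neither [x] nor [y]. *)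
  have c0 : frame_coord q Q E' i.+2 (E 0%N) = 0 by rewrite E01 // (frame_coordE two0 n2 fE').
  have c1 : frame_coord q Q E' i.+2 (E 1%N) = 0 by rewrite E01 // (frame_coordE two0 n2 fE').
  have c2 : frame_coord q Q E' i.+2 (E 2%N) = w i.
    rewrite E2W frame_coord_sum (bigD1 i) //= (frame_coordE two0 n2 fE') //.
    rewrite eqxx mulr1 big1 ?addr0 // => l li.
    have lN : (l.+2 < n)%N by exact: ltn_ord l.
    by rewrite (frame_coordE two0 n2 fE') // !eqSS val_eqE eq_sym (negbTE li) mulr0.
  by rewrite !big_ord_recl -[nat_of_ord ord0]/0%N -[nat_of_ord o1]/1%N -[nat_of_ord o2]/2%N
    c0 c1 c2 !scale0r !add0r.
- by [].
- by rewrite eqxx.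
Qed.
End QuadricCoordinates.

(** * Approximation over the function field *)

Section ResiduePolynomials.
Variables (C : closedFieldType) (K : fieldType) (j : {rmorphism C -> K}).
Hypothesis two_dependent : forall y : 'I_2 -> K, ~ alg_independent j y.
Variable v : place j.

(** The reduction of [h] at [v] exists and is a nonzero polynomial over [C]. *)
Definition good_poly (h : {poly K}) :=
  (forall i, vge v 0 h`_i) /\ exists i, vunit v h`_i.

Lemma vge_horner_near (h : {poly K}) (a b : K) (N : int) :
  (forall i, vge v 0 h`_i) -> vge v 0 a -> vge v 0 b -> vge v N (a - b) ->
  vge v N (h.[a] - h.[b]).
Proof.
move=> hi va vb ab; rewrite !horner_coef -sumrB; apply: vge_sum => // i _.
rewrite -mulrBr; apply: vgeM0 => //; rewrite subrXX; apply: vgeM0r => //.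
by apply: vge_sum => // l _; apply: vgeM0 => //; exact: vgeX.
Qed.

(** A nonzero polynomial over the algebraically closed field [C] has a nonroot. The factor [w] is
    meant for the residue [kap * s] of [y] in [local_avoidance]. *)
Lemma good_poly_unit_value (h : {poly K}) (w : K) :
  good_poly h -> vunit v w -> exists s : C, vunit v h.[w * j s].
Proof.
move=> [hi [i0 ui0]] uw; have vw := vunit_ge0 uw.
have /choice[r hr] : forall i, exists c : C, vge v 1 (h`_i * w ^+ i - j c).
  move=> i; apply: residue_constant => //; apply: vgeM0 => //; exact: vgeX.
pose p : {poly C} := \poly_(i < size h) r i.
have p0 : p != 0.
  apply/eqP => /(congr1 (fun p : {poly C} => p`_i0)); rewrite coef0 coef_poly.
  have -> : (i0 < size h)%N.
    by rewrite ltnNge; apply/negP => le; have := vunit_neq0 (place_hv v) ui0; rewrite nth_default ?eqxx.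
  move=> r0; have := hr i0; rewrite r0 rmorph0 subr0.
  have : vunit v (h`_i0 * w ^+ i0) by apply: vunitM => //; exact: vunitX.
  by rewrite /vunit => /andP[_ /negP h1 /h1].
have /closed_nonrootP[s sp] := p0.
exists s; apply: (vunit_near (place_hv v) (x := j p.[s])).
  by rewrite vunit_const.
rewrite horner_coef [p.[s]](horner_coef_wide s (size_poly _ _)) rmorph_sum -sumrB.
apply: vge_sum => // i _; rewrite exprMn mulrA coef_poly ltn_ord rmorphM rmorphXn -mulrBl.
by apply: vgeM0r => //; exact: vgeX.
Qed.

Lemma vunit_two : vunit v (2%:R : K) = ((2%:R : C) != 0).
Proof. by rewrite -(rmorph_nat j) vunit_const. Qed.

(* Newton's iteration. *)
Lemma approximate_sqrt (c d : K) (k : nat) : (2%:R : C) != 0 ->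
  vunit v c -> vunit v d -> exists2 t, vunit v t & vge v k (c * t ^+ 2 - d).
Proof.
move=> two0 uc ud; have c0 := vunit_neq0 (place_hv v) uc.
have u2 : vunit v (2%:R : K) by rewrite vunit_two.
have t20 := vunit_neq0 (place_hv v) u2.
suff [t ut ht] : exists2 t, vunit v t & vge v k.+1%:Z (c * t ^+ 2 - d).
  by exists t => //; apply: vge_le ht => //; lia.
elim: k => [|k [t ut ht]].
  have udc : vunit v (d / c) by apply: vunitM => //; exact: vunitV.
  have [l hl] := residue_constant two_dependent (vunit_ge0 udc).
  have sz : size ('X^2 - l%:P : {poly C}) != 1%N by rewrite size_XnsubC.
  have /closed_rootP[s /rootP] := sz; rewrite !hornerE => /eqP; rewrite subr_eq0 => /eqP sl.
  have l0 : l != 0.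
    apply/eqP => l0; move: hl; rewrite l0 rmorph0 subr0.
    by move: udc => /andP[_ /negP n1 /n1].
  exists (j s); first by rewrite vunit_const; apply: contraNneq l0 => s0; rewrite -sl s0 expr0n.
  have -> : c * j s ^+ 2 - d = - c * (d / c - j l) by rewrite -sl rmorphXn /=; field.
  by rewrite mulNr vgeN // vgeM0 // vunit_ge0.
set u := c * t ^+ 2 - d in ht; have t0 := vunit_neq0 (place_hv v) ut.
have vinv : vge v 0 (2%:R * c * t)^-1 by apply: vgeV => //; do 2!apply: vunitM => //.
exists (t - u / (2%:R * c * t)).
  apply: (vunit_near (place_hv v) ut); rewrite addrC addrA addNr add0r vgeN //.
  by apply: vgeM0r => //; apply: vge_le ht => //; lia.
have -> : c * (t - u / (2%:R * c * t)) ^+ 2 - d = c * (u / (2%:R * c * t)) ^+ 2 by rewrite /u; field; rewrite c0 t0 t20.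
apply: vgeM0 => //; first exact: vunit_ge0.
apply: vge_le (_ : vge v (k.+1%:Z + k.+1%:Z) _) => //; first by lia.
by rewrite expr2; apply: vgeM => //; apply: vgeM0r.
Qed.

(* When [x] vanishes at [v], the root [t] of [c t ^ 2 = d] modulo [x] is simple,
   and moving [t] in its class modulo [x] makes the residue of
   [y = (d - c t ^ 2) / x] arbitrary. *)
Lemma local_avoidance (c d x : K) (h2 h3 : {poly K}) : (2%:R : C) != 0 ->
  vunit v c -> vunit v d -> x != 0 -> vge v 0 x -> good_poly h2 -> good_poly h3 ->
  exists (tau : K) (M : nat), forall t, vge v M (t - tau) ->
    [/\ vge v 0 t, vge v 0 ((d - c * t ^+ 2) / x) &
        vunit v h2.[t] \/ vunit v h3.[(d - c * t ^+ 2) / x]].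
Proof.
move=> two0 uc ud x0 vx g2 g3.
have int_num t : vge v 0 t -> vge v 0 (d - c * t ^+ 2).
  move=> vt; apply: vgeB => //; first exact: vunit_ge0.
  by apply: vgeM0 => //; [exact: vunit_ge0 | exact: vgeX].
have [ux|nux] := boolP (vunit v x).
  have [s us] := good_poly_unit_value g2 (vunit1 (place_hv v)); rewrite mul1r in us.
  exists (j s), 1%N => t ht.
  have vt : vge v 0 t by rewrite -[t](subrK (j s)); apply: vgeD => //; apply: vge_le ht.
  split=> //; first by apply: vgeM0r => //; [exact: int_num | exact: vgeV].
  left; apply: (vunit_near (place_hv v) us).
  by apply: vge_horner_near => //; have [] := g2.
pose k := `|vord v x|%N.
have ox : vord v x = k.
  by move: vx; rewrite vge_ord // /k; lia.
have k1 : (0 < k)%N.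
  by rewrite lt0n; apply: contra nux => /eqP k0; rewrite vunitE // x0 ox k0.
have xk : vge v k x by rewrite vge_ord // ox.
have vx1 y : vge v k%:Z y -> vge v 0 (y / x).
  move=> hy; rewrite -[0](subrr k%:Z); apply: vgeM => //.
  by rewrite vge_ord ?invr_eq0 // vordV // ox.
have vx2 y : vge v k.+1%:Z y -> vge v 1 (y / x).
  move=> hy; have -> : 1 = k.+1%:Z - k%:Z by lia.
  by apply: vgeM => //; rewrite vge_ord ?invr_eq0 // vordV // ox.
(* Precision [k.+1], for [t1] here and for [t] below, leaves order at least 1 after division by [x],
   which has order [k]. *)
have [t1 ut1 ht1] := approximate_sqrt k.+1 two0 uc ud.
have u2 : vunit v (2%:R : K) by rewrite vunit_two.
pose kap := - (2%:R * c * t1).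
have ukap : vunit v kap.
  have := vunitM (place_hv v) (vunitM (place_hv v) u2 uc) ut1.
  by rewrite /kap /vunit !vgeN.
have [s us] := good_poly_unit_value g3 ukap.
exists (t1 + x * j s), k.+1 => t ht.
have vtau : vge v 0 (t1 + x * j s).
  by apply: vgeD => //; [exact: vunit_ge0 | exact: vgeM0].
have vt : vge v 0 t.
  by rewrite -[t](subrK (t1 + x * j s)); apply: vgeD => //; apply: vge_le ht.
pose eps := t - (t1 + x * j s).
have yE : (d - c * t ^+ 2) / x - kap * j s = - ((c * t1 ^+ 2 - d) / x)
   - c * x * j s ^+ 2 - c * (2%:R * (t1 + x * j s) + eps) * (eps / x).
  by rewrite /kap /eps; field.
have near : vge v 1 ((d - c * t ^+ 2) / x - kap * j s).
  rewrite yE; apply: vgeB => //; first apply: vgeB => //.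
  - by rewrite vgeN //; exact: vx2.
  - apply: vgeM0r => //; last exact: vgeX.
    by apply: vgeM0 => //; [exact: vunit_ge0 | apply: vge_le xk => //; lia].
  apply: vgeM0 => //; last exact: vx2.
  apply: vgeM0 => //; first exact: vunit_ge0.
  apply: vgeD => //; first by apply: vgeM0 => //; exact: vunit_ge0.
  by apply: vge_le ht.
have vy : vge v 0 ((d - c * t ^+ 2) / x).
  rewrite -[_ / x](subrK (kap * j s)); apply: vgeD => //; first exact: vge_le near.
  by apply: vgeM0 => //; exact: vunit_ge0.
split=> //; right; apply: (vunit_near (place_hv v) us).
by apply: vge_horner_near => //; [have [] := g3 | apply: vgeM0 => //; exact: vunit_ge0].
Qed.

End ResiduePolynomials.

Section Surface.
Variables (C : closedFieldType) (K : fieldType) (j : {rmorphism C -> K}).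
Hypothesis two_dependent : forall y : 'I_2 -> K, ~ alg_independent j y.
Hypothesis finitely_generated : exists (N : nat) (xi : 'I_N -> K),
  forall y : K, exists f g : {mpoly C[N]},
    mmap j xi g != 0 /\ y = mmap j xi f / mmap j xi g.
Hypothesis pchar_K : [pchar K] =i pred0.
Variable S : set (place j).
Hypothesis S_nonempty : S !=set0.

(* Choose [x] first; then [t] has to avoid finitely many residues at the finitely
   many places where [x] or [h1.[x]] is not a unit. *)
Lemma surface_approximation (T : seq (place j)) (xv tv : place j -> K) (N : nat)
    (c d : K) (h1 h2 h3 : {poly K}) :
  (forall v, S v -> v \in T) -> h1 != 0 ->
  (forall v, v \notin T -> [/\ vunit v c, vunit v d,
     good_poly v h1, good_poly v h2 & good_poly v h3]) ->
  exists x t, [/\ x != 0, h1.[x] != 0,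
    forall v, v \in T -> ~ S v -> vge v N (x - xv v) /\ vge v N (t - tv v) &
    forall v, v \notin T -> [/\ vge v 0 x, vge v 0 t, vge v 0 ((d - c * t ^+ 2) / x) &
      [\/ vunit v h1.[x], vunit v h2.[t] | vunit v h3.[(d - c * t ^+ 2) / x]]]].
Proof.
move=> ST h10 good.
have two0 : (2%:R : C) != 0.
  by rewrite -(fmorph_eq0 j) rmorph_nat ((pcharf0P _).1 pchar_K).
pose T1 := undup [seq v <- T | ~~ `[< S v >]].
have uT1 : uniq T1 by exact: undup_uniq.
have memT1 v : v \in T1 <-> v \in T /\ ~ S v.
  rewrite mem_undup mem_filter; split; first by move=> /andP[/asboolPn].
  by move=> [vT /asboolPn vS]; rewrite vS.
have T1S v : v \in T1 -> ~ S v by move/memT1 => [].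
have notT v : v \notin T -> ~ S v by move=> vT /ST vT'; rewrite vT' in vT.
have notT1 v : v \notin T -> v \notin T1 by move=> vT; apply/negP => /memT1[vT']; rewrite vT' in vT.
have [x0 [x0T x0S]] := strong_approximation_line two_dependent finitely_generated
  S_nonempty xv N uT1 T1S.
have [u u0 [uT uS]] := small_element two_dependent finitely_generated S_nonempty N uT1 T1S.
have xm_inj : injective (fun m : nat => x0 + m%:R * u).
  by move=> m m' /addrI/(mulIf u0)/(pchar0_natr_inj pchar_K).
have [m xm] : exists m : nat, ~~ root (h1 * 'X) (x0 + m%:R * u).
  apply: contrapT => /forallNP h.
  have hX : h1 * 'X != 0 by rewrite mulf_neq0 ?polyX_eq0.
  have := @max_poly_roots _ (h1 * 'X) [seq x0 + i%:R * u | i <- iota 0 (size (h1 * 'X))] hX.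
  rewrite size_map size_iota ltnn (map_inj_uniq xm_inj) iota_uniq => h'.
  suff : false by []; apply: h' => //.
  by apply/allP => _ /mapP[i _ ->]; apply/negPn/negP/h.
pose x := x0 + m%:R * u.
move: xm; rewrite rootM negb_or /root hornerX -/x => /andP[h1x x_neq0].
have xT v : v \in T1 -> vge v N (x - xv v).
  move=> vT; rewrite /x addrAC; apply: vgeD => //; first exact: x0T.
  by apply: vgeM0 => //; [exact: vge_nat | exact: uT].
have xS v : v \notin T -> vge v 0 x.
  move=> vT; apply: vgeD => //; first by apply: x0S; [exact: notT | exact: notT1].
  by apply: vgeM0 => //; [exact: vge_nat | apply: uS; exact: notT].
have [B hB] := support_finite_seq two_dependent finitely_generated [:: x; h1.[x]].
have /choice[tM htM] : forall v, exists tM : K * nat, v \notin T ->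
    forall t, vge v tM.2 (t - tM.1) ->
    [/\ vge v 0 t, vge v 0 ((d - c * t ^+ 2) / x) &
        vunit v h2.[t] \/ vunit v h3.[(d - c * t ^+ 2) / x]].
  move=> v; have [vT|vT] := boolP (v \in T); first by exists (0, 0%N).
  have [uc ud _ g2 g3] := good v vT.
  have [tau [M h]] := local_avoidance two_dependent two0 uc ud x_neq0 (xS v vT) g2 g3.
  by exists (tau, M).
pose T2 := undup (T1 ++ [seq v <- B | v \notin T]).
have T2S v : v \in T2 -> ~ S v.
  by rewrite mem_undup mem_cat mem_filter => /orP[/T1S//|/andP[/notT]].
pose N2 := (N + \sum_(v <- B) (tM v).2)%N.
have [t [tT tS]] := strong_approximation_line two_dependent finitely_generated
  S_nonempty (fun v => if v \in T then tv v else (tM v).1) N2 (undup_uniq _ : uniq T2) T2S.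
exists x, t; split=> // [v vT vS|v vT].
  have vT1 : v \in T1 by apply/memT1.
  split; first exact: xT.
  have := tT v; rewrite mem_undup mem_cat vT1 vT => /(_ isT).
  by apply: vge_le; rewrite /N2; lia.
have vx := xS v vT; have [vB|vB] := boolP (v \in B).
  have := tT v; rewrite mem_undup mem_cat mem_filter vB vT (negbTE (notT1 v vT)) (negbTE vT).
  move=> /(_ isT) ht; have [|vt vy h23] := htM v vT t.
    by apply: vge_le ht => //; rewrite /N2 lez_nat (big_rem v) //=; lia.
  by split=> //; case: h23 => h; [constructor 2 | constructor 3].
(* Outside [B] both [x] and [h1.[x]] are units: [y] is integral for any integral [t], and the first
   relation suffices. *)
have [x0' | ux] := hB v vB x (mem_head _ _); first by rewrite x0' eqxx in x_neq0.
have h1in : h1.[x] \in [:: x; h1.[x]] by rewrite !inE eqxx orbT.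
have [h0 | uh] := hB v vB _ h1in; first by rewrite h0 eqxx in h1x.
have vt : vge v 0 t.
  apply: tS; first exact: notT.
  by rewrite mem_undup mem_cat mem_filter (negbTE vB) andbF orbF; exact: notT1.
have [uc ud _ _ _] := good v vT.
split=> //; last by constructor 1.
apply: vgeM0r => //; last exact: vgeV.
apply: vgeB => //; first exact: vunit_ge0.
by apply: vgeM0 => //; [exact: vunit_ge0 | exact: vgeX].
Qed.

End Surface.

Lemma vge_mmap (K L : fieldType) (w : L -> \bar int) (f : {rmorphism K -> L}) (n : nat)
    (p : {mpoly K[n]}) (x : 'I_n -> L) :
  discrete_valuation w -> (forall m, vge w 0 (f p@_m)) -> (forall i, vge w 0 (x i)) ->
  vge w 0 (mmap f x p).
Proof.
move=> hw hp hx; apply: vge_sum => // m _; apply: vgeM0 => //.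
by apply: vge_prod => // i _; exact: vgeX.
Qed.

Lemma vge_meval (K : fieldType) (w : K -> \bar int) (n : nat)
    (p : {mpoly K[n]}) (x : 'I_n -> K) :
  discrete_valuation w -> (forall m, vge w 0 p@_m) -> (forall i, vge w 0 (x i)) ->
  vge w 0 p.@[x].
Proof. by move=> hw hp hx; exact: (vge_mmap (f := idfun)). Qed.

(** This transfers integrality of the coefficients from [p] to [muni p]. *)
Lemma mcoeff_muni (K : fieldType) (k : nat) (p : {mpoly K[k.+1]}) i m :
  exists m', ((muni p)`_i)@_m = p@_m'.
Proof.
pose m' : 'X_{1..k.+1} := [multinom adjoin_last (fun l => m l) i l | l < k.+1].
have mw : [multinom m' (widen_ord (leqnSn k) l) | l < k] = m.
  by apply/mnmP => l; rewrite !mnmE adjoin_last_widen.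
have ml : m' ord_max = i by rewrite mnmE /adjoin_last unlift_none.
exists m'; rewrite muniE coef_sum raddf_sum [p in RHS]mpolyE raddf_sum /=.
apply: eq_bigr => m0 _; rewrite coefZ coefXn mcoeffZ mcoeffX.
case: (eqVneq i (m0 ord_max)) => [ie|ne]; last first.
  rewrite mulr0 mcoeff0; case: eqP => [e|_]; last by rewrite mulr0.
  by rewrite -ml -e eqxx in ne.
rewrite mulr1 mcoeffZ mcoeffX; congr (_ * (nat_of_bool _)%:R).
apply/eqP/eqP => [me|e]; last by rewrite e mw.
apply/mnmP => l; case: (unliftP ord_max l) => [l' ->|->]; last by rewrite ml.
have -> : lift ord_max l' = widen_ord (leqnSn k) l'.
  by apply: val_inj; rewrite /= /bump leqNgt ltn_ord.
have /mnmP/(_ l') := etrans me (esym mw).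
by rewrite !mnmE.
Qed.

Section QuadricApproximation.
Variables (C : closedFieldType) (K : fieldType) (j : {rmorphism C -> K}).
Hypothesis two_dependent : forall y : 'I_2 -> K, ~ alg_independent j y.
Hypothesis finitely_generated : exists (N : nat) (xi : 'I_N -> K),
  forall y : K, exists f g : {mpoly C[N]},
    mmap j xi g != 0 /\ y = mmap j xi f / mmap j xi g.
Hypothesis pchar_K : [pchar K] =i pred0.
Variable S : set (place j).
Hypothesis S_nonempty : S !=set0.
Variables (k : nat) (alpha c b : K) (cz : 'I_k -> K) (e : nat) (F0 F1 F2 : {mpoly K[k.+1]}).
Hypotheses (alpha0 : alpha != 0) (F0_neq0 : F0 != 0) (F1_neq0 : F1 != 0).
Hypothesis F2_top : (muni F2)`_e = b%:MP.
Variable T : seq (place j).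
Hypothesis ST : forall v, S v -> v \in T.
Hypothesis good_c : forall v, v \notin T -> vunit v c.
Hypothesis good_b : forall v, v \notin T -> vunit v b.
Hypothesis good_alpha : forall v, v \notin T -> vge v 0 alpha.
Hypothesis good_cz : forall v, v \notin T -> forall i, vge v 0 (cz i).
Hypothesis good_F : forall v, v \notin T ->
  forall m, [/\ vge v 0 F0@_m, vge v 0 F1@_m & vge v 0 F2@_m].

(** The constant [d] of the surface [x y + c t ^ 2 = d] cut out on the quadric by fixing [z]. *)
Definition fiber_constant (L : fieldType) (f : K -> L) (z : 'I_k -> L) : L :=
  f alpha - \sum_i f (cz i) * z i ^+ 2.

Definition specialize_poly (z : 'I_k -> K) (F : {mpoly K[k.+1]}) : {poly K} :=
  map_poly (meval z) (muni F).

Lemma specialize_polyE z F s : (specialize_poly z F).[s] = F.@[adjoin_last z s].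
Proof.
rewrite /meval mmap_muni /adjoin_last unlift_none; congr (_.[_]).
apply: eq_map_poly => q; apply: eq_mmap => // i.
by rewrite -/(adjoin_last z s _) adjoin_last_widen.
Qed.

Lemma specialize_poly_integral (v : place j) z F i :
  (forall l, vge v 0 (z l)) -> (forall m, vge v 0 F@_m) ->
  vge v 0 (specialize_poly z F)`_i.
Proof.
move=> vz vF; rewrite coef_map; apply: vge_meval => // m.
by have [m' ->] := mcoeff_muni F i m.
Qed.

(* For a general [z] the problem is on a surface [x y + c t ^ 2 = d]. The
   places at which this specialization is bad are added to [T]: there [x := 1],
   and [F2], being monic in [t], still leaves a residue for [t]. *)
Lemma quadric_approximation (xv tv : place j -> K) (zv : 'I_k -> place j -> K) (N : nat) :
  exists (x y t : K) (z : 'I_k -> K),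
    [/\ x != 0, x * y + c * t ^+ 2 = fiber_constant id z,
        F0.@[adjoin_last z x] != 0,
        forall v, v \in T -> ~ S v -> [/\ vge v N (x - xv v), vge v N (t - tv v) &
          forall i, vge v N (z i - zv i v)] &
        forall v, v \notin T -> [/\ [/\ vge v 0 x, vge v 0 y & vge v 0 t],
          forall i, vge v 0 (z i) &
          [\/ vunit v F0.@[adjoin_last z x], vunit v F2.@[adjoin_last z t] |
              vunit v F1.@[adjoin_last z y]]]].
Proof.
pose Td := undup [seq v <- T | ~~ `[< S v >]].
have memTd v : v \in Td <-> v \in T /\ ~ S v.
  rewrite mem_undup mem_filter; split; first by move=> /andP[/asboolPn].
  by move=> [vT /asboolPn vS]; rewrite vS.
have TdS v : v \in Td -> ~ S v by move/memTd => [].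
have notT v : v \notin T -> ~ S v by move=> vT /ST vT'; rewrite vT' in vT.
have notTd v : v \notin T -> v \notin Td by move=> vT; apply/negP => /memTd[vT']; rewrite vT' in vT.
pose D : {mpoly K[k]} := alpha%:MP - \sum_i cz i *: 'X_i ^+ 2.
have Dz z : D.@[z] = fiber_constant id z.
  rewrite /D /fiber_constant mevalB mevalC; congr (_ - _); rewrite (raddf_sum (meval z)) /=; apply: eq_bigr => i _.
  by rewrite /= mevalZ rmorphXn /= mevalXU.
have D0 : D != 0.
  apply: contraNneq alpha0 => D0; have := Dz (fun=> 0); rewrite D0 meval0 /fiber_constant.
  by rewrite big1 ?subr0 => [<-//|i _]; rewrite expr0n mulr0.
(* General means here that [d] and the leading coefficients of [F0] and [F1] in their last variable
   do not vanish at [z]; all three are then units outside finitely many places. *)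
have G0 : D * (lead_coef (muni F0) * lead_coef (muni F1)) != 0.
  by rewrite !mulf_neq0 // lead_coef_eq0 muni_eq0.
have [z [zG zT zS]] := strong_approximation_generic two_dependent finitely_generated
  S_nonempty zv N G0 pchar_K (undup_uniq _ : uniq Td) TdS.
move: zG; rewrite !mevalM !mulf_eq0 !negb_or Dz => /and3P[d0 l0 l1].
set d := fiber_constant id z in d0.
have vz v i : v \notin T -> vge v 0 (z i).
  by move=> vT; apply: zS; [exact: notT | exact: notTd].
have [B hB] := support_finite_seq two_dependent finitely_generated
  [:: d; (lead_coef (muni F0)).@[z]; (lead_coef (muni F1)).@[z]].
pose h0 := specialize_poly z F0; pose h1 := specialize_poly z F1.
pose h2 := specialize_poly z F2.
have good2 v : v \notin T -> good_poly v h2.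
  move=> vT; split=> [i|].
    by apply: specialize_poly_integral => [l|m]; [exact: vz | have [] := good_F vT m].
  by exists e; rewrite coef_map /= F2_top mevalC; exact: good_b.
have goodT v : v \notin T ++ B ->
    [/\ vunit v c, vunit v d, good_poly v h0, good_poly v h2 & good_poly v h1].
  rewrite mem_cat negb_or => /andP[vT vB].
  have unitB y : y \in [:: d; (lead_coef (muni F0)).@[z]; (lead_coef (muni F1)).@[z]] ->
      y != 0 -> vunit v y.
    by move=> yin y0; have [y0'|//] := hB v vB y yin; rewrite y0' eqxx in y0.
  split.
  - exact: good_c.
  - by apply: unitB d0; exact: mem_head.
  - split=> [i|]; first by apply: specialize_poly_integral => [l|m]; [exact: vz | have [] := good_F vT m].
    by exists (size (muni F0)).-1; rewrite coef_map; apply: unitB l0; apply: mem_behead; exact: mem_head.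
  - exact: good2.
  - split=> [i|]; first by apply: specialize_poly_integral => [l|m]; [exact: vz | have [] := good_F vT m].
    by exists (size (muni F1)).-1; rewrite coef_map; apply: unitB l1; do 2!apply: mem_behead; exact: mem_head.
have h00 : h0 != 0.
  apply: contraNneq l0 => /(congr1 (fun p : {poly K} => p`_(size (muni F0)).-1)).
  by rewrite coef_map coef0 => /= ->.
have /choice[tau htau] : forall v : place j, exists s : C, v \notin T -> vunit v h2.[j s].
  move=> v; have [vT|vT] := boolP (v \in T); first by exists 0.
  have [s] := good_poly_unit_value two_dependent (good2 v vT) (vunit1 (place_hv v)).
  by rewrite mul1r => us; exists s.
(* The precision [N.+1] is at least 1, so that [x] and [t] have the prescribed residues at the added
   places even if [N] is 0. *)
have [|x [t [x0 h0x xtT xtS]]] := surface_approximation two_dependent finitely_generated pchar_K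
  S_nonempty (fun v => if v \in T then xv v else 1)
  (fun v => if v \in T then tv v else j (tau v)) N.+1 _ h00 goodT.
  by move=> v /ST vT; rewrite mem_cat vT.
exists x, ((d - c * t ^+ 2) / x), t, z; split=> //.
- by rewrite mulrCA divff // mulr1 subrK.
- by rewrite -specialize_polyE.
- move=> v vT vS; have [|h1' h2'] := xtT v _ vS; first by rewrite mem_cat vT.
  rewrite vT in h1' h2'; split.
  + by apply: vge_le h1'; rewrite lez_nat.
  + by apply: vge_le h2'; rewrite lez_nat.
  + by move=> i; apply: zT; apply/memTd.
move=> v vT; rewrite -!specialize_polyE.
have [vB|vB] := boolP (v \in B); last first.
  have [|vx vt vy u] := xtS v; first by rewrite mem_cat negb_or vT.
  by split=> // i; exact: vz.
have [|h1' h2'] := xtT v _ (notT v vT); first by rewrite mem_cat vB orbT.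
rewrite (negbTE vT) in h1' h2'.
have ux : vunit v x by apply: (vunit_near (place_hv v) (vunit1 (place_hv v))); apply: vge_le h1'; rewrite lez_nat.
have vt : vge v 0 t.
  by rewrite -[t](subrK (j (tau v))); apply: vgeD => //; apply: vge_le h2'; rewrite lez_nat.
have vd : vge v 0 d.
  apply: vgeB => //; first exact: good_alpha.
  by apply: vge_sum => // i _; apply: vgeM0 => //; [exact: good_cz | apply: vgeX => //; exact: vz].
have vc := vunit_ge0 (good_c vT).
split=> [|i|]; [split=> // | exact: vz | constructor 2].
- exact: vunit_ge0.
- apply: vgeM0r => //; last exact: vgeV.
  by apply: vgeB => //; apply: vgeM0 => //; exact: vgeX.
apply: (vunit_near (place_hv v) (htau v vT)).
apply: vge_horner_near => //; first by have [] := good2 v vT.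
by apply: vge_le h2'; rewrite lez_nat.
Qed.

End QuadricApproximation.

(** * Approximation of adelic points *)

Section Continuity.
Variables (L : fieldType) (w : L -> \bar int).
Hypothesis hw : discrete_valuation w.
Variable I : Type.
Implicit Types (x y : I -> L) (f g : (I -> L) -> L).

Definition vclose (N : nat) x y := forall i, vge w N (y i - x i).

Definition vcontinuous_at x f := forall N : nat, exists M : nat, forall y,
  vclose M x y -> vge w N (f y - f x).

Lemma vclose_le N M x y : (N <= M)%N -> vclose M x y -> vclose N x y.
Proof. by move=> NM h i; apply: vge_le (h i); rewrite lez_nat. Qed.

Lemma vcontinuous_at_const x (c : L) : vcontinuous_at x (fun=> c).
Proof. by move=> N; exists 0%N => y _; rewrite subrr vge0. Qed.

Lemma vcontinuous_at_coord x i : vcontinuous_at x (fun y => y i).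
Proof. by move=> N; exists N => y; exact. Qed.

Lemma vcontinuous_atD x f g :
  vcontinuous_at x f -> vcontinuous_at x g -> vcontinuous_at x (fun y => f y + g y).
Proof.
move=> hf hg N; have [M1 h1] := hf N; have [M2 h2] := hg N.
exists (M1 + M2)%N => y h; rewrite opprD addrACA; apply: vgeD => //.
  by apply: h1; apply: vclose_le h; exact: leq_addr.
by apply: h2; apply: vclose_le h; exact: leq_addl.
Qed.

Lemma vcontinuous_atM x f g :
  vcontinuous_at x f -> vcontinuous_at x g -> vcontinuous_at x (fun y => f y * g y).
Proof.
move=> hf hg N; have [B1 b1] := vge_exists_bound hw (f x).
have [B2 b2] := vge_exists_bound hw (g x).
have [M1 h1] := hf (N + B2)%N; have [M2 h2] := hg (N + B1)%N.
exists (M1 + M2)%N => y h.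
have h1' : vge w (N + B2)%N (f y - f x) by apply: h1; apply: vclose_le h; exact: leq_addr.
have h2' : vge w (N + B1)%N (g y - g x) by apply: h2; apply: vclose_le h; exact: leq_addl.
have gy : vge w (- B2%:Z) (g y).
  rewrite -[g y](subrK (g x)); apply: vgeD => //; apply: vge_le h2' => //; lia.
have -> : f y * g y - f x * g x = (f y - f x) * g y + f x * (g y - g x) by ring.
apply: vgeD => //.
  by have := vgeM hw h1' gy; apply: vge_le => //; lia.
by have := vgeM hw b1 h2'; apply: vge_le => //; lia.
Qed.

Lemma vcontinuous_atV x f : f x != 0 -> vcontinuous_at x f ->
  vcontinuous_at x (fun y => (f y)^-1).
Proof.
move=> fx hf N; pose o := vord w (f x).
have [M hM] := hf (N + 2 * `|o| + 1)%N; exists M => y /hM h.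
have [fy oy] : f y != 0 /\ vord w (f y) = o.
  have [] := vordD_dominant hw fx (y := f y - f x).
    by apply: vge_le h => //; rewrite -/o; lia.
  by rewrite addrC subrK.
have -> : (f y)^-1 - (f x)^-1 = - (f y - f x) * ((f y)^-1 * (f x)^-1).
  by field; rewrite fy fx.
have hi : vge w (- o - o) ((f y)^-1 * (f x)^-1).
  by apply: vgeM => //; rewrite vge_ord ?invr_eq0 // vordV // ?oy.
rewrite mulNr vgeN //; have := vgeM hw h hi; apply: vge_le => //; lia.
Qed.

Lemma vcontinuous_at_sum x (J : Type) (r : seq J) (F : J -> (I -> L) -> L) :
  (forall l, vcontinuous_at x (F l)) -> vcontinuous_at x (fun y => \sum_(l <- r) F l y).
Proof.
move=> h; elim: r => [|l r IHr] N.
  by exists 0%N => y _; rewrite !big_nil subrr vge0.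
have [M hM] := vcontinuous_atD (h l) IHr N.
by exists M => y /hM; rewrite !big_cons.
Qed.

Lemma vcontinuous_at_prod x (J : Type) (r : seq J) (F : J -> (I -> L) -> L) :
  (forall l, vcontinuous_at x (F l)) -> vcontinuous_at x (fun y => \prod_(l <- r) F l y).
Proof.
move=> h; elim: r => [|l r IHr] N.
  by exists 0%N => y _; rewrite !big_nil subrr vge0.
have [M hM] := vcontinuous_atM (h l) IHr N.
by exists M => y /hM; rewrite !big_cons.
Qed.

Lemma vcontinuous_atX x f n : vcontinuous_at x f -> vcontinuous_at x (fun y => f y ^+ n).
Proof.
move=> hf; elim: n => [|n IHn] N; first by exists 0%N => y _; rewrite subrr vge0.
have [M hM] := vcontinuous_atM hf IHn N.
by exists M => y /hM; rewrite !exprS.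
Qed.

End Continuity.

Lemma vcontinuous_at_mmap (K L : fieldType) (w : L -> \bar int) (f : {rmorphism K -> L})
    (n : nat) (p : {mpoly K[n]}) (x : 'I_n -> L) :
  discrete_valuation w -> vcontinuous_at w x (fun y => mmap f y p).
Proof.
move=> hw; apply: (@vcontinuous_at_sum _ _ hw) => m.
apply: (@vcontinuous_atM _ _ hw); first exact: vcontinuous_at_const.
apply: (@vcontinuous_at_prod _ _ hw) => i.
by apply: (@vcontinuous_atX _ _ hw); exact: vcontinuous_at_coord.
Qed.

Section IntegralPointsOpen.
Variables (K : fieldType) (v : K -> \bar int) (Kv : completion v).
Variables (n : nat) (gs fs : seq {mpoly K[n]}).
Let w : Kv -> \bar int := @cval _ _ Kv.
Let hw : discrete_valuation w := cval_valuation Kv.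

(** A combination of the [fs] equal to 1 at [p] takes a unit value [s] at nearby points; dividing
    its coefficients by [s] restores the value 1. *)
Lemma qaff_integral_open (p : 'I_n -> Kv) :
  qaff_points gs fs (cinj Kv) (integer_ring (Kv := Kv)) p ->
  exists N : nat, forall y, vclose w N p y ->
    (forall g, g \in gs -> mmap (cinj Kv) y g = 0) ->
    qaff_points gs fs (cinj Kv) (integer_ring (Kv := Kv)) y.
Proof.
move=> [pint _ [c [cint csum]]].
have cont : vcontinuous_at w p (fun y => \sum_(k < size fs) c k * mmap (cinj Kv) y fs`_k).
  apply: (@vcontinuous_at_sum _ _ hw) => k.
  by apply: (@vcontinuous_atM _ _ hw); [exact: vcontinuous_at_const | exact: vcontinuous_at_mmap].
have [M hM] := cont 1%N; exists M => y yp gy.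
set s := \sum_(k < size fs) c k * mmap (cinj Kv) y fs`_k.
have us : vunit w s.
  by apply: (vunit_near hw (vunit1 hw)); rewrite -csum; exact: hM.
split=> // [i|].
  rewrite /integer_ring /= -[y i](subrK (p i)); apply: (vgeD hw (N := 0)); last exact: pint.
  by apply: vge_le (yp i); rewrite lez_nat.
exists (fun k => s^-1 * c k); split=> [k|].
  by apply: (vgeM0 hw (N := 0)); [exact: vgeV | exact: cint].
under eq_bigr => k _ do rewrite -mulrA.
by rewrite -mulr_sumr mulVf // (vunit_neq0 hw us).
Qed.

End IntegralPointsOpen.

(** Precisions for [quadric_perturbation]: a product with at most two factors of order at least
    [- B] still ends at precision [N]. *)
Lemma precision_shift (N B : nat) :
  [/\ N%:Z <= (N + 2 * B + 1)%N%:Z, 1 <= (N + 2 * B + 1)%N%:Z,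
      N%:Z <= (N + 2 * B + 1)%N%:Z + - B%:Z, N%:Z <= - B%:Z + (N + 2 * B + 1)%N%:Z &
      N%:Z <= - B%:Z + ((N + 2 * B + 1)%N%:Z + - B%:Z)].
Proof. by split; lia. Qed.

Section QuadricPoint.
Variable k : nat.
Local Notation n := k.+3.
Local Notation o0 := (ord0 : 'I_n).
Local Notation o1 := (lift ord0 ord0 : 'I_n).
Local Notation o2 := (lift ord0 (lift ord0 ord0) : 'I_n).
Local Notation oz i := (lift ord0 (lift ord0 (lift ord0 i)) : 'I_n).

Definition quadric_point (T : Type) (x y t : T) (z : 'I_k -> T) (i : 'I_n) : T :=
  if unlift ord0 i is Some i1 then
    if unlift ord0 i1 is Some i2 then
      if unlift ord0 i2 is Some i3 then z i3 else t
    else y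
  else x.

Lemma quadric_point0 T x y t (z : 'I_k -> T) : quadric_point x y t z o0 = x.
Proof. by rewrite /quadric_point unlift_none. Qed.

Lemma quadric_point1 T x y t (z : 'I_k -> T) : quadric_point x y t z o1 = y.
Proof. by rewrite /quadric_point liftK unlift_none. Qed.

Lemma quadric_point2 T x y t (z : 'I_k -> T) : quadric_point x y t z o2 = t.
Proof. by rewrite /quadric_point !liftK unlift_none. Qed.

Lemma quadric_pointz T x y t (z : 'I_k -> T) i : quadric_point x y t z (oz i) = z i.
Proof. by rewrite /quadric_point !liftK. Qed.

Lemma quadric_index_ind (P : 'I_n -> Prop) :
  P o0 -> P o1 -> P o2 -> (forall i, P (oz i)) -> forall i, P i.
Proof.
move=> h0 h1 h2 hz i; case: (unliftP ord0 i) => [i1 ->|->//].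
case: (unliftP ord0 i1) => [i2 ->|->//].
by case: (unliftP ord0 i2) => [i3 ->|->//].
Qed.

Definition quadric_value (L : fieldType) (c : L) (cz : 'I_k -> L) (xi : 'I_n -> L) : L :=
  xi o0 * xi o1 + c * xi o2 ^+ 2 + \sum_i cz i * xi (oz i) ^+ 2.

(* When the first coordinate vanishes, rescale the coordinates other than the
   first two, on which the form takes the value [a], by [1 + s] with [s] small. *)
Lemma quadric_perturbation (L : fieldType) (w : L -> \bar int) (c a : L)
    (cz : 'I_k -> L) (xi : 'I_n -> L) (N : nat) :
  discrete_valuation w -> vunit w (2%:R : L) ->
  (forall N : nat, exists2 s, s != 0 & vge w N s) ->
  a != 0 -> quadric_value c cz xi = a ->
  exists xi', [/\ vclose w N xi xi', xi' o0 != 0 & quadric_value c cz xi' = a].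
Proof.
move=> hw u2 small a0 rel; have [x0|x0] := eqVneq (xi o0) 0; last first.
  by exists xi; split=> // i; rewrite subrr vge0.
have psi : c * xi o2 ^+ 2 + \sum_i cz i * xi (oz i) ^+ 2 = a.
  by rewrite -rel /quadric_value x0 mul0r add0r.
have [B hB] : exists B : nat, [/\ vge w (- B%:Z) a, vge w (- B%:Z) (xi o1)^-1 &
    forall i, vge w (- B%:Z) (xi i)].
  have [B1 h1] := vge_exists_bound hw a; have [B2 h2] := vge_exists_bound hw (xi o1)^-1.
  have /choice[b hb] : forall i, exists b : nat, vge w (- b%:Z) (xi i).
    by move=> i; exact: vge_exists_bound.
  exists (B1 + B2 + \sum_i b i)%N; split=> [||i].
  - by apply: vge_le h1 => //; lia.
  - by apply: vge_le h2 => //; lia.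
  apply: vge_le (hb i) => //; rewrite (bigD1 i) //=; lia.
have [aB x1B xiB] := hB.
have [s s0 hs] := small (N + 2 * B + 1)%N.
have [p1 p2 p3 p4 p5] := precision_shift N B.
have s1 : vge w 1 s by exact: vge_le hs.
have si : vge w 0 s by apply: vge_le s1.
have u2s t : vge w 1 t -> vunit w (2%:R + t).
  by move=> ht; apply: (vunit_near hw u2); rewrite addrAC subrr add0r.
have ss1 : vge w 1 (s ^+ 2) by rewrite expr2; apply: vgeM0.
pose pt X Y lam i := quadric_point X Y (lam * xi o2) (fun l => lam * xi (oz l)) i.
have val X Y lam : quadric_value c cz (pt X Y lam) = X * Y + lam ^+ 2 * a.
  rewrite /quadric_value /pt quadric_point0 quadric_point1 quadric_point2 -psi -addrA.
  congr (_ + _); rewrite mulrDr exprMn mulr_sumr; congr (_ + _); first by ring.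
  by apply: eq_bigr => i _; rewrite quadric_pointz exprMn; ring.
have far r i : vge w (N + 2 * B + 1)%N r -> vge w N ((1 + r) * xi i - xi i).
  move=> hr; have -> : (1 + r) * xi i - xi i = r * xi i by ring.
  exact: vge_le p3 (vgeM hw hr (xiB i)).
(* The product of the first two coordinates must become [a * (1 - lam ^+ 2)]. If both vanish,
   [lam = 1 + s ^+ 2] makes this [- a * s ^+ 2 * (2%:R + s ^+ 2)], which splits into two small
   factors, the first being [s]. *)
have [x1|x1] := eqVneq (xi o1) 0.
  have hss : vge w (N + 2 * B + 1)%N (s ^+ 2) by rewrite expr2; apply: vgeM0.
  have y0 := vge0 hw.
  exists (pt s (- a * s * (2%:R + s ^+ 2)) (1 + s ^+ 2)); split; last first.
  - by rewrite val; ring.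
  - by rewrite /pt quadric_point0.
  move=> i; elim/quadric_index_ind: i => [|||i]; rewrite /pt.
  - by rewrite quadric_point0 x0 subr0; exact: vge_le hs.
  - rewrite quadric_point1 x1 subr0 mulNr mulNr vgeN // -mulrA.
    have h : vge w (N + 2 * B + 1)%N (s * (2%:R + s ^+ 2)).
      by apply: vgeM0r => //; apply/vunit_ge0/u2s.
    exact: vge_le p4 (vgeM hw aB h).
  - by rewrite quadric_point2; exact: far.
  - by rewrite quadric_pointz; exact: far.
(* Here the second coordinate is kept and [lam = 1 + s]; the first one is nonzero because [2%:R + s]
   is a unit. *)
exists (pt (- a * s * (2%:R + s) / xi o1) (xi o1) (1 + s)); split; last first.
- by rewrite val; field.
- rewrite /pt quadric_point0 !mulf_neq0 ?oppr_eq0 ?invr_eq0 //.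
  exact: (vunit_neq0 hw (u2s s s1)).
move=> i; elim/quadric_index_ind: i => [|||i]; rewrite /pt.
- rewrite quadric_point0 x0 subr0 !mulNr vgeN // -[a * s * _]mulrA -mulrA.
  have h : vge w (N + 2 * B + 1)%N (s * (2%:R + s)).
    by apply: vgeM0r => //; apply/vunit_ge0/u2s.
  exact: vge_le p5 (vgeM hw aB (vgeM hw h x1B)).
- by rewrite quadric_point1 subrr vge0.
- by rewrite quadric_point2; exact: far.
- by rewrite quadric_pointz; exact: far.
Qed.

(** Once the local point is moved to one with nonzero [x], the equation gives [y] as a continuous
    function [Yf] of [x], [t] and [z]. Hence only these need to be approximated, and by density
    their targets can be taken in [K]. *)
Lemma local_targets (K : fieldType) (v : K -> \bar int) (Kv : completion v)
    (E P : 'I_n -> 'I_n -> K) (alpha c : K) (cz : 'I_k -> K) (p : 'I_n -> Kv) (N : nat) :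
  discrete_valuation v -> vunit v (2%:R : K) ->
  (forall N : nat, exists2 s, s != 0 & vge v N s) -> alpha != 0 ->
  (forall a b, \sum_i E i a * P i b = (a == b)%:R) ->
  quadric_value (cinj Kv c) (fun i => cinj Kv (cz i))
    (fun i => \sum_b cinj Kv (P i b) * p b) = cinj Kv alpha ->
  exists (xs ts : K) (zs : 'I_k -> K) (M : nat), forall x y t z,
    x != 0 -> x * y + c * t ^+ 2 = fiber_constant alpha cz id z ->
    vge v M (x - xs) -> vge v M (t - ts) -> (forall i, vge v M (z i - zs i)) ->
    vclose (@cval _ _ Kv) N p
      (fun a => cinj Kv (\sum_i E i a * quadric_point x y t z i)).
Proof.
move=> hv u2 small alpha0 EP; set w := @cval _ _ Kv.
have hw : discrete_valuation w := cval_valuation Kv.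
have wE M a : vge w M (cinj Kv a) = vge v M a by rewrite /vge /w cval_inj.
set xi := (fun i => \sum_b _) => rel.
have pE a : p a = \sum_i cinj Kv (E i a) * xi i.
  under [RHS]eq_bigr => i _ do rewrite mulr_sumr.
  rewrite exchange_big (bigD1 a) //= [X in _ + X]big1 ?addr0 => [|b ba].
    under eq_bigr => i _ do rewrite mulrA -rmorphM.
    by rewrite -mulr_suml -rmorph_sum EP eqxx rmorph1 mul1r.
  under eq_bigr => i _ do rewrite mulrA -rmorphM.
  by rewrite -mulr_suml -rmorph_sum EP eq_sym (negbTE ba) rmorph0 mul0r.
have [B hB] : exists B : nat, forall i a, vge w (- B%:Z) (cinj Kv (E i a)).
  have /choice[b hb] : forall ia : 'I_n * 'I_n, exists b : nat,
      vge w (- b%:Z) (cinj Kv (E ia.1 ia.2)) by move=> ia; exact: vge_exists_bound.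
  exists (\sum_ia b ia)%N => i a; apply: vge_le (hb (i, a)) => //.
  by rewrite (bigD1 (i, a)) //= lerN2 lez_nat leq_addr.
pose N1 := (N + B)%N.
have u2w : vunit w (2%:R : Kv) by rewrite -(rmorph_nat (cinj Kv)) /vunit !wE.
have smallw (M : nat) : exists2 s : Kv, s != 0 & vge w M s.
  by have [s s0 hs] := small M; exists (cinj Kv s); rewrite ?fmorph_eq0 ?wE.
have a0w : cinj Kv alpha != 0 by rewrite fmorph_eq0.
have [xi' [xixi' x0 rel']] := quadric_perturbation N1 hw u2w smallw a0w rel.
pose Yf (u : 'I_n -> Kv) := (cinj Kv alpha + -1 * (\sum_i cinj Kv (cz i) * u (oz i) ^+ 2) +
   -1 * (cinj Kv c * u o2 ^+ 2)) * (u o0)^-1.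
have Ycont : vcontinuous_at w xi' Yf.
  apply: (vcontinuous_atM hw); last first.
    by apply: (vcontinuous_atV hw) => //; exact: vcontinuous_at_coord.
  apply: (vcontinuous_atD hw); first apply: (vcontinuous_atD hw).
  - exact: vcontinuous_at_const.
  - apply: (vcontinuous_atM hw); first exact: vcontinuous_at_const.
    apply: (vcontinuous_at_sum hw) => i; apply: (vcontinuous_atM hw).
      exact: vcontinuous_at_const.
    by apply: (vcontinuous_atX hw); exact: vcontinuous_at_coord.
  apply: (vcontinuous_atM hw); first exact: vcontinuous_at_const.
  apply: (vcontinuous_atM hw); first exact: vcontinuous_at_const.
  by apply: (vcontinuous_atX hw); exact: vcontinuous_at_coord.
have Yxi' : Yf xi' = xi' o1.
  by apply: (mulIf x0); rewrite /Yf mulfVK // -rel' /quadric_value; ring.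
have [M1 hM1] := Ycont N1; pose M := (M1 + N1)%N.
have /choice[kap hkap] : forall i, exists a : K, vge w M (xi' i - cinj Kv a).
  by move=> i; exact: cinj_dense.
exists (kap o0), (kap o2), (fun i => kap (oz i)), M => x y t z xn0 rxy hx ht hz.
have near (a b : K) r : vge w M (r - cinj Kv b) -> vge v M (a - b) -> vge w M (cinj Kv a - r).
  move=> h1 h2; have -> : cinj Kv a - r = cinj Kv (a - b) - (r - cinj Kv b).
    by rewrite rmorphB; ring.
  by apply: vgeB => //; rewrite wE.
(* [Yf] does not involve the coordinate [o1], so the local value can stand there; closeness of [y]
   is deduced afterwards. *)
pose u := quadric_point (cinj Kv x) (xi' o1) (cinj Kv t) (fun i => cinj Kv (z i)).
have uM : vclose w M xi' u.
  move=> i; elim/quadric_index_ind: i => [|||i]; rewrite /u.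
  - by rewrite quadric_point0; exact: near hx.
  - by rewrite quadric_point1 subrr vge0.
  - by rewrite quadric_point2; exact: near ht.
  - by rewrite quadric_pointz; exact: near (hz i).
have Yu : Yf u = cinj Kv y.
  have xw : cinj Kv x != 0 by rewrite fmorph_eq0.
  apply: (mulIf xw); rewrite /Yf /u quadric_point0 mulfVK // quadric_point2.
  have -> : cinj Kv y * cinj Kv x = cinj Kv (fiber_constant alpha cz id z - c * t ^+ 2).
    by rewrite -rxy -rmorphM; congr (cinj Kv _); ring.
  rewrite /fiber_constant !rmorphB rmorphM rmorphXn rmorph_sum /=.
  rewrite (eq_bigr (fun i => cinj Kv (cz i * z i ^+ 2))); first by ring.
  by move=> i _; rewrite quadric_pointz rmorphM rmorphXn.
have y1 : vge w N1 (cinj Kv y - xi' o1).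
  by rewrite -Yu -Yxi'; apply: hM1; apply: vclose_le uM => //; exact: leq_addr.
have cl : vclose w N1 xi' (fun i => cinj Kv (quadric_point x y t z i)).
  have uN : vclose w N1 xi' u by apply: vclose_le uM => //; exact: leq_addl.
  move=> i; elim/quadric_index_ind: i => [|||i].
  - by have := uN o0; rewrite /u !quadric_point0.
  - by rewrite quadric_point1.
  - by have := uN o2; rewrite /u !quadric_point2.
  - by have := uN (oz i); rewrite /u !quadric_pointz.
move=> a; rewrite pE rmorph_sum -sumrB; apply: vge_sum => // i _.
rewrite rmorphM -mulrBr.
have h : vge w N1 (cinj Kv (quadric_point x y t z i) - xi i).
  by rewrite -[_ - _](subrKA (xi' i)); apply: (vgeD hw); [exact: cl | exact: xixi'].
have := vgeM hw (hB i a) h; apply: vge_le; by rewrite /N1 PoszD addrC addrK.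
Qed.

End QuadricPoint.

Section AdelicOpen.
Variables (C K : fieldType) (j : {rmorphism C -> K}).
Variable Kv : forall v : place j, completion v.
Variables (S S' : set (place j)) (n : nat) (gs fs : seq {mpoly K[n]}).
Local Notation AP := (adelic_points Kv S S' gs fs).

(** The set [T] may be larger than the exceptional set of [W] because integral points are open among
    local points: at the extra places closeness to [x] already implies integrality. *)
Lemma adelic_basic_nbhs (W : set AP) (x : AP) :
  adelic_basic W -> W x ->
  exists TW : seq (place j), forall T : seq (place j), {subset TW <= T} ->
  exists Nf : place j -> nat, forall y : AP,
    (forall v : off S, sval v \in T ->
       vclose (@cval _ _ (Kv (sval v))) (Nf (sval v)) (x v) (y v)) ->
    (forall v : off S, sval v \notin T -> @integral_points C K j Kv n gs fs _ (y v)) -> W y.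
Proof.
move=> [T0 [A [/finite_seqP[TW TWE] _ Aopen WE]]] Wx; exists TW => T TWT.
have memT v : T0 v <-> v \in TW by rewrite TWE.
rewrite WE in Wx.
have /choice[Nf hNf] : forall v : place j, exists N : nat, forall (h : ~ S v) y',
    vclose (@cval _ _ (Kv v)) N (x (exist _ v h)) y' -> local_points Kv gs fs v y' ->
    (T0 v -> A v y') /\ (~ T0 v -> @integral_points C K j Kv n gs fs _ y').
  move=> v; have [Sv|h] := pselect (S v); first by exists 0%N => h; case: (h Sv).
  have [hA hint] := Wx (exist _ v h).
  have [Tv|nTv] := pselect (T0 v).
    have [N hN] := Aopen v _ (hA Tv).
    exists `|N|%N => h' y'; rewrite (Prop_irrelevance h' h) => cl _; split=> // _.
    apply: hN => i; apply: le_trans (cl i); rewrite lee_fin; lia.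
  have [N hN] := qaff_integral_open (hint nTv).
  exists N => h' y'; rewrite (Prop_irrelevance h' h) => cl [_ gy _]; split=> // _.
  exact: hN.
exists Nf => y hT hint; rewrite WE => -[v h].
have loc := (adelic_familyP y).1 (exist _ v h).
have [vT|vT] := boolP (v \in T); first exact: (hNf v h _ (hT (exist _ v h) vT) loc).
split=> [/memT/TWT vT'|_]; last exact: (hint (exist _ v h) vT).
by rewrite vT' in vT.
Qed.

(** The basic sets are taken as a subbase, so [x] has a neighbourhood that is a finite intersection
    of them: exceptional sets are concatenated and precisions added. *)
Lemma adelic_open_nbhs (O : set AP) (x : AP) : open O -> O x ->
  exists TO : seq (place j), forall T : seq (place j), {subset TO <= T} ->
  exists Nf : place j -> nat, forall y : AP,
    (forall v : off S, sval v \in T ->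
       vclose (@cval _ _ (Kv (sval v))) (Nf (sval v)) (x v) (y v)) ->
    (forall v : off S, sval v \notin T -> @integral_points C K j Kv n gs fs _ (y v)) -> O y.
Proof.
move=> [D' D'sub OE] Ox.
have [W D'W Wx] : exists2 W, D' W & W x by move: Ox; rewrite -OE => -[W ? ?]; exists W.
have [D1 D1basic WE] := D'sub W D'W.
suff [TW hTW] : exists TW : seq (place j), forall T : seq (place j), {subset TW <= T} ->
    exists Nf : place j -> nat, forall y : AP,
    (forall v : off S, sval v \in T ->
       vclose (@cval _ _ (Kv (sval v))) (Nf (sval v)) (x v) (y v)) ->
    (forall v : off S, sval v \notin T -> @integral_points C K j Kv n gs fs _ (y v)) ->
    forall B : set AP, B \in finmap.enum_fset D1 -> B y.
  exists TW => T /hTW[Nf hNf]; exists Nf => y hT hint; rewrite -OE; exists W => //.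
  suff Wy : (W : set AP) y by exact: Wy.
  by rewrite -WE => B BD; exact: (hNf y hT hint B BD).
have {}Wx : forall B, B \in finmap.enum_fset D1 -> adelic_basic B /\ B x.
  move=> B BD; split; first by have := D1basic B BD; rewrite inE.
  by move: Wx; rewrite -WE => /(_ B BD).
elim: (finmap.enum_fset D1) Wx => [|B l IHl] Wx.
  by exists [::] => T _; exists (fun=> 0%N) => y _ _ B.
have [TB hTB] := adelic_basic_nbhs (Wx B (mem_head _ _)).1 (Wx B (mem_head _ _)).2.
have [Tl hTl] := IHl (fun B' B'l => Wx B' (mem_behead (B'l : B' \in behead (B :: l)))).
exists (TB ++ Tl) => T sub.
have [|N1 h1] := hTB T; first by move=> v vT; apply: sub; rewrite mem_cat vT.
have [|N2 h2] := hTl T; first by move=> v vT; apply: sub; rewrite mem_cat vT orbT.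
exists (fun v => N1 v + N2 v)%N => y hT hint B'; rewrite inE => /predU1P[->|B'l].
  by apply: h1 => // v vT; apply: vclose_le (hT v vT); exact: leq_addr.
by apply: h2 => // v vT; apply: vclose_le (hT v vT); exact: leq_addl.
Qed.

End AdelicOpen.

Section PointsFromRelation.
Variables (K : fieldType) (n : nat) (gs fs : seq {mpoly K[n]}).

Lemma qaff_points_map (L : fieldType) (f : {rmorphism K -> L}) (O : set L)
    (O' : set K) (a : 'I_n -> K) :
  (forall x, O' x -> O (f x)) -> qaff_points gs fs idfun O' a ->
  qaff_points gs fs f O (f \o a).
Proof.
move=> OO [aO ga [c [cO csum]]].
have fE p : mmap f (f \o a) p = f (mmap idfun a p) by rewrite rmorph_mmap.
split=> [i|g gin|]; [exact/OO/aO | by rewrite fE ga // rmorph0 |].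
exists (f \o c); split=> [i|]; first exact/OO/cO.
rewrite -[RHS](rmorph1 f) -csum rmorph_sum; apply: eq_bigr => l _.
by rewrite fE rmorphM.
Qed.

(** This converts a relation with value [h] at [a] into avoidance of the closed subset: divided by
    [h], it makes the values of the [fs] generate the unit ideal. *)
Lemma qaff_points_relation (O : set K) (a : 'I_n -> K) (cf : nat -> {mpoly K[n]}) (h : K) :
  O 0 -> (forall i, O (a i)) -> (forall g, g \in gs -> g.@[a] = 0) -> h != 0 ->
  (forall l : nat, (l < size fs)%N -> O (h^-1 * (cf l).@[a])) ->
  h = \sum_(l < size fs) (cf l).@[a] * (fs`_l).@[a] ->
  qaff_points gs fs idfun O a.
Proof.
move=> O0 aO ga h0 cO hE; split=> //.
(* [qaff_points] asks for coefficients in [O] at every index, hence the padding by 0. *)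
exists (fun l => if (l < size fs)%N then h^-1 * (cf l).@[a] else 0); split=> [l|].
  by case: ifP => // /cO.
under eq_bigr => l _ do rewrite ltn_ord -mulrA.
by rewrite -mulr_sumr -hE mulVf.
Qed.

End PointsFromRelation.

Lemma polynomial_bad_places (C : closedFieldType) (K : fieldType) (j : {rmorphism C -> K})
    (two_dependent : forall y : 'I_2 -> K, ~ alg_independent j y)
    (finitely_generated : exists (N : nat) (xi : 'I_N -> K),
      forall y : K, exists f g : {mpoly C[N]},
        mmap j xi g != 0 /\ y = mmap j xi f / mmap j xi g)
    (n : nat) (ps : seq {mpoly K[n]}) :
  exists s : seq (place j), forall v, v \notin s -> forall p, p \in ps ->
    forall m, vge v 0 p@_m.
Proof.
have [s hs] := support_finite_seq two_dependent finitely_generated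
  (flatten [seq [seq p@_m | m <- msupp p] | p <- ps]).
exists s => v vs p pin m; have [mp|mp] := boolP (m \in msupp p); last first.
  by rewrite (memN_msupp_eq0 mp) vge0.
have [|->|/vunit_ge0//] := hs v vs p@_m; last by rewrite vge0.
by apply/flattenP; exists [seq p@_m | m <- msupp p]; apply: map_f.
Qed.

Lemma linear_mpoly_eval (K : fieldType) (n : nat) (c : 'I_n -> K) (a : 'I_n -> K) :
  (linear_mpoly c).@[a] = \sum_b c b * a b.
Proof.
rewrite /linear_mpoly raddf_sum; apply: eq_bigr => b _.
by rewrite /= mevalZ mevalXU.
Qed.

Section CoordinateEvaluation.
Variables (K : fieldType) (k : nat) (q : {mpoly K[k.+3]}) (I : {pred {mpoly K[k.+3]}}).
Variable qc : quadric_coordinates q I.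

Definition ambient_point (xi : 'I_k.+3 -> K) (a : 'I_k.+3) : K :=
  \sum_i qc_E qc i a * xi i.

Lemma ambient_point_coord xi i :
  (linear_mpoly (qc_P qc i)).@[ambient_point xi] = xi i.
Proof.
rewrite linear_mpoly_eval /ambient_point.
under eq_bigr => b _ do rewrite mulr_sumr.
rewrite exchange_big (bigD1 i) //= [X in _ + X]big1 ?addr0 => [|i' ii'].
  under eq_bigr => b _ do rewrite mulrA.
  by rewrite -mulr_suml qc_EP eqxx mul1r.
under eq_bigr => b _ do rewrite mulrA.
by rewrite -mulr_suml qc_EP eq_sym (negbTE ii') mul0r.
Qed.

Lemma relation_eval (F : {mpoly K[k.+1]}) (i : 'I_k.+3) xi :
  (mmap (@mpolyC _ K) (adjoin_last
     (fun l => linear_mpoly (qc_P qc (lift ord0 (lift ord0 (lift ord0 l)))))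
     (linear_mpoly (qc_P qc i))) F).@[ambient_point xi] =
  F.@[adjoin_last (fun l => xi (lift ord0 (lift ord0 (lift ord0 l)))) (xi i)].
Proof.
rewrite (rmorph_mmap _ (meval (ambient_point xi))); apply: eq_mmap => [c|l].
  exact: mevalC.
by rewrite /= /adjoin_last; case: unliftP => [l' _|_]; exact: ambient_point_coord.
Qed.

Lemma form_eval (L : fieldType) (f : {rmorphism K -> L}) (xi : 'I_k.+3 -> L) :
  mmap f (fun a => \sum_i f (qc_E qc i a) * xi i) q =
  quadric_value (f (qc_c qc)) (fun l => f (qc_cz qc l)) xi.
Proof.
have fX i : mmap f xi 'X_i = xi i by rewrite mmapX mmap1U.
have fZ (c : K) p : mmap f xi (c *: p) = f c * mmap f xi p by exact: mmapZ.
have := congr1 (mmap f xi) (qc_form qc).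
rewrite (rmorph_mmap _ (mmap f xi)) => e.
transitivity (mmap f xi ('X_ord0 * 'X_(lift ord0 ord0)
    + qc_c qc *: 'X_(lift ord0 (lift ord0 ord0)) ^+ 2
    + \sum_i qc_cz qc i *: 'X_(lift ord0 (lift ord0 (lift ord0 i))) ^+ 2)).
  rewrite -e; apply: eq_mmap => [c|a] /=; first by rewrite mmapC.
  by rewrite raddf_sum; apply: eq_bigr => i _; rewrite /= fZ fX.
rewrite !rmorphD rmorphM /= !fX fZ rmorphXn /= fX rmorph_sum /=.
by congr (_ + _); apply: eq_bigr => i _; rewrite fZ rmorphXn /= fX.
Qed.

End CoordinateEvaluation.

(** * Purity for the quadric *)

Section Purity.
Variables (C : closedFieldType) (K : fieldType) (j : {rmorphism C -> K}).
Hypothesis C_uncountable : uncountable_pigeonhole C.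
Hypothesis pchar_K : [pchar K] =i pred0.
Hypothesis two_dependent : forall y : 'I_2 -> K, ~ alg_independent j y.
Hypothesis nonconstant : exists t, ~ is_constant j t.
Hypothesis finitely_generated : exists (N : nat) (xi : 'I_N -> K),
  forall y : K, exists f g : {mpoly C[N]},
    mmap j xi g != 0 /\ y = mmap j xi f / mmap j xi g.
Variables (Kv : forall v : place j, completion v) (S : set (place j)).
Hypothesis S_nonempty : S !=set0.
Variables (k : nat) (q : {mpoly K[k.+3]}).
Hypothesis q_homog : q \is 2%N.-homog.
Hypothesis q_nondeg : nondegenerate_quadratic_form q.
Variable alpha : K.
Hypothesis alpha0 : alpha != 0.

Lemma quadric_purity : purity_of_strong_approximation Kv S [:: q - alpha%:MP].
Proof.
set g := q - alpha%:MP.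
move=> fs hcod S' /finite_seqP[S's S'E] SS' _ _ O [x Ox] openO.
have g0 : g != 0.
  apply: contraNneq alpha0 => /(congr1 (mcoeff 0%MM)).
  rewrite mcoeff0 mcoeffB mcoeffC eqxx mulr1.
  have -> : q@_0 = 0 by apply: (dhomog_nemf_coeff q_homog); rewrite /= mdeg0.
  by rewrite sub0r => /eqP; rewrite oppr_eq0.
have [t0 nct0] := nonconstant.
have iso := Tsen_quadratic C_uncountable two_dependent finitely_generated nct0
  (isT : (3 <= k.+3)%N) q_homog.
have [qc] := exists_quadric_coordinates pchar_K q_homog iso q_nondeg
  (fun u => codim2_relation u g0 hcod).
(* The generator [g] has index 0 and vanishes on the quadric, so there each relation is a
   combination of the [fs] with coefficients [cf s l.+1]. *)
have /choice[cf hcf] : forall s : 'I_3, exists c : nat -> {mpoly K[k.+3]},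
    mmap (@mpolyC _ K) (adjoin_last
      (fun i => linear_mpoly (qc_P qc (lift ord0 (lift ord0 (lift ord0 i)))))
      (linear_mpoly (qc_P qc (widen_ord (isT : (3 <= k.+3)%N) s)))) (qc_F qc s)
    = c 0%N * g + \sum_(l < size fs) c l.+1 * fs`_l.
  by move=> s; have /ideal_spanP[c] := qc_F_in qc s; rewrite big_ord_recl; exists c.
pose F0 := qc_F qc ord0; pose F1 := qc_F qc (lift ord0 ord0); pose F2 := qc_F qc ord_max.
have [TO hTO] := adelic_open_nbhs openO Ox.
have [B1 hB1] := support_finite_seq two_dependent finitely_generated
  ([:: qc_c qc; qc_b qc; alpha] ++ [seq qc_cz qc i | i <- enum 'I_k]
    ++ [seq qc_E qc ia.1 ia.2 | ia : 'I_k.+3 * 'I_k.+3]).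
have [B2 hB2] := polynomial_bad_places two_dependent finitely_generated [:: F0; F1; F2].
have [B3 hB3] := polynomial_bad_places two_dependent finitely_generated
  [seq cf sl.1 sl.2.+1 | sl : 'I_3 * 'I_(size fs)].
(* Besides [S'] and the places constrained by [O], [T] contains those where the constants of the
   form, the basis, the relations or the coefficients [cf] are bad. *)
pose T := S's ++ TO ++ B1 ++ B2 ++ B3.
have ST v : S v -> v \in T.
  by move=> /SS'; rewrite S'E /= mem_cat => ->.
have [Nf hNf] : exists Nf : place j -> nat, forall y : adelic_points Kv S S' [:: g] fs,
    (forall v : off S, sval v \in T ->
       vclose (@cval _ _ (Kv (sval v))) (Nf (sval v)) (x v) (y v)) ->
    (forall v : off S, sval v \notin T -> @integral_points C K j Kv _ [:: g] fs _ (y v)) -> O y.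
  by apply: hTO => v vT; rewrite /T !mem_cat vT /= orbT.
have TB v : v \notin T -> [/\ v \notin B1, v \notin B2 & v \notin B3].
  by rewrite !mem_cat !negb_or => /and5P[].
have two0 : (2%:R : C) != 0.
  by rewrite -(fmorph_eq0 j) rmorph_nat ((pcharf0P _).1 pchar_K).
have u2 (v : place j) : vunit v (2%:R : K) by rewrite vunit_two.
have small (v : place j) (N : nat) : exists2 s, s != 0 & vge v N s.
  have [p p0 vp] := place_unif v; exists (p ^+ N); rewrite ?expf_neq0 //.
  by rewrite vge_ord ?expf_neq0 // vordX // vp mulr1.
pose tgt := (K * K * ('I_k -> K) * nat)%type.
have /choice[tg htg] : forall v : place j, exists tg : tgt, forall (h : ~ S v) x0 y t z,
    x0 != 0 -> x0 * y + qc_c qc * t ^+ 2 = fiber_constant alpha (qc_cz qc) id z ->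
    vge v tg.2 (x0 - tg.1.1.1) -> vge v tg.2 (t - tg.1.1.2) ->
    (forall i, vge v tg.2 (z i - tg.1.2 i)) ->
    vclose (@cval _ _ (Kv v)) (Nf v) (x (exist _ v h))
      (fun a => cinj (Kv v) (ambient_point qc (quadric_point x0 y t z) a)).
  move=> v; have [Sv|h] := pselect (S v); first by exists (0, 0, fun=> 0, 0%N) => h; case: (h Sv).
  have [_ gx _] := (adelic_familyP x).1 (exist _ v h).
  have rel : quadric_value (cinj (Kv v) (qc_c qc)) (fun i => cinj (Kv v) (qc_cz qc i))
      (fun i => \sum_b cinj (Kv v) (qc_P qc i b) * x (exist _ v h) b) = cinj (Kv v) alpha.
    rewrite -form_eval; have := gx g (mem_head _ _).
    rewrite /g mmapB mmapC => /eqP; rewrite subr_eq0 => /eqP <-.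
    apply: eq_mmap => // a; under eq_bigr => i _ do rewrite mulr_sumr.
    rewrite exchange_big (bigD1 a) //= [X in _ + X]big1 ?addr0 => [|b ba].
      under eq_bigr => i _ do rewrite mulrA -rmorphM.
      by rewrite -mulr_suml -rmorph_sum qc_PE eqxx rmorph1 mul1r.
    under eq_bigr => i _ do rewrite mulrA -rmorphM.
    by rewrite -mulr_suml -rmorph_sum qc_PE eq_sym (negbTE ba) rmorph0 mul0r.
  have [xs [ts [zs [M hM]]]] := local_targets (Nf v) (place_hv v) (u2 v) (small v) alpha0
    (qc_PE qc) rel.
  exists (xs, ts, zs, M) => h' x0 y t z; rewrite (Prop_irrelevance h' h).
  exact: hM.
pose M := (\sum_(v <- T) (tg v).2)%N.
have unitB1 v y : v \notin T -> y != 0 ->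
    y \in [:: qc_c qc; qc_b qc; alpha] ++ [seq qc_cz qc i | i <- enum 'I_k]
    ++ [seq qc_E qc ia.1 ia.2 | ia : 'I_k.+3 * 'I_k.+3] -> vunit v y.
  by move=> /TB[vB1 _ _] y0 yin; have [y0'|//] := hB1 v vB1 y yin; rewrite y0' eqxx in y0.
have intB1 v y : v \notin T ->
    y \in [:: qc_c qc; qc_b qc; alpha] ++ [seq qc_cz qc i | i <- enum 'I_k]
    ++ [seq qc_E qc ia.1 ia.2 | ia : 'I_k.+3 * 'I_k.+3] -> vge v 0 y.
  move=> vT yin; have [->|y0] := eqVneq y 0; first by rewrite vge0.
  exact/vunit_ge0/unitB1.
have gc v : v \notin T -> vunit v (qc_c qc).
  by move=> vT; apply: unitB1 (qc_c0 qc) _ => //; exact: mem_head.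
have gb v : v \notin T -> vunit v (qc_b qc).
  move=> vT; apply: unitB1 (qc_b0 qc) _ => //.
  by apply: mem_behead; exact: mem_head.
have ga v : v \notin T -> vge v 0 alpha.
  by move=> vT; apply: intB1 => //; do 2!apply: mem_behead; exact: mem_head.
have gcz v : v \notin T -> forall i, vge v 0 (qc_cz qc i).
  move=> vT i; apply: intB1 => //; rewrite mem_cat [X in _ || X]mem_cat.
  by rewrite (map_f (qc_cz qc) (mem_enum 'I_k i)) /= orbT.
have gE v : v \notin T -> forall i a, vge v 0 (qc_E qc i a).
  move=> vT i a; apply: intB1 => //; rewrite mem_cat [X in _ || X]mem_cat.
  by rewrite (map_f (fun ia => qc_E qc ia.1 ia.2) (mem_enum _ (i, a))) /= !orbT.
have gF v : v \notin T -> forall m, [/\ vge v 0 F0@_m, vge v 0 F1@_m & vge v 0 F2@_m].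
  move=> /TB[_ /hB2 h _] m; split; apply: h.
  - exact: mem_head.
  - by apply: mem_behead; exact: mem_head.
  - by do 2!apply: mem_behead; exact: mem_head.
have [x0 [y [t [z [x0n rel F0n near int]]]]] := quadric_approximation
  two_dependent finitely_generated pchar_K S_nonempty
  alpha0 (qc_F_neq0 qc ord0) (qc_F_neq0 qc (lift ord0 ord0)) (qc_top qc) ST gc gb ga gcz gF
  (fun v => (tg v).1.1.1) (fun v => (tg v).1.1.2) (fun i v => (tg v).1.2 i) M.
pose xi := quadric_point x0 y t z; pose a := ambient_point qc xi.
have ga0 g' : g' \in [:: g] -> g'.@[a] = 0.
  rewrite inE => /eqP ->; rewrite /g mevalB mevalC.
  have -> : q.@[a] = quadric_value (qc_c qc) (qc_cz qc) xi by exact: (form_eval qc idfun xi).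
  rewrite /quadric_value /xi quadric_point0 quadric_point1 quadric_point2 rel /fiber_constant.
  under [X in _ + X - _]eq_bigr => i _ do rewrite quadric_pointz.
  by rewrite subrK subrr.
have Fa (s : 'I_3) : (qc_F qc s).@[adjoin_last z (xi (widen_ord (isT : (3 <= k.+3)%N) s))] =
    \sum_(l < size fs) (cf s l.+1).@[a] * (fs`_l).@[a].
  have := congr1 (meval a) (hcf s); rewrite relation_eval mevalD mevalM (ga0 g (mem_head _ _)).
  rewrite mulr0 add0r raddf_sum => e1; transitivity (qc_F qc s).@[adjoin_last
      (fun l => xi (lift ord0 (lift ord0 (lift ord0 l)))) (xi (widen_ord (isT : (3 <= k.+3)%N) s))].
    apply: meval_eq => l; rewrite /adjoin_last; case: unliftP => // l' _.
    by rewrite /xi quadric_pointz.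
  by rewrite e1; apply: eq_bigr => l _; rewrite /= mevalM.
have w0 : widen_ord (isT : (3 <= k.+3)%N) (ord0 : 'I_3) = ord0 by exact: val_inj.
have w1 : widen_ord (isT : (3 <= k.+3)%N) (lift ord0 ord0 : 'I_3) = lift ord0 ord0 by exact: val_inj.
have w2 : widen_ord (isT : (3 <= k.+3)%N) (ord_max : 'I_3) = lift ord0 (lift ord0 ord0) by exact: val_inj.
have Fa0 : F0.@[adjoin_last z x0] = \sum_(l < size fs) (cf ord0 l.+1).@[a] * (fs`_l).@[a].
  by rewrite -Fa w0 /xi quadric_point0.
have Fa1 : F1.@[adjoin_last z y] = \sum_(l < size fs) (cf (lift ord0 ord0) l.+1).@[a] * (fs`_l).@[a].
  by rewrite -Fa w1 /xi quadric_point1.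
have Fa2 : F2.@[adjoin_last z t] = \sum_(l < size fs) (cf ord_max l.+1).@[a] * (fs`_l).@[a].
  by rewrite -Fa w2 /xi quadric_point2.
have rat : rational_points [:: g] fs a.
  by apply: (qaff_points_relation (cf := fun l => cf ord0 l.+1) _ _ ga0 F0n _ Fa0).
have integral (v : place j) : v \notin T ->
    qaff_points [:: g] fs idfun [set y0 | vge v 0 y0] a.
  move=> vT; have [[vx vy vt] vz u] := int v vT.
  have va b : vge v 0 (a b).
    apply: vge_sum => // i _; apply: vgeM0; [by [] | exact: gE |].
    elim/quadric_index_ind: i => [|||i]; rewrite /xi.
    - by rewrite quadric_point0.
    - by rewrite quadric_point1.
    - by rewrite quadric_point2.
    - by rewrite quadric_pointz.
  have cv (s : 'I_3) (l : nat) h : vunit v h -> (l < size fs)%N -> vge v 0 (h^-1 * (cf s l.+1).@[a]).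
    move=> uh lt; apply: vgeM0; [by [] | exact: vgeV |].
    apply: vge_meval => // m; have [_ _ vB3] := TB v vT.
    apply: (hB3 v vB3); apply/mapP; exists (s, Ordinal lt) => //; exact: mem_enum.
  have rel_int (s : 'I_3) h : vunit v h -> h = \sum_(l < size fs) (cf s l.+1).@[a] * (fs`_l).@[a] ->
      qaff_points [:: g] fs idfun [set y0 | vge v 0 y0] a.
    move=> uh hE; have h0 := vunit_neq0 (place_hv v) uh.
    apply: (qaff_points_relation (cf := fun l => cf s l.+1) _ va ga0 h0 _ hE).
      exact: vge0.
    by move=> l lt; exact: cv.
  (* Any one of the three relations with a unit value at [v] shows that [a] does not reduce into the
     closed subset. *)
  by case: u => uh; [exact: rel_int uh Fa0 | exact: rel_int uh Fa2 | exact: rel_int uh Fa1].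
have loc (v : place j) : local_points Kv [:: g] fs v (cinj (Kv v) \o a).
  exact: (qaff_points_map _ rat).
have intv (v : place j) : v \notin T -> @integral_points C K j Kv _ [:: g] fs v (cinj (Kv v) \o a).
  move=> vT; apply: (qaff_points_map _ (integral v vT)) => b vb.
  by rewrite /integer_ring /= cval_inj.
have adel : is_adelic (Kv := Kv) (S := S) S' [:: g] fs (fun v => cinj (Kv (sval v)) \o a).
  split=> [v|]; first exact: loc.
  exists [set` T]; split=> [|v|v nT]; first exact: finite_seq.
    by rewrite S'E /= /T mem_cat => ->.
  by apply: intv; apply/negP.
exists (AdelicPoints adel); split; last by exists a.
apply: hNf => [[v h] vT|[v h] vT]; last exact: intv.
have [|h1 h2 h3] := near v vT _; first exact: h.
have tM : ((tg v).2 <= M)%N by rewrite /M (big_rem v) //= leq_addr.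
apply: (htg v h x0 y t z x0n).
- by rewrite rel.
- by apply: vge_le h1; rewrite lez_nat.
- by apply: vge_le h2; rewrite lez_nat.
- by move=> i; apply: vge_le (h3 i); rewrite lez_nat.
Qed.
End Purity.

Lemma curve_finitely_generated (C K : fieldType) (j : {rmorphism C -> K}) :
  function_field_of_smooth_projective_curve j ->
  exists (N : nat) (xi : 'I_N -> K), forall y : K, exists f g : {mpoly C[N]},
    mmap j xi g != 0 /\ y = mmap j xi f / mmap j xi g.
Proof.
move=> [N [eqs [_ [xi [_ gen]] _ _]]]; exists N.+1, xi => y.
by have [d [f [g [_ _ g0 ->]]]] := gen y; exists f, g.
Qed.

Lemma curve_nonconstant (C K : fieldType) (j : {rmorphism C -> K}) :
  has_trdeg j 1 -> exists t, ~ is_constant j t.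
Proof.
move=> [[y ind] _]; exists (y ord0) => -[c yc].
have p0 : 'X_ord0 - c%:MP = 0 :> {mpoly C[1]}.
  by apply: ind; rewrite mmapB mmapX mmap1U mmapC yc subrr.
have := congr1 (mcoeff U_(ord0)) p0; rewrite mcoeffB mcoeffX eqxx mcoeffC mcoeff0.
rewrite -mdeg_eq0 mdeg1 mulr0 subr0 => /eqP; by rewrite oner_eq0.
Qed.

Theorem mainTheorem2 (R : realType) (K : fieldType) (j : {rmorphism R[i] -> K})
  (hK : function_field_of_smooth_projective_curve j)
  (Kv : forall v : place j, completion v)
  (S : set (place j)) (hS : S !=set0) (finS : finite_set S)
  (n : nat) (hn : (3 <= n)%N)
  (q : {mpoly K[n]}) (hq : quadratic_form q) (ndq : nondegenerate_quadratic_form q)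
  (alpha : K) (halpha : alpha != 0) :
  purity_of_strong_approximation Kv S [:: q - alpha%:MP].
Proof.
have trdeg1 : has_trdeg j 1 by have [N [eqs [_ _ h _]]] := hK.
case: n hn q hq ndq => [|[|[|k]]] // _ q hq ndq.
apply: quadric_purity => //.
- exact: real_uncountable_pigeonhole.
- by move=> p; rewrite (fmorph_pchar j) pchar_num.
- by have [_ h] := trdeg1; exact: h.
- exact: curve_nonconstant.
- exact: curve_finitely_generated.
Qed.
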